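(* The flat odd-contact $F(4)$-supergeometry $(M^{1|8},\mathcal C,[\mathsf Q])$ has symmetry superalgebra $\mathfrak{inf}(M,\mathcal C,[\mathsf Q])$ isomorphic to $F(4)$.
   Context: Everything is over $\mathbb C$. $F(4)$ is the exceptional simple Lie superalgebra of dimension $(24|16)$ in Kac's classification, with even part $\mathfrak{so}(7)\oplus\mathfrak{sp}(2)$ and odd part $\mathbb S\boxtimes\mathbb C^2$. The flat odd-contact $F(4)$-supergeometry: $M^{1|8}=J^1(\mathbb C^{0|4},\mathbb C^{1|0})$ with coordinates $(x^i,u,u_i)$, $0\le i\le3$, where $x^i,u_i$ are odd and $u$ is even; $\mathcal C=\ker\sigma$ with $\sigma=du-\sum_i(dx^i)u_i$; and $[\mathsf Q]$ is the conformal class of the even supersymmetric 4-tensor on $\mathcal C$ $$\begin{aligned}\mathsf Q&=\omega^0\omega^1\theta_0\theta_1+\omega^0\omega^2\theta_0\theta_2+\omega^0\omega^3\theta_0\theta_3-2\omega^0\theta_1\theta_2\theta_3\\&\quad-\omega^1\omega^2\theta_1\theta_2-\omega^1\omega^3\theta_1\theta_3-\omega^2\omega^3\theta_2\theta_3+2\omega^1\omega^2\omega^3\theta_0\ \in\Gamma(\odot^4\mathcal C^* )\end{aligned}$$ with $(\omega^i,\theta_i)=(dx^i,du_i)$ restricted to $\mathcal C$ (the product is supersymmetric; $\mathsf Q$ is skew in the classical sense on odd generators of $\mathcal C$). Its symmetry superalgebra is $\mathfrak{inf}(M,\mathcal C,[\mathsf Q])=\{\mathbf X\in\mathfrak X(M):\mathcal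 L_{\mathbf X}\mathcal C\subset\mathcal C,\ \exists\,\mu\text{ with }\mathcal L_{\mathbf X}\mathsf Q=\mu\mathsf Q\text{ on }\mathcal C\}$. *)

(* Defs.v *)
From mathcomp Require Import all_boot all_order all_algebra.
From mathcomp Require Import complex.
From mathcomp Require Import boolp classical_sets functions reals topology.
From mathcomp Require Import normedtype derive.

Set Implicit Arguments.
Unset Strict Implicit.
Unset Printing Implicit Defensive.

Import GRing.Theory Num.Theory numFieldNormedType.Exports.
Local Open Scope ring_scope.

Section Superspace.
Variable K : numFieldType.

(* Superfunctions in one even variable u and n odd variables xi_0..xi_(n-1):
   f stands for the sum over S of f_S(u) xi_S, where xi_S is the product of
   the xi_i (i in S) in increasing order. *)
Definition sfun (n : nat) := {ffun {set 'I_n} -> (K -> K)}.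

(* For K the complex numbers: every coefficient is an entire function. *)
Definition holomorphic n (f : sfun n) : Prop :=
  forall (S : {set 'I_n}) (z : K), derivable (f S) z 1.

(* xi_A xi_B = (-1) ^ (inversions A B) xi_(A :|: B) for disjoint A and B. *)
Definition inversions n (A B : {set 'I_n}) : nat :=
  #|[set p : 'I_n * 'I_n | [&& p.1 \in A, p.2 \in B & (p.2 < p.1)%N]]|.

Definition smul n (f g : sfun n) : sfun n :=
  [ffun S : {set 'I_n} => fun z : K =>
     \sum_(A : {set 'I_n} | A \subset S)
        (-1) ^+ inversions A (S :\: A) * f A z * g (S :\: A) z].

Definition sone n : sfun n :=
  [ffun S : {set 'I_n} => fun=> (S == finset.set0)%:R].

Definition sgen n (i : 'I_n) : sfun n :=
  [ffun S : {set 'I_n} => fun=> (S == [set i])%:R].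

(* The even derivation d/du and the odd left derivations d/dxi_i. *)
Definition d_even n (f : sfun n) : sfun n :=
  [ffun S : {set 'I_n} => fun z : K => derive1 (f S) z].

Definition d_odd n (i : 'I_n) (f : sfun n) : sfun n :=
  [ffun S : {set 'I_n} => fun z : K =>
     if i \in S then 0 else (-1) ^+ inversions [set i] S * f (i |: S) z].

(* p = false is even, p = true is odd. *)
Definition sproj n (p : bool) (f : sfun n) : sfun n :=
  [ffun S : {set 'I_n} => if odd #|S| == p then f S else 0].

(* (a, b) stands for the vector field a d/du + sum_i b_i d/dxi_i. *)
Definition vfield (n : nat) := (sfun n * {ffun 'I_n -> sfun n})%type.

Definition vholomorphic n (X : vfield n) : Prop :=
  holomorphic X.1 /\ forall i, holomorphic (X.2 i).

Definition vapp n (X : vfield n) (f : sfun n) : sfun n :=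
  smul X.1 (d_even f) + \sum_(i < n) smul (X.2 i) (d_odd i f).

Definition vproj n (p : bool) (X : vfield n) : vfield n :=
  (sproj p X.1, [ffun i => sproj (~~ p) (X.2 i)]).

Definition vapp_comp n (X Y : vfield n) : vfield n :=
  (vapp X Y.1, [ffun i => vapp X (Y.2 i)]).

(* [X, Y] = X Y - (-1)^(|X| |Y|) Y X on homogeneous fields. *)
Definition vbracket n (X Y : vfield n) : vfield n :=
  \sum_(p : bool) \sum_(q : bool)
     (vapp_comp (vproj p X) (vproj q Y)
      - ((-1) ^+ (p && q) : K) *: vapp_comp (vproj q Y) (vproj p X)).

End Superspace.

Section ContactF4.
Variable K : numFieldType.

Local Notation "f ** g" := (smul f g) (at level 40, left associativity).

(* Odd coordinates of M^{1|8}: first x^0..x^3, then u_0..u_3. *)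
Definition ix (i : 'I_4) : 'I_(4 + 4) := lshift 4 i.
Definition iu (i : 'I_4) : 'I_(4 + 4) := rshift 4 i.

(* The value on Y of sigma = du - sum_i (dx^i) u_i. *)
Definition sigma (Y : vfield K (4 + 4)) : sfun K (4 + 4) :=
  Y.1 - \sum_(i < 4) Y.2 (ix i) ** sgen K (iu i).

Definition contact_section (Y : vfield K (4 + 4)) : Prop :=
  vholomorphic Y /\ sigma Y = 0.

Definition preserves_contact (X : vfield K (4 + 4)) : Prop :=
  forall Y, contact_section Y -> contact_section (vbracket X Y).

(* The supersymmetric covariant tensors on the contact distribution form the
   supercommutative algebra generated over the superfunctions of M by the odd
   elements omega^i = dx^i and theta_i = du_i.  We realize it as superfunctions
   in 8 + 8 odd variables: the first 8 are the coordinates (x, u), the last 8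
   are their differentials (omega, theta).  Here [pull] is the inclusion of
   the superfunctions of M. *)
Definition pull (f : sfun K (4 + 4)) : sfun K ((4 + 4) + (4 + 4)) :=
  [ffun S : {set 'I_((4 + 4) + (4 + 4))} =>
     if S \subset [set lshift (4 + 4) i | i : 'I_(4 + 4)]
     then f (lshift (4 + 4) @^-1: S) else 0].

Definition omega (i : 'I_4) : sfun K ((4 + 4) + (4 + 4)) :=
  sgen K (rshift (4 + 4) (ix i)).
Definition theta (i : 'I_4) : sfun K ((4 + 4) + (4 + 4)) :=
  sgen K (rshift (4 + 4) (iu i)).

(* df restricted to the distribution, where du = sum_i omega^i u_i:
   df = sum_i omega^i (d/dx^i + u_i d/du) f + sum_i theta_i (d/du_i) f. *)
Definition d_contact (f : sfun K (4 + 4)) : sfun K ((4 + 4) + (4 + 4)) :=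
  \sum_(i < 4) (omega i ** pull (d_odd (ix i) f + sgen K (iu i) ** d_even f)
                + theta i ** pull (d_odd (iu i) f)).

(* The Lie derivative along X is the superderivation of the tensor algebra with
   L_X f = X f and L_X (df) = d (X f) for superfunctions f (no sign, as d is
   even on supersymmetric forms); it descends to the distribution when X
   preserves it.  [lie_field X] is this superderivation, expressed as a vector
   field in the variables (u; x, u_i, omega, theta). *)
Definition lie_field (X : vfield K (4 + 4)) : vfield K ((4 + 4) + (4 + 4)) :=
  (pull X.1,
   [ffun a : 'I_((4 + 4) + (4 + 4)) => match fintype.split a with
              | inl b => pull (X.2 b)
              | inr b => d_contact (X.2 b)
              end]).

Definition lie_derivative (X : vfield K (4 + 4))
    (T : sfun K ((4 + 4) + (4 + 4))) : sfun K ((4 + 4) + (4 + 4)) :=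
  vapp (lie_field X) T.

Definition Qtensor : sfun K ((4 + 4) + (4 + 4)) :=
    omega 0 ** omega 1 ** theta 0 ** theta 1
  + omega 0 ** omega 2 ** theta 0 ** theta 2
  + omega 0 ** omega 3 ** theta 0 ** theta 3
  - (2 : K) *: (omega 0 ** theta 1 ** theta 2 ** theta 3)
  - omega 1 ** omega 2 ** theta 1 ** theta 2
  - omega 1 ** omega 3 ** theta 1 ** theta 3
  - omega 2 ** omega 3 ** theta 2 ** theta 3
  + (2 : K) *: (omega 1 ** omega 2 ** omega 3 ** theta 0).

Definition preserves_Q (X : vfield K (4 + 4)) : Prop :=
  exists2 mu : sfun K (4 + 4), holomorphic mu &
    lie_derivative X Qtensor = pull mu ** Qtensor.

Definition inf_MCQ : set (vfield K (4 + 4)) :=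
  [set X | [/\ vholomorphic X, preserves_contact X & preserves_Q X]]%classic.

End ContactF4.

Section F4.
Variable K : numFieldType.

(* Structure constants of the imaginary octonions, e_p e_q = e_r for
   (p, q, r) = (k, k + 1, k + 3) modulo 7 and its cyclic permutations. *)
Definition fano_line (p q r : 'I_7) : bool := (q == p + 1) && (r == p + 3).
Definition fano (p q r : 'I_7) : bool :=
  [|| fano_line p q r, fano_line q r p | fano_line r p q].
Definition oct (p q r : 'I_7) : K := (fano p q r)%:R - (fano q p r)%:R.

(* Left multiplication by e_p on the octonions, in the basis 1, e_0, .., e_6. *)
Definition gamma (p : 'I_7) : 'M[K]_(1 + 7) :=
  block_mx 0 (- delta_mx 0 p) (delta_mx p 0) (\matrix_(r, q) oct p q r).

Definition gamma2 (p q : 'I_7) : 'M[K]_(1 + 7) :=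
  2^-1 *: (gamma p *m gamma q - gamma q *m gamma p).

(* The spin representation; gamma p squares to -1, whence the sign. *)
Definition spin (A : 'M[K]_7) : 'M[K]_(1 + 7) :=
  - (4^-1 *: \sum_(p < 7) \sum_(q < 7) A p q *: gamma2 p q).

Definition symp : 'M[K]_2 := delta_mx 0 1 - delta_mx 1 0.

(* Elements (A, B, P): A in so(7), B in sp(2), and P in S (x) C^2 viewed as an
   8 x 2 matrix. *)
Definition f4_ambient := ('M[K]_7 * 'M[K]_2 * 'M[K]_(1 + 7, 2))%type.

Definition f4_set : set f4_ambient :=
  [set a | a.1.1^T = - a.1.1 /\ a.1.2^T *m symp + symp *m a.1.2 = 0]%classic.

Definition f4_homog (p : bool) : set f4_ambient :=
  [set a | if p then a.1 = 0 else a.2 = 0]%classic.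

(* The so(7)- and sp(2)-components of the bracket of two odd elements: the
   equivariant symmetric maps S^2 (S (x) C^2) -> so(7) and sp(2), the ratio
   -2/3 of the coefficients being forced by the Jacobi identity. *)
Definition odd_so (P Q : 'M[K]_(1 + 7, 2)) : 'M[K]_7 :=
  - (2 / 3) *: \matrix_(p, q) \tr (P^T *m gamma2 p q *m Q *m symp^T).
Definition odd_sp (P Q : 'M[K]_(1 + 7, 2)) : 'M[K]_2 :=
  (P^T *m Q + Q^T *m P) *m symp.

Definition f4_act (a : 'M[K]_7 * 'M[K]_2) (P : 'M[K]_(1 + 7, 2)) :
    'M[K]_(1 + 7, 2) :=
  spin a.1 *m P + P *m a.2^T.

Definition f4_bracket (a b : f4_ambient) : f4_ambient :=
  (a.1.1 *m b.1.1 - b.1.1 *m a.1.1 + odd_so a.2 b.2,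
   a.1.2 *m b.1.2 - b.1.2 *m a.1.2 + odd_sp a.2 b.2,
   f4_act a.1 b.2 - f4_act b.1 a.2).

End F4.

(* A Lie superalgebra presented inside a vector space: [sa_set] is the
   underlying subspace, [sa_homog p] cuts out its part of parity p. *)
Record superalgebra (K : numFieldType) := Superalgebra {
  sa_ambient : lmodType K;
  sa_set : set sa_ambient;
  sa_homog : bool -> set sa_ambient;
  sa_bracket : sa_ambient -> sa_ambient -> sa_ambient }.

Arguments sa_set {K} s _.
Arguments sa_homog {K} s _ _.
Arguments sa_bracket {K} s _ _.

Definition superalgebra_iso (K : numFieldType) (g h : superalgebra K) : Prop :=
  exists phi : sa_ambient g -> sa_ambient h,
  [/\ set_bij (sa_set g) (sa_set h) phi,
      forall (k : K) a b, sa_set g a -> sa_set g b ->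
        sa_set g (k *: a + b) /\ phi (k *: a + b) = k *: phi a + phi b,
      forall p a, sa_set g a -> sa_homog g p a -> sa_homog h p (phi a)
    & forall a b, sa_set g a -> sa_set g b ->
        sa_set g (sa_bracket g a b) /\
        phi (sa_bracket g a b) = sa_bracket h (phi a) (phi b)].

Definition inf_superalgebra (K : numFieldType) : superalgebra K :=
  Superalgebra (@inf_MCQ K) (fun p X => vproj p X = X) (@vbracket K (4 + 4)).

Definition F4 (K : numFieldType) : superalgebra K :=
  Superalgebra (@f4_set K) (@f4_homog K) (@f4_bracket K).

(* Main.v *)
From Stdlib Require Import ZArith Nnat.
Require Import Defs.
From mathcomp Require Import all_boot all_order all_algebra.
From mathcomp Require Import complex reals.
From mathcomp Require Import boolp classical_sets functions topology.
From mathcomp Require Import normedtype derive.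
From mathcomp Require constructive_ereal realfun measure lebesgue_measure.
From mathcomp Require lebesgue_integral ftc.
From mathcomp Require Import ring lra ssrZ zify.
Set Implicit Arguments.
Unset Strict Implicit.
Unset Printing Implicit Defensive.
Import Order.TTheory GRing.Theory Num.Theory.

Module EntireFunctions.
Import constructive_ereal realfun measure lebesgue_measure lebesgue_integral ftc.
Import ComplexField numFieldNormedType.Exports.
Local Open Scope classical_set_scope.
Local Open Scope ring_scope.

Section RealIntegral.
Variable R : realType.
Implicit Types (f g : R -> R) (a b c k : R).

Definition rint f a b : R :=
  \int[lebesgue_measure]_(x in `[a, b]) (f x).

Lemma itv_integrable f a b : continuous f ->
  lebesgue_measure.-integrable `[a, b] (EFin \o f).
Proof.
move=> cf; apply: continuous_compact_integrable; first exact: segment_compact.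
exact: continuous_subspaceT.
Qed.

Lemma rint_lin f g a b k : continuous f -> continuous g ->
  rint (fun x => k * f x + g x) a b = k * rint f a b + rint g a b.
Proof.
move=> cf cg; rewrite /rint RintegralD //.
- by rewrite RintegralZl //; apply: itv_integrable.
- apply: itv_integrable => x; apply: continuousM; [exact: cst_continuous|exact: cf].
- exact: itv_integrable.
Qed.

Lemma rint_FTC f (F : R -> R) a b : a <= b -> continuous f ->
  (forall x : R, is_derive x 1 F (f x)) -> rint f a b = F b - F a.
Proof.
rewrite le_eqVlt => /predU1P[<- _ _|ab cf dF].
  by rewrite subrr /rint set_itv1 Rintegral_set1.
have cF : continuous F.
  by move=> x; apply/differentiable_continuous/derivable1_diffP; case: (dF x).
rewrite /rint /Rintegral (@continuous_FTC2 R f F a b ab) //.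
- exact: continuous_subspaceT.
- split; first by move=> x _; case: (dF x).
    by apply: cvg_at_right_filter; apply: cF.
  by apply: cvg_at_left_filter; apply: cF.
- by move=> x _; rewrite derive1E; apply: derive_val.
Qed.

Lemma rint_bound f a b k : a <= b -> continuous f ->
  (forall x, a <= x <= b -> `|f x| <= k) -> `|rint f a b| <= k * (b - a).
Proof.
move=> ab cf fk; apply: (@le_trans _ _ (rint (fun=> k) a b)).
  apply: le_trans (le_normr_Rintegral _ _) _ => //; first exact: itv_integrable.
  apply: le_Rintegral => //.
  - apply: itv_integrable => x; apply: continuous_comp; first exact: cf.
    exact: norm_continuous.
  - by apply: itv_integrable => x; apply: cst_continuous.
have -> : rint (fun=> k) a b = k * b - k * a; last by rewrite mulrBr.
apply: (@rint_FTC (fun=> k) (fun x => k * x)) => // x; first exact: cst_continuous.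
by rewrite -[X in is_derive _ _ _ X]mulr1; apply: is_deriveZ.
Qed.

Lemma rint_split f a b c : a <= b -> b <= c -> continuous f ->
  rint f a c = rint f a b + rint f b c.
Proof.
move=> ab bc cf; rewrite /rint; apply/eqP; rewrite addrC -subr_eq; apply/eqP.
rewrite Rintegral_itvB ?bnd_simp//; last exact: itv_integrable.
by rewrite Rintegral_itv_obnd_cbnd //; apply: integrableS (itv_integrable b c cf) => //;
  apply: subset_itvr; rewrite bnd_simp.
Qed.

End RealIntegral.

Definition CF (R : realType) : numFieldType := R[i].
Section ComplexDeriv.
Variable R : realType.
Local Notation C := (CF R).
Local Notation nm := (@Normc.normc R).
Implicit Types (z w h d k : C) (f g : C -> C).

Lemma normE z : `|z| = (nm z)%:C%C. Proof. by []. Qed.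
Lemma nmM z w : nm (z * w) = nm z * nm w. Proof. exact: Normc.normcM. Qed.
Lemma nmD z w : nm (z + w) <= nm z + nm w. Proof. exact: le_normcD. Qed.
Lemma nmN z : nm (- z) = nm z. Proof. exact: normcN. Qed.
Lemma nmV z : nm z^-1 = (nm z)^-1. Proof. exact: Normc.normcV. Qed.
Lemma nm0 : nm 0 = 0. Proof. exact: Normc.normc0. Qed.
Lemma nm1 : nm 1 = 1. Proof. exact: Normc.normc1. Qed.
Lemma nmR (x : R) : nm x%:C%C = `|x|.
Proof. by rewrite /Normc.normc /= expr0n addr0 sqrtr_sqr. Qed.
Lemma nm_ge0 z : 0 <= nm z. Proof. by case: z => a b; apply: sqrtr_ge0. Qed.
Lemma nm_eq0 z : (nm z == 0) = (z == 0).
Proof. by apply/eqP/eqP => [/Normc.eq0_normc|->]//; rewrite nm0. Qed.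
Lemma nm_gt0 z : (0 < nm z) = (z != 0).
Proof. by rewrite lt_neqAle nm_ge0 andbT eq_sym nm_eq0. Qed.
Lemma nmB z w : nm (z - w) = nm (w - z). Proof. by rewrite -nmN opprB. Qed.
Lemma nmi : nm 'i%C = 1.
Proof. by rewrite /Normc.normc /= expr0n add0r expr1n sqrtr1. Qed.
Lemma nm_Re z : `|complex.Re z| <= nm z.
Proof.
case: z => a b /=; rewrite -sqrtr_sqr ler_sqrt ?lerDl ?sqr_ge0 // addr_ge0 ?sqr_ge0//.
Qed.
Lemma nm_Im z : `|complex.Im z| <= nm z.
Proof.
case: z => a b /=; rewrite -sqrtr_sqr ler_sqrt ?lerDr ?sqr_ge0 // addr_ge0 ?sqr_ge0//.
Qed.
Lemma nm_leD (z : C) : nm z <= `|complex.Re z| + `|complex.Im z|.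
Proof.
rewrite {1}[z]complexE; apply: le_trans (nmD _ _) _.
by rewrite nmM nmi mul1r !nmR.
Qed.

(** eps-delta forms *)
Lemma near_nm z (P : C -> Prop) :
  (\forall x \near z, P x) <-> exists2 r : R, 0 < r & forall h, nm h < r -> P (z + h).
Proof.
split.
  move=> /nbhs_ballP[e /= e0 He].
  exists (complex.Re e); first by move: e0; rewrite ltcE => /andP[].
  move=> h hr; apply: He; rewrite /ball /= opprD addrA subrr add0r normrN normE.
  rewrite ltcE /= hr andbT; move: e0; rewrite ltcE => /andP[/eqP e0 _].
  by rewrite e0.
move=> [r r0 Hr]; apply/nbhs_ballP; exists r%:C%C; first by rewrite /= ltcR.
move=> x; rewrite /ball /= distrC normE ltcR => xr.
by rewrite (_ : x = z + (x - z)); [apply: Hr|rewrite addrC subrK].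
Qed.

Lemma deriv_epsP f z d : is_derive z (1 : C) f d <->
  forall e : R, 0 < e -> exists2 r : R, 0 < r &
    forall h, nm h < r -> nm (f (z + h) - f z - d * h) <= e * nm h.
Proof.
split.
  move=> [df fd] e e0.
  have : (fun h => h^-1 *: ((f \o shift z) (h *: 1) - f z)) @ 0^' --> d.
    by rewrite -fd; exact: df.
  move=> /cvgrPdist_lt /(_ e%:C%C); rewrite ltcR => /(_ e0) /nbhs_ballP[r /= r0 Hr].
  exists (complex.Re r); first by move: r0; rewrite ltcE => /andP[].
  move=> h hr; have [->|h0] := eqVneq h 0.
    by rewrite addr0 subrr mulr0 subrr nm0 mulr0.
  have hrC : `|h| < r.
    rewrite normE ltcE /= hr andbT; move: r0; rewrite ltcE => /andP[/eqP -> _]//.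
  have := Hr h; rewrite /ball /= add0r normrN => /(_ hrC h0).
  rewrite normE ltcR => H; rewrite -ler_pdivrMr ?nm_gt0// -nmV -nmM.
  apply/ltW; rewrite nmB in H; apply: le_lt_trans H; rewrite le_eqVlt; apply/orP; left.
  apply/eqP; congr nm.
  rewrite /GRing.scale /= mulr1 [h + z]addrC mulrDl mulNr -[d * h / h]mulrA divff// mulr1.
  by rewrite mulrC.
move=> H.
have cv : (fun h => h^-1 *: ((f \o shift z) (h *: 1) - f z)) @ 0^' --> d.
  apply/cvgrPdist_lt => e e0.
  have e0R : 0 < complex.Re e by move: e0; rewrite ltcE => /andP[].
  have [|r r0 Hr] := H (complex.Re e / 2); first by rewrite divr_gt0.
  apply/nbhs_ballP; exists r%:C%C; first by rewrite /= ltcR.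
  move=> h; rewrite /ball /= add0r normrN normE ltcR => hr h0.
  rewrite normE ltcE /=; apply/andP; split.
    by move: e0; rewrite ltcE => /andP[/eqP ->].
  have := Hr h hr; rewrite -ler_pdivrMr ?nm_gt0// -nmV -nmM => {}Hr.
  rewrite nmB; apply: (@le_lt_trans _ _ (complex.Re e / 2)); last by lra.
  apply: le_trans Hr; rewrite le_eqVlt; apply/orP; left.
  apply/eqP; congr nm.
  rewrite /GRing.scale /= mulr1 [h + z]addrC [RHS]mulrDl mulNr -[d * h / h]mulrA divff// mulr1.
  by rewrite mulrC.
by apply: DeriveDef; [apply/cvg_ex; exists d|apply/cvg_lim => //].
Qed.
End ComplexDeriv.

Section CInt.
Variable R : realType.
Local Notation C := (CF R).
Local Notation nm := (@Normc.normc R).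
Local Notation Re := (@complex.Re R).
Local Notation Im := (@complex.Im R).
Local Notation Cr x := (x%:C%C : C).

Lemma real_deriv_eps (g : R -> R) (x l : R) :
  (forall e : R, 0 < e -> exists2 r : R, 0 < r &
    forall h, `|h| < r -> `|g (x + h) - g x - l * h| <= e * `|h|) ->
  is_derive x 1 g l.
Proof.
move=> H.
have cv : (fun h => h^-1 *: ((g \o shift x) (h *: 1) - g x)) @ 0^' --> l.
  apply/cvgrPdist_lt => e e0.
  have [|r r0 Hr] := H (e / 2); first by rewrite divr_gt0.
  apply/nbhs_ballP; exists r => // h; rewrite /ball /= add0r normrN => hr h0.
  have := Hr h hr; rewrite -ler_pdivrMr ?normr_gt0// -normfV -normrM => {}Hr.
  apply: (@le_lt_trans _ _ (e / 2)); last by lra.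
  apply: le_trans Hr; rewrite distrC le_eqVlt; apply/orP; left; apply/eqP; congr `|_|.
  by rewrite /GRing.scale /= mulr1 [h + x]addrC [RHS]mulrDl mulNr mulfK// mulrC.
by apply: DeriveDef; [apply/cvg_ex; exists l|apply/cvg_lim => //].
Qed.

Definition cder (phi : R -> C) t (l : C) :=
  is_derive t (1 : R) (Re \o phi) (Re l) /\ is_derive t (1 : R) (Im \o phi) (Im l).

Lemma path_deriv (f : C -> C) (z u d : C) (t : R) :
  is_derive (z + Cr t * u) 1 f d ->
  cder (fun s => f (z + Cr s * u)) t (d * u).
Proof.
move=> /deriv_epsP df.
have key (P : C -> R) : (forall w, `|P w| <= nm w) ->
    (forall v w, P (v - w) = P v - P w) -> (forall (h : R) v, P (v * Cr h) = P v * h) ->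
    is_derive t 1 (fun s => P (f (z + Cr s * u))) (P (d * u)).
  move=> Pn PB PZ; apply: real_deriv_eps => e e0.
  have e1 : 0 < e / (nm u + 1) by rewrite divr_gt0// ltr_wpDl ?nm_ge0.
  have [r r0 Hr] := df _ e1; exists (r / (nm u + 1)).
    by rewrite divr_gt0// ltr_wpDl ?nm_ge0.
  move=> h hr.
  have uh : nm (Cr h * u) <= `|h| * (nm u + 1).
    by rewrite nmM nmR ler_wpM2l// lerDl.
  have /Hr : nm (Cr h * u) < r.
    by apply: le_lt_trans uh _; rewrite -ltr_pdivlMr// ltr_wpDl ?nm_ge0.
  have -> : z + Cr t * u + Cr h * u = z + Cr (t + h) * u.
    by rewrite -addrA -mulrDl -rmorphD.
  move=> H; rewrite -PZ -!PB; apply: le_trans (Pn _) _.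
  rewrite -mulrA [u * _]mulrC; apply: le_trans H _.
  by rewrite -mulrA ler_wpM2l ?(ltW e0)// mulrC ler_pdivrMr// ltr_wpDl ?nm_ge0.
split; apply: key.
- exact: nm_Re.
- by move=> [a b] [a' b'].
- by move=> h [a b] /=; rewrite mulr0 subr0.
- exact: nm_Im.
- by move=> [a b] [a' b'].
- by move=> h [a b] /=; rewrite mulr0 add0r.
Qed.

Definition cint (phi : R -> C) (a b : R) : C :=
  Complex (rint (Re \o phi) a b) (rint (Im \o phi) a b).

Lemma continuous_Re (phi : R -> C) : continuous phi -> continuous (Re \o phi).
Proof.
move=> cp x; apply/cvgrPdist_lt => e e0; move/cvgrPdist_lt: (cp x) => /(_ (Cr e)).
rewrite ltcR => /(_ e0); apply: filterS => y; rewrite normE ltcR.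
apply: le_lt_trans; apply: le_trans (nm_Re (phi x - phi y)) => /=.
by case: (phi x) => ? ?; case: (phi y).
Qed.

Lemma continuous_Im (phi : R -> C) : continuous phi -> continuous (Im \o phi).
Proof.
move=> cp x; apply/cvgrPdist_lt => e e0; move/cvgrPdist_lt: (cp x) => /(_ (Cr e)).
rewrite ltcR => /(_ e0); apply: filterS => y; rewrite normE ltcR.
apply: le_lt_trans; apply: le_trans (nm_Im (phi x - phi y)) => /=.
by case: (phi x) => ? ?; case: (phi y).
Qed.

Lemma continuous_line (f : C -> C) (z u : C) :
  continuous f -> continuous (fun t : R => f (z + Cr t * u)).
Proof.
move=> cf t; suff cl : (fun s : R => z + Cr s * u) @ t --> z + Cr t * u.
  by apply: (@cvg_comp _ _ _ _ f _ _ _ cl); apply: cf.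
apply/cvgrPdist_lt => e; rewrite ltcE => /= /andP[/eqP ei e0].
have u1 : 0 < nm u + 1 by rewrite ltr_wpDl ?nm_ge0.
apply/nbhs_ballP; exists (Re e / (nm u + 1)); first by rewrite /= divr_gt0.
move=> s; rewrite /ball /= => st.
rewrite opprD addrACA subrr add0r -mulrBl -rmorphB /= normE ltcE /= ei eqxx /= nmM nmR.
apply: le_lt_trans (_ : _ <= `|t - s| * (nm u + 1)) _.
  by rewrite ler_wpM2l// lerDl.
by rewrite -ltr_pdivlMr.
Qed.

Lemma continuousZ_C (phi : R -> C) k : continuous phi -> continuous (fun t => k * phi t).
Proof. by move=> cp x; apply: continuousM; [exact: cst_continuous|exact: cp]. Qed.

Lemma cint_lin (phi psi : R -> C) (a b : R) (k : C) :
  continuous phi -> continuous psi ->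
  cint (fun t => k * phi t + psi t) a b = k * cint phi a b + cint psi a b.
Proof.
move=> cp cs; have [cpr cpi] := (continuous_Re cp, continuous_Im cp).
have [csr csi] := (continuous_Re cs, continuous_Im cs).
have cE (f g : R -> R) (l : R) : continuous f -> continuous g ->
    continuous (fun x => l * f x + g x).
  by move=> cf cg x; apply: cvgD; [apply: cvgM; [exact: cvg_cst|exact: cf]|exact: cg].
case: k => k1 k2; apply/eqP; rewrite eq_complex /=; apply/andP; split; apply/eqP.
- rewrite -addrA -mulNr -!rint_lin //; last exact: cE.
  congr rint; apply/funext => t /=; case: (phi t) (psi t) => [? ?] [? ?] /=; ring.
- rewrite -addrA -!rint_lin //; last exact: cE.
  congr rint; apply/funext => t /=; case: (phi t) (psi t) => [? ?] [? ?] /=; ring.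
Qed.

Lemma cint_bound (phi : R -> C) (a b M : R) : a <= b -> continuous phi ->
  (forall t, a <= t <= b -> nm (phi t) <= M) -> nm (cint phi a b) <= 2 * M * (b - a).
Proof.
move=> ab cp pM; apply: le_trans (nm_leD _) _ => /=.
rewrite -mulrA mulr2n mulrDl mul1r lerD//; apply: rint_bound => //.
- exact: continuous_Re.
- by move=> t /pM; apply: le_trans; exact: nm_Re.
- exact: continuous_Im.
- by move=> t /pM; apply: le_trans; exact: nm_Im.
Qed.

Lemma cint_split (phi : R -> C) (a b c : R) : a <= b -> b <= c -> continuous phi ->
  cint phi a c = cint phi a b + cint phi b c.
Proof.
move=> ab bc cp; have [cpr cpi] := (continuous_Re cp, continuous_Im cp).
by rewrite /cint !(rint_split ab bc).
Qed.

Lemma cint_FTC (phi Phi : R -> C) (a b : R) : a <= b -> continuous phi ->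
  (forall t, cder Phi t (phi t)) -> cint phi a b = Phi b - Phi a.
Proof.
move=> ab cp d; have [cpr cpi] := (continuous_Re cp, continuous_Im cp).
rewrite /cint; have -> : rint (Re \o phi) a b = Re (Phi b) - Re (Phi a).
  by apply: (@rint_FTC _ _ (Re \o Phi)) => // t; case: (d t).
have -> : rint (Im \o phi) a b = Im (Phi b) - Im (Phi a).
  by apply: (@rint_FTC _ _ (Im \o Phi)) => // t; case: (d t).
by case: (Phi b) => ? ?; case: (Phi a).
Qed.

Lemma cint0 (a b : R) : a <= b -> cint (fun=> 0) a b = 0.
Proof.
move=> ab; apply/eqP; rewrite -nm_eq0 eq_le nm_ge0 andbT.
apply: le_trans (cint_bound (M := 0) ab _ _) _.
- by move=> x; apply: cst_continuous.
- by move=> t _; rewrite nm0.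
- by rewrite mulr0 mul0r.
Qed.

Lemma cintZ (phi : R -> C) (a b : R) (k : C) : a <= b -> continuous phi ->
  cint (fun t => k * phi t) a b = k * cint phi a b.
Proof.
move=> ab cp; have c0 : continuous (fun _ : R => 0 : C) by move=> x; apply: cst_continuous.
have := cint_lin a b k cp c0; rewrite (cint0 ab) [RHS]addr0 => <-.
by congr cint; apply/funext => t; rewrite addr0.
Qed.

Lemma is_derive_continuous (f : C -> C) : (forall z : C, derivable f z 1) -> continuous f.
Proof. by move=> df z; apply/differentiable_continuous/derivable1_diffP. Qed.

Lemma deriv0_cst (f : C -> C) : (forall z : C, is_derive z 1 f 0) -> forall z, f z = f 0.
Proof.
move=> df z; apply/eqP; rewrite -subr_eq0; apply/eqP.
have := @cint_FTC (fun=> 0) (fun t => f (0 + Cr t * z)) 0 1 ler01.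
rewrite rmorph0 rmorph1 mul1r mul0r addr0 add0r => <-.
- exact: cint0.
- by move=> x; apply: cst_continuous.
- by move=> t; rewrite -[X in cder _ _ X](mul0r z); apply: path_deriv.
Qed.
End CInt.

Lemma continuous_affine (K : numFieldType) (k l p : K) :
  continuous (fun z : K => k + l * (z - p)).
Proof.
suff H (z : K^o) : {for z, continuous (fun z : K^o => k + l * (z - p))} by move=> z; exact: H.
apply: continuousD; first exact: cst_continuous.
apply: continuousM; first exact: cst_continuous.
by apply: continuousB; [exact: cvg_id|exact: cst_continuous].
Qed.

Section Goursat.
Variable R : realType.
Local Notation C := (CF R).
Local Notation nm := (@Normc.normc R).
Local Notation Re := (@complex.Re R).
Local Notation Im := (@complex.Im R).
Local Notation Cr x := (x%:C%C : C).
Local Notation pt x y := (@Complex R x y : C).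
Local Notation ii := ('i%C : C).
Implicit Types (g f : C -> C) (a b c d : R).

Definition rect g a b c d : C :=
  (cint (fun t => g (pt t c)) a b - cint (fun t => g (pt t d)) a b)
  + ii * (cint (fun t => g (pt b t)) c d - cint (fun t => g (pt a t)) c d).

Definition hcont g c := continuous (fun t : R => g (pt t c)).
Definition vcont g a := continuous (fun t : R => g (pt a t)).

Lemma hline (t c : R) : pt t c = pt 0 c + Cr t * 1.
Proof. by rewrite mulr1; apply/eqP; rewrite eq_complex /= add0r addr0 !eqxx. Qed.
Lemma vline (t a : R) : pt a t = pt a 0 + Cr t * 'i%C.
Proof. by apply/eqP; rewrite eq_complex /= !mulr0 !mul0r !mulr1 subr0 addr0 add0r addr0 !eqxx. Qed.

Lemma continuous_hcont g c : continuous g -> hcont g c.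
Proof.
move=> cg; rewrite /hcont (_ : (fun t => _) = (fun t : R => g (pt 0 c + Cr t * 1))).
  exact: continuous_line.
by apply/funext => t; rewrite -hline.
Qed.
Lemma continuous_vcont g a : continuous g -> vcont g a.
Proof.
move=> cg; rewrite /vcont (_ : (fun t => _) = (fun t : R => g (pt a 0 + Cr t * 'i%C))).
  exact: continuous_line.
by apply/funext => t; rewrite -vline.
Qed.

Definition econt g a b c d := [/\ hcont g c, hcont g d, vcont g b & vcont g a].

Lemma continuous_econt g a b c d : continuous g -> econt g a b c d.
Proof. by move=> cg; split; [exact: continuous_hcont|exact: continuous_hcont|exact: continuous_vcont|exact: continuous_vcont]. Qed.

Lemma rect_lin g f a b c d k : econt g a b c d -> econt f a b c d ->
  rect (fun z => k * g z + f z) a b c d = k * rect g a b c d + rect f a b c d.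
Proof.
move=> [g1 g2 g3 g4] [f1 f2 f3 f4]; rewrite /rect.
by rewrite (cint_lin _ _ _ g1 f1) (cint_lin _ _ _ g2 f2) (cint_lin _ _ _ g3 f3) (cint_lin _ _ _ g4 f4); ring.
Qed.

Lemma rect_FTC g f a b c d : a <= b -> c <= d -> econt g a b c d ->
  (forall t, is_derive (pt t c) 1 f (g (pt t c))) ->
  (forall t, is_derive (pt t d) 1 f (g (pt t d))) ->
  (forall t, is_derive (pt b t) 1 f (g (pt b t))) ->
  (forall t, is_derive (pt a t) 1 f (g (pt a t))) ->
  rect g a b c d = 0.
Proof.
move=> ab cd [g1 g2 g3 g4] d1 d2 d3 d4; rewrite /rect.
have hF (y : R) : hcont g y -> (forall t, is_derive (pt t y) 1 f (g (pt t y))) ->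
    cint (fun t => g (pt t y)) a b = f (pt b y) - f (pt a y).
  move=> gy dy; apply: (cint_FTC (Phi := fun t => f (pt t y))) => // t.
  rewrite (_ : (fun t => f _) = (fun t : R => f (pt 0 y + Cr t * 1))).
    by rewrite -[X in cder _ _ X]mulr1; apply: path_deriv; rewrite -hline.
  by apply/funext => s; rewrite -hline.
have vF (x : R) : vcont g x -> (forall t, is_derive (pt x t) 1 f (g (pt x t))) ->
    ii * cint (fun t => g (pt x t)) c d = f (pt x d) - f (pt x c).
  move=> gx dx.
  have e := cintZ ii cd gx.
  rewrite -e.
  apply: (cint_FTC (Phi := fun t => f (pt x t)) cd); first exact: continuousZ_C.
  move=> t; rewrite mulrC.
  rewrite (_ : (fun t => f _) = (fun t : R => f (pt x 0 + Cr t * 'i%C))).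
    by apply: path_deriv; rewrite -vline.
  by apply/funext => s; rewrite -vline.
by rewrite mulrBr !hF// !vF//; ring.
Qed.

Lemma rect_splitx g a m b c d : a <= m -> m <= b -> hcont g c -> hcont g d ->
  rect g a b c d = rect g a m c d + rect g m b c d.
Proof. by move=> am mb gc gd; rewrite /rect (cint_split am mb gc) (cint_split am mb gd); ring. Qed.

Lemma rect_splity g a b c m d : c <= m -> m <= d -> vcont g a -> vcont g b ->
  rect g a b c d = rect g a b c m + rect g a b m d.
Proof. by move=> am mb gc gd; rewrite /rect (cint_split am mb gc) (cint_split am mb gd); ring. Qed.

Lemma rect_bound g a b c d M : a <= b -> c <= d -> econt g a b c d ->
  (forall x y, a <= x <= b -> c <= y <= d -> nm (g (pt x y)) <= M) ->
  nm (rect g a b c d) <= 4 * M * ((b - a) + (d - c)).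
Proof.
move=> ab cd [g1 g2 g3 g4] gM; rewrite /rect.
apply: le_trans (nmD _ _) _; rewrite nmM nmi mul1r.
have -> : 4 * M * (b - a + (d - c)) = 2 * M * (b - a) + 2 * M * (b - a) + (2 * M * (d - c) + 2 * M * (d - c)) by ring.
have aa : a <= a <= b by rewrite lexx.
have bb : a <= b <= b by rewrite lexx andbT.
have cc : c <= c <= d by rewrite lexx.
have dd : c <= d <= d by rewrite lexx andbT.
apply: lerD; (apply: le_trans (nmD _ _) _; rewrite nmN); apply: lerD.
- by apply: (cint_bound ab g1) => t tt; apply: gM.
- by apply: (cint_bound ab g2) => t tt; apply: gM.
- by apply: (cint_bound cd g3) => t tt; apply: gM.
- by apply: (cint_bound cd g4) => t tt; apply: gM.
Qed.

Lemma rect_affine (k l p : C) a b c d : a <= b -> c <= d ->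
  rect (fun z => k + l * (z - p)) a b c d = 0.
Proof.
move=> ab cd.
have cg := @continuous_affine C k l p.
have dF (z : C) : is_derive z 1 (fun z : C => k * z + l / 2 * (z - p) ^+ 2) (k + l * (z - p)).
  apply/deriv_epsP => e e0; exists (e / (nm (l / 2) + 1)).
    by rewrite divr_gt0// ltr_wpDl// nm_ge0.
  move=> h hr; have -> : k * (z + h) + l / 2 * (z + h - p) ^+ 2 - (k * z + l / 2 * (z - p) ^+ 2) -
     (k + l * (z - p)) * h = (l / 2 * h) * h by field.
  rewrite nmM ler_wpM2r ?nm_ge0// nmM.
  move: hr; rewrite ltr_pdivlMr ?ltr_wpDl ?nm_ge0// => /ltW; apply: le_trans.
  by rewrite mulrC ler_wpM2l ?nm_ge0// lerDl.
exact: (rect_FTC ab cd (continuous_econt a b c d cg) (fun t => dF _) (fun t => dF _) (fun t => dF _) (fun t => dF _)).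
Qed.
End Goursat.

Lemma continuous_lincomb (K : numFieldType) (k : K) (f g : K -> K) :
  continuous f -> continuous g -> continuous (fun z => k * f z + g z).
Proof.
move=> cf cg; suff H (z : K^o) : {for z, continuous (fun z : K^o => k * f z + g z : K^o)} by move=> z; exact: H.
apply: continuousD; last exact: cg.
by apply: continuousM; [exact: cst_continuous|exact: cf].
Qed.

Section Goursat.
Variable R : realType.
Local Notation C := (CF R).
Local Notation nm := (@Normc.normc R).
Local Notation pt x y := (@Complex R x y : C).
Variables (g : C -> C) (a b c d : R).
Hypotheses (ab : a <= b) (cd : c <= d) (cg : continuous g).
Hypothesis dg : forall x y, a <= x <= b -> c <= y <= d -> derivable g (pt x y) 1.

Let V (p : R * R) (n : nat) : R :=
  nm (rect g p.1 (p.1 + (b - a) / 2 ^+ n) p.2 (p.2 + (d - c) / 2 ^+ n)).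

Definition quad (p : R * R) (n : nat) : R * R :=
  let w := (b - a) / 2 ^+ n.+1 in let h := (d - c) / 2 ^+ n.+1 in
  let big q := V p n <= 4 * V q n.+1 in
  if big p then p else
  if big (p.1 + w, p.2) then (p.1 + w, p.2) else
  if big (p.1, p.2 + h) then (p.1, p.2 + h) else (p.1 + w, p.2 + h).

Fixpoint corner (n : nat) : R * R :=
  if n is m.+1 then quad (corner m) m else (a, c).

Lemma half_pow (w : R) n : w / 2 ^+ n = w / 2 ^+ n.+1 + w / 2 ^+ n.+1.
Proof. by rewrite exprS invfM mulrCA mulrC; lra. Qed.

Lemma half_ge0 (w : R) n : 0 <= w -> 0 <= w / 2 ^+ n.
Proof. by move=> w0; rewrite divr_ge0// exprn_ge0. Qed.

Lemma V_quad p n : V p n <= 4 * V (quad p n) n.+1.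
Proof.
have w0 : 0 <= (b - a) / 2 ^+ n.+1 by rewrite half_ge0// subr_ge0.
have h0 : 0 <= (d - c) / 2 ^+ n.+1 by rewrite half_ge0// subr_ge0.
rewrite /quad; case: ifP => [//|/negbT]; rewrite -ltNge => b1.
case: ifP => [//|/negbT]; rewrite -ltNge => b2.
case: ifP => [//|/negbT]; rewrite -ltNge => b3; rewrite leNgt; apply/negP => b4.
suff : V p n <= V p n.+1 + V (p.1 + (b - a) / 2 ^+ n.+1, p.2) n.+1 +
   (V (p.1, p.2 + (d - c) / 2 ^+ n.+1) n.+1 +
    V (p.1 + (b - a) / 2 ^+ n.+1, p.2 + (d - c) / 2 ^+ n.+1) n.+1) by lra.
rewrite /V (half_pow _ n) (half_pow (d - c) n) !addrA; cbn [fst snd].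
set w := (b - a) / _ in w0 *; set h := (d - c) / _ in h0 *.
have [hc vc] := (fun y => @continuous_hcont R g y cg, fun x => @continuous_vcont R g x cg).
rewrite (@rect_splity _ g _ _ _ (p.2 + h)) ?lerDl //.
rewrite (@rect_splitx _ g _ (p.1 + w) _ p.2) ?lerDl //.
rewrite (@rect_splitx _ g _ (p.1 + w) _ (p.2 + h)) ?lerDl //.
by apply: le_trans (nmD _ _) _; rewrite -[X in _ <= X]addrA; apply: lerD; apply: nmD.
Qed.

Lemma V_corner n : V (a, c) 0 <= 4 ^+ n * V (corner n) n.
Proof.
elim: n => [|n IH]; first by rewrite expr0 mul1r.
apply: le_trans IH _; rewrite exprSr -mulrA ler_wpM2l ?exprn_ge0//; exact: V_quad.
Qed.

Lemma corner_step n : (corner n).1 <= (corner n.+1).1 /\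
  (corner n.+1).1 + (b - a) / 2 ^+ n.+1 <= (corner n).1 + (b - a) / 2 ^+ n /\
  (corner n).2 <= (corner n.+1).2 /\
  (corner n.+1).2 + (d - c) / 2 ^+ n.+1 <= (corner n).2 + (d - c) / 2 ^+ n.
Proof.
have w0 : 0 <= (b - a) / 2 ^+ n.+1 by rewrite half_ge0// subr_ge0.
have h0 : 0 <= (d - c) / 2 ^+ n.+1 by rewrite half_ge0// subr_ge0.
rewrite (half_pow _ n) (half_pow (d - c) n).
set w := (b - a) / _ in w0 *; set h := (d - c) / _ in h0 *.
rewrite [corner n.+1]/= /quad -/w -/h; move: (corner n) => p.
by case: ifP => _; [|case: ifP => _; [|case: ifP => _]] => /=; (split; [|split; [|split]]); lra.
Qed.

Lemma nested (u : nat -> R) (w : R) : 0 <= w ->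
  (forall n, u n <= u n.+1) -> (forall n, u n.+1 + w / 2 ^+ n.+1 <= u n + w / 2 ^+ n) ->
  exists x, forall n, u n <= x <= u n + w / 2 ^+ n.
Proof.
move=> w0 uS uwS.
have um n k : u n <= u (n + k)%N.
  by elim: k => [|k IH]; rewrite ?addn0// addnS (le_trans IH).
have uw n k : u (n + k)%N + w / 2 ^+ (n + k) <= u n + w / 2 ^+ n.
  by elim: k => [|k IH]; rewrite ?addn0// addnS; apply: le_trans IH.
have ub n : ubound (range u) (u n + w / 2 ^+ n).
  move=> _ [m _ <-]; apply: (@le_trans _ _ (u (n + m)%N)); first by rewrite addnC; apply: um.
  by apply: le_trans (uw n m); rewrite lerDl half_ge0.
exists (sup (range u)) => n; apply/andP; split.
  by apply: ub_le_sup; [exists (u 0%N + w / 2 ^+ 0)|exists n].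
by apply: ge_sup; [exists (u 0%N), 0%N|].
Qed.

Lemma goursat : rect g a b c d = 0.
Proof.
have [x xP] : exists x, forall n, (corner n).1 <= x <= (corner n).1 + (b - a) / 2 ^+ n.
  by apply: nested; [rewrite subr_ge0|move=> n; have := corner_step n; tauto..].
have [y yP] : exists y, forall n, (corner n).2 <= y <= (corner n).2 + (d - c) / 2 ^+ n.
  by apply: nested; [rewrite subr_ge0|move=> n; have := corner_step n; tauto..].
set D := (b - a) + (d - c).
have D0 : 0 <= D by rewrite addr_ge0// subr_ge0.
have V0 : V (a, c) 0 = nm (rect g a b c d).
  have [eb ed] : a + (b - a) = b /\ c + (d - c) = d by split; ring.
  by rewrite /V expr0 !divr1; cbn [fst snd]; rewrite eb ed.
have xab : a <= x <= b.
  by have /andP[x1 x2] := xP 0%N; apply/andP; split; move: x1 x2; rewrite /= expr0 divr1; lra.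
have ycd : c <= y <= d.
  by have /andP[x1 x2] := yP 0%N; apply/andP; split; move: x1 x2; rewrite /= expr0 divr1; lra.
have /derivableP := dg xab ycd; set l := 'D_1 g _ => /deriv_epsP dgl.
apply/eqP; rewrite -nm_eq0 eq_le nm_ge0 andbT -V0.
apply/ler_addgt0Pr => e e0; rewrite add0r.
have e1 : 0 < e / (4 * D ^+ 2 + 1) by rewrite divr_gt0// ltr_wpDl// mulr_ge0// exprn_ge0.
have [r r0 Hr] := dgl _ e1; set e' := e / _ in e1 Hr.
have [n Hn] : exists n, D / 2 ^+ n < r.
  exists (Num.bound (D / r)); set n := Num.bound _.
  have /archi_boundP Dn : 0 <= D / r by rewrite divr_ge0// ltW.
  rewrite ltr_pdivrMr ?exprn_gt0// mulrC -ltr_pdivrMr//.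
  by apply: lt_le_trans Dn _; rewrite -natrX ler_nat ltnW// ltn_expl.
apply: le_trans (V_corner n) _.
set p := corner n; have xn := xP n; have yn := yP n; rewrite -/p in xn yn.
set w := (b - a) / 2 ^+ n in xn; set h := (d - c) / 2 ^+ n in yn.
have w0 : 0 <= w by rewrite half_ge0// subr_ge0.
have h0 : 0 <= h by rewrite half_ge0// subr_ge0.
have whD : w + h = D / 2 ^+ n by rewrite /D mulrDl.
pose E z := (-1) * (g (pt x y) + l * (z - pt x y)) + g z.
have aff := @continuous_affine C (g (pt x y)) l (pt x y).
have -> : V p n = nm (rect E p.1 (p.1 + w) p.2 (p.2 + h)).
  rewrite /V (rect_lin (-1) (continuous_econt _ _ _ _ aff) (continuous_econt _ _ _ _ cg)).
  by rewrite rect_affine ?lerDl// mulr0 add0r.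
have cE : continuous E by exact: continuous_lincomb.
have -> : e = 4 ^+ n * (4 * (e' * (D / 2 ^+ n)) * (D / 2 ^+ n)) + e'.
  have P0 : 2 ^+ n != 0 :> R by rewrite expf_neq0 ?pnatr_eq0.
  have D1 : 4 * D ^+ 2 + 1 != 0.
    by apply: lt0r_neq0; rewrite ltr_wpDl ?mulr_ge0 ?exprn_ge0.
  have -> : 4 ^+ n = (2 ^+ n) ^+ 2 :> R by rewrite -exprM mulnC exprM; congr (_ ^+ _); ring.
  by rewrite /e'; move: (2 ^+ n) P0 => P P0; field; rewrite P0 D1.
apply: ler_wpDr; first exact: ltW.
rewrite ler_wpM2l ?exprn_ge0// -whD.
have := @rect_bound _ E p.1 (p.1 + w) p.2 (p.2 + h) (e' * (w + h)).
rewrite ![_ + w - _]addrC ![_ + h - _]addrC !addKr; apply; rewrite ?lerDl//.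
  exact: (continuous_econt _ _ _ _ cE).
move=> s t /andP[s1 s2] /andP[t1 t2].
move/andP: xn => [x1 x2]; move/andP: yn => [y1 y2].
have zE : pt s t = pt x y + pt (s - x) (t - y).
  by apply/eqP; rewrite eq_complex /= ![_ + (_ - _)]addrC !subrK !eqxx.
have zn : nm (pt (s - x) (t - y)) <= w + h.
  apply: le_trans (nm_leD _) _ => /=; apply: lerD; rewrite ler_norml; apply/andP; split; lra.
have /Hr : nm (pt (s - x) (t - y)) < r by apply: le_lt_trans zn _; rewrite whD.
rewrite -zE => H.
have -> : E (pt s t) = g (pt s t) - g (pt x y) - l * pt (s - x) (t - y).
  by rewrite /E zE; ring.
by apply: le_trans H _; rewrite ler_wpM2l// ltW.
Qed.
End Goursat.

Section AbstractDeriv.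
Variable K : numFieldType.
Implicit Types (f g q : K -> K) (z w : K).

Lemma derivable_quotient f z w : z != w -> derivable f z 1 ->
  derivable (fun x => (f x - f w) / (x - w)) z 1.
Proof.
move=> zw df; apply: derivableM.
  by apply: derivableB => //; exact: derivable_cst.
by apply: derivableV; [rewrite subr_eq0|apply: derivableB; [exact: derivable_id|exact: derivable_cst]].
Qed.

Lemma is_derive_comb (q1 q2 q3 q4 : K -> K) (k d1 d2 d3 d4 : K) z :
  is_derive z 1 q1 d1 -> is_derive z 1 q2 d2 -> is_derive z 1 q3 d3 -> is_derive z 1 q4 d4 ->
  is_derive z 1 (fun w => (q1 w - q2 w) + k * (q3 w - q4 w)) ((d1 - d2) + k * (d3 - d4)).
Proof.
by move=> D1 D2 D3 D4; apply: is_deriveD.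
Qed.

Lemma is_derive_prod f g df dg z :
  is_derive z 1 f df -> is_derive z 1 g dg ->
  is_derive z 1 (fun w => f w * g w) (df * g z + f z * dg).
Proof.
move=> Df Dg; have -> : df * g z + f z * dg = f z *: dg + g z *: df.
  by rewrite /GRing.scale /= addrC [g z * _]mulrC.
exact: is_deriveM.
Qed.

Lemma derivable_ratio f g z : g z != 0 -> derivable f z 1 -> derivable g z 1 ->
  derivable (fun w => f w / g w) z 1.
Proof. by move=> gz Df Dg; apply: derivableM => //; apply: derivableV. Qed.

Lemma is_derive_Ninv w z : z != w ->
  is_derive z 1 (fun x => - (x - w)^-1) ((z - w) ^- 2).
Proof.
move=> zw; have zw0 : z - w != 0 by rewrite subr_eq0.
have D : is_derive z 1 (fun x : K => x - w) 1.
  by rewrite -[X in is_derive _ _ _ X]subr0; apply: is_deriveB.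
have [dD eD] := D.
have D2 : is_derive z 1 (fun x : K => (x - w)^-1) (- (z - w) ^- 2).
  apply: DeriveDef; first exact: (@derivableV K K (fun x : K => x - w) z 1 zw0 dD).
  have := @deriveV K K (fun x : K => x - w) z 1 zw0 dD.
  by rewrite eD /GRing.scale /= mulr1.
by rewrite -[X in is_derive _ _ _ X]opprK; apply: is_deriveN.
Qed.
End AbstractDeriv.

Section Punctured.
Variable R : realType.
Local Notation C := (CF R).
Local Notation nm := (@Normc.normc R).
Local Notation pt x y := (@Complex R x y : C).

Lemma goursat_punctured (g : C -> C) (a b c d x0 y0 : R) :
  a < x0 < b -> c < y0 < d -> continuous g ->
  (forall z : C, z != pt x0 y0 -> derivable g z 1) -> rect g a b c d = 0.
Proof.
move=> /andP[ax xb] /andP[cy yd] cg dg.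
have hc y : hcont g y by exact: continuous_hcont.
have vc x : vcont g x by exact: continuous_vcont.
have [r r0 Hr] : exists2 r : R, 0 < r & forall h, nm h < r -> nm (g (pt x0 y0 + h)) <= nm (g (pt x0 y0)) + 1.
  have /cvgrPdist_lt /(_ 1 ltr01) /near_nm[r r0 Hr] := cg (pt x0 y0).
  exists r => // h /Hr; rewrite normE => H.
  have {}H : nm (g (pt x0 y0) - g (pt x0 y0 + h)) < 1 by rewrite -ltcR.
  apply: le_trans (_ : nm (g (pt x0 y0) + (g (pt x0 y0 + h) - g (pt x0 y0))) <= _).
    by rewrite [g (pt x0 y0) + (_ - _)]addrC subrK lexx.
  by apply: le_trans (nmD _ _) _; rewrite lerD2l nmB; apply: ltW.
set M := nm _ + 1 in Hr.
have M0 : 0 < M by rewrite ltr_wpDl// nm_ge0.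
apply/eqP; rewrite -nm_eq0 eq_le nm_ge0 andbT; apply/ler_addgt0Pr => e e0; rewrite add0r.
pose m := Num.min (Num.min (x0 - a) (b - x0)) (Num.min (Num.min (y0 - c) (d - y0)) (Num.min (r / 3) (e / (16 * M)))).
have m0 : 0 < m by rewrite !lt_min !subr_gt0 ax xb cy yd !divr_gt0// mulr_gt0.
have [m1 m2 m3 m4] : [/\ m <= x0 - a, m <= b - x0, m <= y0 - c & m <= d - y0].
  by split; rewrite /m !ge_min lexx ?orbT.
have [m5 m6] : m <= r / 3 /\ m <= e / (16 * M).
  by split; rewrite /m !ge_min lexx ?orbT.
move: m m0 m1 m2 m3 m4 m5 m6 => m m0 m1 m2 m3 m4 m5 m6.
rewrite (@rect_splity R g a b c (y0 - m) d (_ : _ <= _) (_ : _ <= _) (vc _) (vc _)); [|lra|lra].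
rewrite (@rect_splity R g a b (y0 - m) (y0 + m) d (_ : _ <= _) (_ : _ <= _) (vc _) (vc _)); [|lra|lra].
rewrite (@rect_splitx R g a (x0 - m) b (y0 - m) (y0 + m) (_ : _ <= _) (_ : _ <= _) (hc _) (hc _)); [|lra|lra].
rewrite (@rect_splitx R g (x0 - m) (x0 + m) b (y0 - m) (y0 + m) (_ : _ <= _) (_ : _ <= _) (hc _) (hc _)); [|lra|lra].
have G a' b' c' d' : a' <= b' -> c' <= d' ->
    [|| b' < x0, x0 < a', d' < y0 | y0 < c'] -> rect g a' b' c' d' = 0.
  move=> ab cd out; apply: goursat => // x y xab ycd; apply: dg; apply/eqP => -[ex ey].
  move: out xab ycd; rewrite ex ey => /or4P[] H /andP[H1 H2] /andP[H3 H4]; lra.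
rewrite (G a b c (y0 - m)); [|lra|lra|by apply/or4P; constructor 3; lra].
rewrite (G a b (y0 + m) d); [|lra|lra|by apply/or4P; constructor 4; lra].
rewrite (G a (x0 - m)); [|lra|lra|by apply/or4P; constructor 1; lra].
rewrite (G (x0 + m) b); [|lra|lra|by apply/or4P; constructor 2; lra].
rewrite !add0r !addr0.
apply: le_trans (rect_bound (M := M) _ _ (continuous_econt _ _ _ _ cg) _) _; [lra|lra| |].
  move=> x y /andP[x1 x2] /andP[y1 y2].
  rewrite (_ : pt x y = pt x0 y0 + pt (x - x0) (y - y0)).
    apply: Hr; apply: le_lt_trans (nm_leD _) _ => /=.
    have : `|x - x0| <= m by rewrite ler_norml; apply/andP; split; lra.
    have : `|y - y0| <= m by rewrite ler_norml; apply/andP; split; lra.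
    by move: `|_| `|_| => u v; lra.
  by apply/eqP; rewrite eq_complex /= ![_ + (_ - _)]addrC !subrK !eqxx.
have -> : 4 * M * (x0 + m - (x0 - m) + (y0 + m - (y0 - m))) = m * (16 * M) by ring.
by rewrite -ler_pdivlMr// mulr_gt0.
Qed.
End Punctured.

Section AbsK.
Variable K : numFieldType.
Lemma continuous_kernel (T : topologicalType) (phi l : T -> K) (w : K) n :
  continuous phi -> continuous l -> (forall t, l t != w) ->
  continuous (fun t => phi t * ((l t - w)^-1) ^+ n).
Proof.
move=> cp cl lw t; have cv : (fun t => (l t - w)^-1) @ t --> (l t - w)^-1.
  apply: cvgV; first by rewrite subr_eq0.
  by apply: cvgB; [exact: cl|exact: cvg_cst].
elim: n => [|n IH].
  by under eq_fun do rewrite expr0 mulr1; exact: cp.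
under eq_fun do rewrite exprSr mulrA.
exact: cvgM.
Qed.
Lemma continuous_lincombT (T : topologicalType) (phi psi : T -> K) (k : K) :
  continuous phi -> continuous psi -> continuous (fun t => k * phi t + psi t).
Proof.
move=> cp cs t; apply: cvgD; last exact: cs.
by apply: cvgM; [exact: cvg_cst|exact: cp].
Qed.
End AbsK.

Section Kernel.
Variable R : realType.
Local Notation C := (CF R).
Local Notation nm := (@Normc.normc R).
Variables (phi l : R -> C) (a b : R).
Hypotheses (ab : a <= b) (cp : continuous phi) (cl : continuous l).
Hypothesis l1 : forall t, 1 <= nm (l t).

Definition kern (n : nat) (w : C) : C := cint (fun t => phi t * ((l t - w)^-1) ^+ n) a b.

Lemma kern_away (w : C) t : nm w < 2^-1 -> 2^-1 <= nm (l t - w).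
Proof.
move=> w2; have : nm (l t) <= nm (l t - w) + nm w.
  by apply: le_trans (nmD _ _); rewrite subrK.
have := l1 t; lra.
Qed.

Lemma kern_neq (w : C) t : nm w < 2^-1 -> l t != w.
Proof.
move=> w2; rewrite -subr_eq0 -nm_gt0; apply: lt_le_trans (kern_away t w2).
by rewrite invr_gt0.
Qed.

Lemma kern_continuous n (w : C) : nm w < 2^-1 ->
  continuous (fun t => phi t * ((l t - w)^-1) ^+ n).
Proof.
move=> w2; have H := @continuous_kernel C R phi l w n cp cl (fun t => kern_neq t w2).
exact: H.
Qed.
Arguments kern_continuous : clear implicits.

Lemma phi_bounded : exists2 M, 0 <= M & forall t, a <= t <= b -> nm (phi t) <= M.
Proof.
have B (f : R -> R) : continuous f -> exists M, forall t, a <= t <= b -> `|f t| <= M.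
  move=> cf; have cn : {within `[a, b], continuous (fun t => `|f t|)}.
    apply: continuous_subspaceT => t; apply: continuous_comp; first exact: cf.
    exact: norm_continuous.
  have [c _ Hc] := EVT_max ab cn.
  by exists `|f c| => t tab; apply: Hc; rewrite in_itv.
have [M1 H1] := B _ (continuous_Re cp); have [M2 H2] := B _ (continuous_Im cp).
have aa : a <= a <= b by rewrite lexx.
exists (M1 + M2).
  by apply: addr_ge0; [apply: le_trans (H1 _ aa)|apply: le_trans (H2 _ aa)].
move=> t tab; apply: le_trans (nm_leD _) _; apply: lerD; [exact: H1|exact: H2].
Qed.

(* h (l - w)^-1 (l - w - h)^-1 is the increment of the kernel *)
Lemma kern_deriv (n : nat) (w : C) : (0 < n <= 2)%N -> nm w < 2^-1 ->
  is_derive w 1 (kern n) (n%:R * kern n.+1 w).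
Proof.
move=> n12 w2; have [M M0 HM] := phi_bounded; apply/deriv_epsP => e e0.
set r := Num.min (Num.min (2^-1 - nm w) 4^-1) (e / (512 * M * (b - a) + 1)).
have K1 : 0 < 512 * M * (b - a) + 1.
  by rewrite ltr_wpDl// !mulr_ge0// subr_ge0.
exists r; first by rewrite !lt_min subr_gt0 w2 invr_gt0 ltr0n /= divr_gt0.
move=> h; rewrite !lt_min => /andP[/andP[h1 h2] h3].
have wh : nm (w + h) < 2^-1 by apply: le_lt_trans (nmD _ _) _; lra.
pose D t := phi t * ((l t - (w + h))^-1) ^+ n - phi t * ((l t - w)^-1) ^+ n
       - (n%:R * h) * (phi t * ((l t - w)^-1) ^+ n.+1).
have [-> cD] : kern n (w + h) - kern n w - n%:R * kern n.+1 w * h = cint D a b /\ continuous D.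
  have c1 := kern_continuous n _ wh; have c2 := kern_continuous n _ w2.
  have c3 := kern_continuous n.+1 _ w2.
  rewrite /kern.
  have e1 : D =
     (fun t => (-1) * (phi t * ((l t - w)^-1) ^+ n) + ((- (n%:R * h)) * (phi t * ((l t - w)^-1) ^+ n.+1) +
         phi t * ((l t - (w + h))^-1) ^+ n)).
    by apply/funext => t; rewrite /D; ring.
  have c31 := @continuous_lincombT C R _ _ (- (n%:R * h)) c3 c1.
  have c231 := @continuous_lincombT C R _ _ (-1) c2 c31.
  split; last by rewrite e1.
  have E1 := cint_lin a b (-1) c2 c31; have E2 := cint_lin a b (- (n%:R * h)) c3 c1.
  cbv beta in E1, E2.
  rewrite e1 E1 E2; move: (cint _ a b) (cint _ a b) (cint _ a b) => x y z; ring.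
apply: le_trans (cint_bound (M := 128 * M * nm h * nm h) ab cD _) _.
- move=> t tab; have lw := kern_neq t w2; have lwh := kern_neq t wh.
  have A2 : nm ((l t - w)^-1) <= 2.
    rewrite nmV -[leRHS]invrK lef_pV2 ?posrE ?invr_gt0 ?nm_gt0 ?subr_eq0//; exact: kern_away.
  have B2 : nm ((l t - (w + h))^-1) <= 2.
    rewrite nmV -[leRHS]invrK lef_pV2 ?posrE ?invr_gt0 ?nm_gt0 ?subr_eq0//; exact: kern_away.
  have BA : (l t - (w + h))^-1 - (l t - w)^-1 = h * (l t - w)^-1 * (l t - (w + h))^-1.
    by field; rewrite !subr_eq0 lw lwh.
  move: A2 B2 BA; set A := (l t - w)^-1; set B := (l t - (w + h))^-1 => A2 B2 BA.
  rewrite /D -/A -/B; clear D cD; have [X -> X4] : exists2 X, phi t * B ^+ n - phi t * A ^+ n - n%:R * h * (phi t * A ^+ n.+1) =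
      phi t * (h * h * X) & nm X <= 128.
    have EB : B = A + h * A * B by rewrite -BA; ring.
    have nA := nm_ge0 A; have nB := nm_ge0 B.
    case: n n12 => [//|[|[|//]]] _.
      exists (A * A * B); last by rewrite !nmM; nra.
      by rewrite [in LHS]EB [in LHS]EB; ring.
    exists (A * A * B * (B + 2 * A)); last first.
      have B2A : nm (B + 2 * A) <= 6.
        apply: le_trans (nmD _ _) _; rewrite nmM.
        have -> : nm 2 = 2 by rewrite -(rmorph_nat (real_complex R)) nmR ger0_norm.
        lra.
      rewrite !nmM; have : nm A * nm A * nm B <= 8 by nra.
      have := nm_ge0 (B + 2 * A); have : 0 <= nm A * nm A * nm B by rewrite !mulr_ge0.
      move: (nm A * nm A * nm B) (nm (B + 2 * A)) B2A => u v; nra.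
    have E2 : B - A = h * A * B by [].
    transitivity (phi t * (h * A * ((B - A) * (B + 2 * A)))); last by rewrite E2; ring.
    transitivity (phi t * ((B - A) * (B + A) - 2 * h * A * A * A)); first by ring.
    by rewrite [in LHS]E2; congr (_ * _); transitivity (h * A * (B * (B + A) - 2 * A * A)); ring.
  rewrite !nmM; have := HM t tab; have := nm_ge0 (phi t); have := nm_ge0 h; have := nm_ge0 X.
  move: (nm (phi t)) (nm h) (nm X) X4 => u v x x128 x0 v0 u0 uM.
  have : u * x <= M * 128 by apply: ler_pM.
  have vv : 0 <= v * v by apply: mulr_ge0.
  have -> : u * (v * v * x) = (u * x) * (v * v) by ring.
  have -> : 128 * M * v * v = (M * 128) * (v * v) by ring.
  exact: ler_wpM2r.
- have -> : 2 * (128 * M * nm h * nm h) * (b - a) = (256 * M * (b - a) * nm h) * nm h by ring.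
  apply: ler_wpM2r; first exact: nm_ge0.
  move: h3; rewrite ltr_pdivlMr// => /ltW; apply: le_trans.
  rewrite mulrC; apply: ler_wpM2l; first exact: nm_ge0.
  have : 0 <= M * (b - a) by rewrite mulr_ge0// subr_ge0.
  by rewrite -!mulrA; move: (M * (b - a)) => u; lra.
Qed.
End Kernel.

Section Cauchy.
Variable R : realType.
Local Notation C := (CF R).
Local Notation nm := (@Normc.normc R).
Local Notation pt x y := (@Complex R x y : C).
Local Notation ii := ('i%C : C).

Lemma continuous_eps (g : C -> C) :
  (forall z (e : R), 0 < e -> exists2 r : R, 0 < r &
     forall h, nm h < r -> nm (g (z + h) - g z) <= e) -> continuous g.
Proof.
move=> H z; have FF : Filter (nbhs z) := @nbhs_filter C z.
apply/(@cvgrPdist_lt _ _ _ _ FF) => e; rewrite ltcE => /= /andP[/eqP ei e0].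
have [|r r0 Hr] := H z (complex.Re e / 2); first by rewrite divr_gt0.
apply: (proj2 (near_nm z (fun t => `|g z - g t| < e))); exists r => // h /Hr Hh.
rewrite normE ltcE /= ei eqxx /= -/(nm _) nmB; apply: le_lt_trans Hh _; lra.
Qed.

Lemma derivable_off (g q : C -> C) (w z : C) : z != w ->
  (forall x, x != w -> g x = q x) -> derivable q z 1 -> derivable g z 1.
Proof.
move=> zw gq /derivableP /deriv_epsP dq.
suff : is_derive z 1 g ('D_1 q z) by case.
apply/deriv_epsP => e e0; have [r r0 Hr] := dq e e0.
exists (Num.min r (nm (z - w))); first by rewrite lt_min r0 nm_gt0 subr_eq0.
move=> h; rewrite lt_min => /andP[hr hzw]; rewrite !gq//; first exact: Hr.
apply/eqP => E; move: hzw; rewrite -E opprD addrA subrr add0r nmN; lra.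
Qed.

Lemma edge_h (s t : R) : `|s| = 1 -> 1 <= nm (pt t s).
Proof. by move=> s1; have := nm_Im (pt t s); rewrite /= s1. Qed.
Lemma edge_v (s t : R) : `|s| = 1 -> 1 <= nm (pt s t).
Proof. by move=> s1; have := nm_Re (pt s t); rewrite /= s1. Qed.
Lemma continuous_idC : continuous (fun z : C => z).
Proof. by move=> z; apply: cvg_id. Qed.
Lemma N11 : `|-1 : R| = 1. Proof. by rewrite normrN1. Qed.
Lemma P11 : `|1 : R| = 1. Proof. by rewrite normr1. Qed.

Definition Q (n : nat) (f : C -> C) (w : C) : C :=
  rect (fun z => f z * ((z - w)^-1) ^+ n) (-1) 1 (-1) 1.

Lemma Q_kern n (f : C -> C) (w : C) : Q n f w =
  (kern (fun t => f (pt t (-1))) (fun t => pt t (-1)) (-1) 1 n w -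
   kern (fun t => f (pt t 1)) (fun t => pt t 1) (-1) 1 n w) +
  ii * (kern (fun t => f (pt 1 t)) (fun t => pt 1 t) (-1) 1 n w -
   kern (fun t => f (pt (-1) t)) (fun t => pt (-1) t) (-1) 1 n w).
Proof. by []. Qed.

Lemma Q_deriv n (f : C -> C) (w : C) : (0 < n <= 2)%N -> continuous f -> nm w < 2^-1 ->
  is_derive w 1 (Q n f) (n%:R * Q n.+1 f w).
Proof.
move=> n12 cf w2.
have ab : -1 <= 1 :> R by lra.
have D1 := @kern_deriv R _ _ (-1) 1 ab (@continuous_hcont R _ (-1) cf) (@continuous_hcont R _ (-1) continuous_idC)
   (fun t => edge_h t N11) n w n12 w2.
have D2 := @kern_deriv R _ _ (-1) 1 ab (@continuous_hcont R _ 1 cf) (@continuous_hcont R _ 1 continuous_idC)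
   (fun t => edge_h t P11) n w n12 w2.
have D3 := @kern_deriv R _ _ (-1) 1 ab (@continuous_vcont R _ 1 cf) (@continuous_vcont R _ 1 continuous_idC)
   (fun t => edge_v t P11) n w n12 w2.
have D4 := @kern_deriv R _ _ (-1) 1 ab (@continuous_vcont R _ (-1) cf) (@continuous_vcont R _ (-1) continuous_idC)
   (fun t => edge_v t N11) n w n12 w2.
have := is_derive_comb ii D1 D2 D3 D4.
rewrite Q_kern.
have -> : forall x y z t : C, n%:R * ((x - y) + ii * (z - t)) =
   (n%:R * x - n%:R * y) + ii * (n%:R * z - n%:R * t) by move=> x y z t; ring.
exact.
Qed.

Lemma Q_econt n (f : C -> C) (w : C) : continuous f -> nm w < 2^-1 ->
  econt (fun z => f z * ((z - w)^-1) ^+ n) (-1) 1 (-1) 1.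
Proof.
move=> cf w2; split.
- exact: (@kern_continuous R _ _ (@continuous_hcont R _ (-1) cf) (@continuous_hcont R _ (-1) continuous_idC)
   (fun t => edge_h t N11) n w w2).
- exact: (@kern_continuous R _ _ (@continuous_hcont R _ 1 cf) (@continuous_hcont R _ 1 continuous_idC)
   (fun t => edge_h t P11) n w w2).
- exact: (@kern_continuous R _ _ (@continuous_vcont R _ 1 cf) (@continuous_vcont R _ 1 continuous_idC)
   (fun t => edge_v t P11) n w w2).
- exact: (@kern_continuous R _ _ (@continuous_vcont R _ (-1) cf) (@continuous_vcont R _ (-1) continuous_idC)
   (fun t => edge_v t N11) n w w2).
Qed.

Lemma edge_neq (z w : C) : 1 <= nm z -> nm w < 2^-1 -> z != w.
Proof. by move=> z1 w2; apply/eqP => E; move: z1 w2; rewrite E; lra. Qed.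

Lemma cauchy (f : C -> C) (w : C) : (forall z : C, derivable f z 1) -> nm w < 2^-1 ->
  Q 1 f w = f w * Q 1 (fun=> 1) w.
Proof.
move=> df w2; have cf := is_derive_continuous df.
pose q (z : C) := (f z - f w) / (z - w).
pose g (z : C) := if z == w then 'D_1 f w else q z.
have gq x : x != w -> g x = q x by rewrite /g => /negbTE ->.
have dg z : z != w -> derivable g z 1.
  by move=> zw; apply: (derivable_off zw gq); apply: derivable_quotient.
have cg : continuous g.
  apply: continuous_eps => z e e0; have [->|zw] := eqVneq z w.
    have /deriv_epsP/(_ e e0)[r r0 Hr] := @derivableP _ _ _ _ _ _ (df w).
    exists r => // h /Hr H; have [->|h0] := eqVneq h 0.
      by rewrite addr0 subrr nm0 ltW.
    have wh : w + h != w by rewrite -subr_eq0 addrC addKr.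
    rewrite gq// /g eqxx /q [w + h - w]addrC addKr.
    have -> : (f (w + h) - f w) / h - 'D_1 f w = (f (w + h) - f w - 'D_1 f w * h) / h.
      by rewrite [RHS]mulrBl mulfK.
    by rewrite nmM nmV ler_pdivrMr ?nm_gt0.
  have /derivableP/deriv_epsP/(_ 1 ltr01)[r r0 Hr] := dg z zw.
  set d := 'D_1 g z in Hr; have d1 : 0 < nm d + 1 by rewrite ltr_wpDl// nm_ge0.
  exists (Num.min r (e / (nm d + 1))); first by rewrite lt_min r0 divr_gt0.
  move=> h; rewrite lt_min => /andP[/Hr H1 H2].
  have -> : g (z + h) - g z = (g (z + h) - g z - d * h) + d * h by rewrite subrK.
  apply: le_trans (nmD _ _) _; move: H2; rewrite ltr_pdivlMr// nmM.
  move: H1; move: (nm _) (nm h) (nm d) => u v x; nra.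
have wb : nm w < 1 by lra.
have [w1 w3] : -1 < complex.Re w < 1 /\ -1 < complex.Im w < 1.
  by split; rewrite -ltr_norml; apply: le_lt_trans wb; [exact: nm_Re|exact: nm_Im].
have := @goursat_punctured R g (-1) 1 (-1) 1 _ _ w1 w3 cg.
have -> : pt (complex.Re w) (complex.Im w) = w by case: (w).
move=> /(_ dg) G0.
pose g2 (z : C) := (- f w) * (1 * ((z - w)^-1) ^+ 1) + f z * ((z - w)^-1) ^+ 1.
have gg2 z : 1 <= nm z -> g z = g2 z.
  by move=> z1; rewrite gq ?edge_neq// /q /g2 !expr1; ring.
have R2 : rect g (-1) 1 (-1) 1 = rect g2 (-1) 1 (-1) 1.
  rewrite /rect; congr (_ - _ + _ * (_ - _)); congr cint; apply/funext => t; apply: gg2.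
  - exact: edge_h N11.
  - exact: edge_h P11.
  - exact: edge_v P11.
  - exact: edge_v N11.
have c1 : continuous (fun _ : C => 1 : C) by move=> z; apply: cst_continuous.
have := rect_lin (- f w) (Q_econt 1 c1 w2) (Q_econt 1 cf w2).
rewrite -/(g2) -R2 G0 -/(Q 1 f w) -/(Q 1 (fun=> 1) w) => /eqP.
by rewrite mulNr addrC eq_sym subr_eq0 => /eqP.
Qed.
End Cauchy.

Section Entire.
Variable R : realType.
Local Notation C := (CF R).
Local Notation nm := (@Normc.normc R).
Local Notation pt x y := (@Complex R x y : C).

Lemma is_derive_near (f g : C -> C) (z d : C) (s : R) : 0 < s ->
  (forall h, nm h < s -> g (z + h) = f (z + h)) -> is_derive z 1 f d -> is_derive z 1 g d.
Proof.
move=> s0 gf /deriv_epsP H; apply/deriv_epsP => e e0; have [r r0 Hr] := H e e0.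
exists (Num.min r s); first by rewrite lt_min r0.
move=> h; rewrite lt_min => /andP[hr hs]; rewrite gf//.
have := gf 0; rewrite addr0 nm0 => ->//; exact: Hr.
Qed.

Lemma is_derive_shift (f : C -> C) (z w d : C) :
  is_derive (w + z) 1 f d <-> is_derive z 1 (fun x => f (w + x)) d.
Proof.
split=> /deriv_epsP H; apply/deriv_epsP => e e0; have [r r0 Hr] := H e e0;
  by exists r => // h /Hr; rewrite addrA.
Qed.

Lemma is_derive_uniq (f : C -> C) (z d1 d2 : C) :
  is_derive z 1 f d1 -> is_derive z 1 f d2 -> d1 = d2.
Proof. by move=> [_ <-] [_ <-]. Qed.

Lemma Q2_1 (w : C) : nm w < 2^-1 -> Q 2 (fun=> 1) w = 0.
Proof.
move=> w2; have ab : -1 <= 1 :> R by lra.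
have c1 : continuous (fun _ : C => 1 : C) by move=> z; apply: cst_continuous.
have D (z : C) : 1 <= nm z ->
    is_derive z 1 (fun x : C => - (x - w)^-1) (1 * ((z - w)^-1) ^+ 2).
  by move=> z1; rewrite mul1r exprVn; apply: is_derive_Ninv; apply: edge_neq.
apply: (rect_FTC (f := fun x : C => - (x - w)^-1) ab ab (Q_econt 2 c1 w2)) => t; apply: D.
- exact: edge_h (N11 R).
- exact: edge_h (P11 R).
- exact: edge_v (P11 R).
- exact: edge_v (N11 R).
Qed.

Lemma arctan_integral : 1 <= rint (fun t : R => (t ^+ 2 + 1)^-1) (-1) 1.
Proof.
have ab : -1 <= 1 :> R by lra.
have t0 (t : R) : 0 < t ^+ 2 + 1 by rewrite ltr_wpDl// sqr_ge0.
have cg : continuous (fun t : R => (t ^+ 2 + 1)^-1).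
  move=> t; apply: cvgV; first by rewrite gt_eqF.
  by apply: cvgD; [apply: exprn_continuous|exact: cvg_cst].
have cc (k : R) : continuous (fun _ : R => k) by move=> t; apply: cst_continuous.
have := @rint_lin R _ _ (-1) 1 (-1) (cc (3 / 4)) cg.
have -> : rint (fun=> 3 / 4) (-1) 1 = 3 / 4 * 1 - 3 / 4 * (-1) :> R.
  apply: (rint_FTC (F := fun t => 3 / 4 * t) ab (cc _)) => t.
  by rewrite -[X in is_derive _ _ _ X]mulr1; apply: is_deriveZ.
have : `|rint (fun t : R => (-1) * (3 / 4) + (t ^+ 2 + 1)^-1) (-1) 1| <= 4^-1 * (1 - (-1)).
  apply: rint_bound => //.
    by move=> t; apply: cvgD; [exact: cvg_cst|exact: cg].
  move=> t /andP[ta tb]; rewrite ler_norml; have t1 : t ^+ 2 <= 1 by rewrite expr2; nra.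
  apply/andP; split.
    have : 2^-1 <= (t ^+ 2 + 1)^-1 by rewrite lef_pV2 ?posrE//; lra.
    move: ((t ^+ 2 + 1)^-1) => u; lra.
  have : (t ^+ 2 + 1)^-1 <= 1 by rewrite invf_le1// lerDr sqr_ge0.
  move: ((t ^+ 2 + 1)^-1) => u; lra.
rewrite ler_norml => /andP[H1 H2] E; move: H1 H2; rewrite E.
by move: (rint _ _ _) => u; lra.
Qed.

Lemma Q1_1_neq0 : Q 1 (fun=> 1) (0 : C) != 0.
Proof.
have t0 (t : R) : t ^+ 2 + 1 != 0 by rewrite gt_eqF// ltr_wpDl// sqr_ge0.
have H (s t : R) : s ^+ 2 = 1 ->
    1 * ((pt t s - 0)^-1) ^+ 1 = pt (t / (t ^+ 2 + 1)) (- s / (t ^+ 2 + 1)).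
  by move=> s1; rewrite mul1r expr1 subr0; apply/eqP; rewrite eq_complex /= s1 mulNr !eqxx.
have V (s t : R) : s ^+ 2 = 1 ->
    1 * ((pt s t - 0)^-1) ^+ 1 = pt (s / (t ^+ 2 + 1)) (- t / (t ^+ 2 + 1)).
  by move=> s1; rewrite mul1r expr1 subr0; apply/eqP; rewrite eq_complex /= s1 mulNr addrC !eqxx.
have : complex.Im (Q 1 (fun=> 1) (0 : C)) = 4 * rint (fun t : R => (t ^+ 2 + 1)^-1) (-1) 1.
  have e2 : (-1) ^+ 2 = 1 :> R by rewrite sqrrN expr1n.
  have f2 : 1 ^+ 2 = 1 :> R by rewrite expr1n.
  have ab : -1 <= 1 :> R by lra.
  have cg : continuous (fun t : R => (t ^+ 2 + 1)^-1).
    move=> t; apply: cvgV; first exact: t0.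
    by apply: cvgD; [apply: exprn_continuous|exact: cvg_cst].
  have cz : continuous (fun _ : R => 0 : R) by move=> t; apply: cst_continuous.
  have N : rint (fun t : R => - (t ^+ 2 + 1)^-1) (-1) 1 = - rint (fun t : R => (t ^+ 2 + 1)^-1) (-1) 1.
    have := rint_lin (-1) 1 (-1) cg cz.
    have -> : rint (fun=> 0) (-1) 1 = 0 - 0 :> R.
      by apply: (rint_FTC (F := fun=> 0) ab cz) => t; apply: is_derive_cst.
    rewrite subrr addr0 mulN1r => <-; congr rint; apply/funext => t.
    by rewrite mulN1r addr0.
  rewrite /Q /rect.
  have EH (s : R) : s ^+ 2 = 1 -> complex.Im (cint (fun t => 1 * ((pt t s - 0)^-1) ^+ 1) (-1) 1) =
     rint (fun t => - s / (t ^+ 2 + 1)) (-1) 1.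
    by move=> s1; rewrite /cint /=; congr rint; apply/funext => t; rewrite /comp (H _ _ s1).
  have EV (s : R) : s ^+ 2 = 1 -> complex.Re (cint (fun t => 1 * ((pt s t - 0)^-1) ^+ 1) (-1) 1) =
     rint (fun t => s / (t ^+ 2 + 1)) (-1) 1.
    by move=> s1; rewrite /cint /=; congr rint; apply/funext => t; rewrite /comp (V _ _ s1).
  have ImE (x y z t : C) : complex.Im ((x - y) + ('i%C : C) * (z - t)) =
     (complex.Im x - complex.Im y) + (complex.Re z - complex.Re t).
    by case: x y z t => [? ?] [? ?] [? ?] [? ?] /=; ring.
  rewrite ImE !EH// !EV//.
  have -> : (fun t : R => - -1 / (t ^+ 2 + 1)) = (fun t => (t ^+ 2 + 1)^-1).
    by apply/funext => t; rewrite opprK mul1r.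
  have -> : (fun t : R => 1 / (t ^+ 2 + 1)) = (fun t => (t ^+ 2 + 1)^-1).
    by apply/funext => t; rewrite mul1r.
  have -> : (fun t : R => -1 / (t ^+ 2 + 1)) = (fun t => - (t ^+ 2 + 1)^-1).
    by apply/funext => t; rewrite mulN1r.
  by rewrite N; move: (rint _ _ _) => u; ring.
have := arctan_integral; move: (rint _ _ _) => u u1 E; apply/eqP => Q0.
by move: E; rewrite Q0 /=; lra.
Qed.

Lemma entire_derivable0 (f : C -> C) : (forall z : C, derivable f z 1) ->
  derivable (derive1 f) (0 : C) 1.
Proof.
move=> df; have cf := is_derive_continuous df.
have c1 : continuous (fun _ : C => 1 : C) by move=> z; apply: cst_continuous.
have n1 : (0 < 1 <= 2)%N by []. have n2 : (0 < 2 <= 2)%N by [].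
have c' (w : C) : nm w < 2^-1 -> is_derive w 1 (Q 1 (fun=> 1)) 0.
  by move=> w2; have := Q_deriv n1 c1 w2; rewrite (Q2_1 w2) mulr0.
have fc (w : C) : nm w < 2^-1 -> derive1 f w * Q 1 (fun=> 1) w = Q 2 f w.
  move=> w2; have D1 := Q_deriv n1 cf w2; rewrite mul1r in D1.
  have D2 := is_derive_prod (@derivableP _ _ _ _ _ _ (df w)) (c' w w2).
  rewrite mulr0 addr0 -derive1E in D2.
  have s0 : 0 < 2^-1 - nm w by rewrite subr_gt0.
  have agree h : nm h < 2^-1 - nm w -> f (w + h) * Q 1 (fun=> 1) (w + h) = Q 1 f (w + h).
    move=> hs; apply/esym/cauchy; first exact: df.
    by apply: le_lt_trans (nmD _ _) _; lra.
  have D3 := is_derive_near (g := fun x => f x * Q 1 (fun=> 1) x) s0 agree D1.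
  exact: is_derive_uniq D2 D3.
have z2 : nm (0 : C) < 2^-1 by rewrite nm0 invr_gt0.
have /deriv_epsP/(_ 1 ltr01)[r r0 Hr] := c' 0 z2.
set k := Q 1 _ 0 in Hr; have k0 : 0 < nm k by rewrite nm_gt0; exact: Q1_1_neq0.
pose s := Num.min 2^-1 (Num.min r (nm k)).
have s0 : 0 < s by rewrite !lt_min r0 k0 invr_gt0 ltr0n.
have /derivableP D : derivable (fun w => Q 2 f w / Q 1 (fun=> 1) w) (0 : C) 1.
  apply: derivable_ratio; first exact: Q1_1_neq0.
    by case: (Q_deriv n2 cf z2).
  by case: (c' 0 z2).
suff [] : is_derive (0 : C) 1 (derive1 f) ('D_1 (fun w => Q 2 f w / Q 1 (fun=> 1) w) 0) by [].
have agree h : nm h < s -> derive1 f (0 + h) = Q 2 f (0 + h) / Q 1 (fun=> 1) (0 + h).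
  rewrite !lt_min => /andP[h2 /andP[hr hk]]; rewrite add0r -(fc _ h2) mulfK//; apply/eqP => Q0.
  by have := Hr h hr; rewrite add0r Q0 mul0r subr0 sub0r nmN mul1r -/k; lra.
exact: (is_derive_near (g := derive1 f) s0 agree D).
Qed.

Lemma entire_derivable (f : C -> C) : (forall z : C, derivable f z 1) ->
  forall z : C, derivable (derive1 f) z 1.
Proof.
move=> df z; pose F (x : C) := f (z + x).
have dF (x : C) : is_derive x 1 F ('D_1 f (z + x)) by apply/is_derive_shift/derivableP/df.
have /derivableP := entire_derivable0 (fun x => let: DeriveDef H _ := dF x in H).
have -> : derive1 F = (fun x => derive1 f (z + x)).
  by apply/funext => x; rewrite !derive1E; case: (dF x).
by move=> /is_derive_shift; rewrite addr0 => -[].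
Qed.
End Entire.
End EntireFunctions.
Import EntireFunctions.

Module Superfunctions.
Import numFieldNormedType.Exports mathcomp.boot.finset.
Local Open Scope ring_scope.

Section Super.
Variables (K : numFieldType) (n : nat).
Implicit Types (f g h : sfun K n) (A B S : {set 'I_n}) (phi psi : K -> K) (c : K).

Definition mono A phi : sfun K n := [ffun S => if S == A then phi else 0].

Lemma smulDl f g h : smul (f + g) h = smul f h + smul g h.
Proof.
apply/ffunP => S; rewrite !ffunE; apply/funext => z; rewrite -[RHS]big_split /=.
by apply: eq_bigr => A _; rewrite !ffunE mulrDr mulrDl.
Qed.

Lemma smulDr f g h : smul h (f + g) = smul h f + smul h g.
Proof.
apply/ffunP => S; rewrite !ffunE; apply/funext => z; rewrite -[RHS]big_split /=.
by apply: eq_bigr => A _; rewrite !ffunE mulrDr.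
Qed.

Lemma smulZl c f g : smul (c *: f) g = c *: smul f g.
Proof.
apply/ffunP => S; rewrite !ffunE; apply/funext => z; rewrite -[RHS]/(c * _) mulr_sumr.
by apply: eq_bigr => A _; rewrite !ffunE -[(c *: _) z]/(c * _); ring.
Qed.

Lemma smulZr c f g : smul f (c *: g) = c *: smul f g.
Proof.
apply/ffunP => S; rewrite !ffunE; apply/funext => z; rewrite -[RHS]/(c * _) mulr_sumr.
by apply: eq_bigr => A _; rewrite !ffunE -[(c *: _) z]/(c * _); ring.
Qed.

Lemma smul0l f : smul 0 f = 0.
Proof. by have := smulZl 0 0 f; rewrite !scale0r. Qed.
Lemma smul0r f : smul f 0 = 0.
Proof. by have := smulZr 0 f 0; rewrite !scale0r. Qed.

Lemma smul_mono A B phi psi : smul (mono A phi) (mono B psi) =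
  if [disjoint A & B] then (-1) ^+ inversions A B *: mono (A :|: B) (fun z => phi z * psi z) else 0.
Proof.
apply/ffunP => S; rewrite ffunE; apply/funext => z.
transitivity (\sum_(A' : {set 'I_n} | (A' \subset S) && (A' == A))
   if S :\: A == B then (-1) ^+ inversions A B * phi z * psi z else 0).
  rewrite [RHS]big_mkcondr; apply: eq_bigr => A' _ /=; rewrite !ffunE.
  case: eqP => [->|_]; last by rewrite [(0 : K -> K) z]/(0 : K) mulr0 mul0r.
  by case: eqP => [->//|_]; rewrite [(0 : K -> K) z]/(0 : K) mulr0.
case: (boolP (A \subset S)) => AS; last first.
  rewrite big_pred0; last by move=> A' /=; apply/andP => -[H /eqP E]; move: AS; rewrite -E H.
  case: ifP => _; rewrite !ffunE //; case: (S =P A :|: B) => [E|_]; last by rewrite -[RHS]/(_ * 0) mulr0.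
  by move: AS; rewrite E subsetUl.
rewrite (big_pred1 A); last by move=> A' /=; case: eqP => [->|]; rewrite ?AS ?andbF.
case: (boolP [disjoint A & B]) => D.
  rewrite !ffunE; case: (S =P A :|: B) => [->|N].
    rewrite setDUl setDv set0U (setDidPl _) ?eqxx; last by rewrite disjoint_sym.
    by rewrite -[RHS]/(_ * _) mulrA.
  case: eqP => [E|_]; last by rewrite -[RHS]/(_ * 0) mulr0.
  case: N; rewrite -E; apply/finset.setP => x; rewrite !finset.inE.
  by case: (boolP (x \in A)) => //= xA; rewrite (fintype.subsetP AS).
case: (S :\: A =P B) => [E|_]; last by rewrite ffunE.
case/negP: D; rewrite -E -setI_eq0.
by apply/eqP/finset.setP => x; rewrite !finset.inE; case: (x \in A).
Qed.

Lemma sgenE i : sgen K i = mono [set i] (fun=> 1).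
Proof. by apply/ffunP => S; rewrite !ffunE; apply/funext => z; case: eqP. Qed.

Lemma d_oddD i f g : d_odd i (f + g) = d_odd i f + d_odd i g.
Proof.
apply/ffunP => S; rewrite !ffunE; apply/funext => z; rewrite -[RHS]/(_ + _).
by case: ifP => _; rewrite ?addr0 // -[LHS]/(_ * (_ + _)) mulrDr.
Qed.

Lemma d_oddZ i c f : d_odd i (c *: f) = c *: d_odd i f.
Proof.
apply/ffunP => S; rewrite !ffunE; apply/funext => z; rewrite -[RHS]/(c * _).
by case: ifP => _; rewrite ?mulr0 // -[LHS]/(_ * (c * _)) mulrCA.
Qed.

Lemma d_odd_mono i A phi : d_odd i (mono A phi) =
  if i \in A then (-1) ^+ inversions [set i] (A :\ i) *: mono (A :\ i) phi else 0.
Proof.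
apply/ffunP => S; rewrite !ffunE; apply/funext => z.
case: (boolP (i \in S)) => iS.
  case: ifP => iA; rewrite !ffunE //; case: (S =P A :\ i) => [E|_]; last by rewrite -[RHS]/(_ * 0) mulr0.
  by move: iS; rewrite E !finset.inE eqxx.
case: (boolP (i \in A)) => iA.
  rewrite !ffunE -[RHS]/(_ * _); case: (S =P A :\ i) => [->|N]; first by rewrite setD1K // eqxx.
  case: (i |: S =P A) => [E|_]; last by rewrite mulr0 [(0 : K -> K) z]/(0 : K) mulr0.
  by case: N; rewrite -E setU1K.
rewrite ffunE; case: (i |: S =P A) => [E|_]; last by rewrite [(0 : K -> K) z]/(0 : K) mulr0.
by move: iA; rewrite -E setU11.
Qed.

Lemma d_even_mono A phi : d_even (mono A phi) = mono A (derive1 phi).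
Proof.
apply/ffunP => S; rewrite !ffunE; apply/funext => z; case: eqP => // _.
exact: derive1_cst.
Qed.

Lemma holomorphicD f g : holomorphic f -> holomorphic g -> holomorphic (f + g).
Proof. by move=> hf hg S z; rewrite ffunE; apply: derivableD. Qed.

Lemma holomorphicZ c f : holomorphic f -> holomorphic (c *: f).
Proof. by move=> hf S z; rewrite ffunE; apply: derivableZ. Qed.

Lemma holomorphic0 : holomorphic (0 : sfun K n).
Proof. by move=> S z; rewrite ffunE; apply: derivable_cst. Qed.

Lemma holomorphic_mono A phi : (forall z, derivable phi z 1) -> holomorphic (mono A phi).
Proof. by move=> hp S z; rewrite ffunE; case: ifP => _ //; apply: derivable_cst. Qed.

Lemma d_evenD f g : holomorphic f -> holomorphic g -> d_even (f + g) = d_even f + d_even g.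
Proof.
move=> hf hg; apply/ffunP => S; rewrite !ffunE; apply/funext => z.
by rewrite -[RHS]/(_ + _) !derive1E deriveD.
Qed.

Lemma d_evenZ c f : holomorphic f -> d_even (c *: f) = c *: d_even f.
Proof.
move=> hf; apply/ffunP => S; rewrite !ffunE; apply/funext => z.
by rewrite -[RHS]/(_ * _) !derive1E deriveZ.
Qed.

Lemma d_even0 : d_even (0 : sfun K n) = 0.
Proof. by apply/ffunP => S; rewrite !ffunE; apply/funext => z; apply: derive1_cst. Qed.

Lemma sprojD p f g : sproj p (f + g) = sproj p f + sproj p g.
Proof. by apply/ffunP => S; rewrite !ffunE; case: ifP => _; rewrite ?addr0. Qed.
Lemma sprojZ p c f : sproj p (c *: f) = c *: sproj p f.
Proof. by apply/ffunP => S; rewrite !ffunE; case: ifP => _; rewrite ?scaler0. Qed.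
Lemma sproj_mono p A phi : sproj p (mono A phi) = if odd #|A| == p then mono A phi else 0.
Proof.
apply/ffunP => S; rewrite !ffunE; case: ifP => [E|E]; case: (boolP (S == A)) => [/eqP Sa|N].
- by rewrite -Sa E ffunE Sa eqxx.
- by case: ifP; rewrite !ffunE// (negbTE N).
- by rewrite -Sa E ffunE.
- by case: ifP; rewrite ?ffunE// (negbTE N).
Qed.
End Super.

Section Pull.
Variable K : numFieldType.
Lemma pullD (f g : sfun K 8) : pull (f + g) = pull f + pull g.
Proof. by apply/ffunP => S; rewrite !ffunE; case: ifP => _; rewrite ?addr0. Qed.
Lemma pullZ c (f : sfun K 8) : pull (c *: f) = c *: pull f.
Proof. by apply/ffunP => S; rewrite !ffunE; case: ifP => _; rewrite ?scaler0. Qed.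
Lemma pull_mono (A : {set 'I_8}) (phi : K -> K) :
  pull (mono A phi) = mono (lshift 8 @: A : {set 'I_(8 + 8)}) phi.
Proof.
apply/ffunP => S; rewrite !ffunE; case: ifP => SS; last first.
  case: eqP => // E; move: SS; rewrite E => /negbT/subsetPn[x /imsetP[y _ ->]].
  by rewrite imset_f.
case: (lshift 8 @^-1: S =P A) => [E|N]; case: (S =P lshift 8 @: A) => H //.
  case: H; rewrite -E; apply/finset.setP => x; apply/idP/imsetP => [xS|[y yS ->]].
    by have /imsetP[y _ xy] := fintype.subsetP SS _ xS; exists y; rewrite ?finset.inE -?xy.
  by rewrite finset.inE in yS.
case: N; rewrite H; apply/finset.setP => x; rewrite finset.inE mem_imset//; exact: lshift_inj.
Qed.
End Pull.
End Superfunctions.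
Import Superfunctions.

Module Masks.
Import numFieldNormedType.Exports mathcomp.boot.finset.
Local Open Scope ring_scope.

Section Masks.
Definition bit (m : N) (i : nat) : bool := N.testbit m (N.of_nat i).
Definition setN n (m : N) : {set 'I_n} := [set i : 'I_n | bit m i].

Lemma bit_lor A B i : bit (N.lor A B) i = bit A i || bit B i.
Proof. by rewrite /bit N.lor_spec. Qed.
Lemma bit_land A B i : bit (N.land A B) i = bit A i && bit B i.
Proof. by rewrite /bit N.land_spec. Qed.
Lemma bit_ones n i : bit (N.ones (N.of_nat n)) i = (i < n)%N.
Proof.
rewrite /bit; case: (ltnP i n) => H.
  by apply: N.ones_spec_low; lia.
by apply: N.ones_spec_high; lia.
Qed.
Lemma bit_clear A i j : bit (N.clearbit A (N.of_nat i)) j = bit A j && (j != i).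
Proof.
rewrite /bit N.clearbit_eqb; congr (_ && ~~ _); apply/N.eqb_spec/eqP => [/Nat2N.inj ->//|->//].
Qed.
Lemma bit_single i j : bit (N.shiftl 1 (N.of_nat i)) j = (j == i).
Proof.
rewrite /bit N.shiftl_1_l N.pow2_bits_eqb; apply/N.eqb_spec/eqP => [/Nat2N.inj ->//|->//].
Qed.
Lemma bit0 A : bit A 0 = N.odd A. Proof. exact: N.bit0_odd. Qed.
Lemma bitS A i : bit A i.+1 = bit (N.div2 A) i.
Proof. by rewrite /bit Nat2N.inj_succ N.testbit_succ_r_div2 //; apply: N.le_0_l. Qed.

Fixpoint ipar (n : nat) (A B : N) (p : bool) : bool :=
  if n is n'.+1 then (N.odd A && p) (+) ipar n' (N.div2 A) (N.div2 B) (p (+) N.odd B) else false.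

Lemma iparE n A B p : ipar n A B p =
  odd (\sum_(i < n) bit A i * (p + \sum_(j < n | j < i) bit B j)).
Proof.
elim: n A B p => [|n IH] A B p; first by rewrite big_ord0.
rewrite big_ord_recl big_pred0 //= addn0 oddD -bit0; congr (_ (+) _).
  by case: (bit A 0); case: p.
rewrite IH; transitivity (odd (\sum_(i < n) bit (N.div2 A) i * (p + bit B 0 +
     \sum_(j < n | j < i) bit (N.div2 B) j))); last first.
  congr odd; apply: eq_bigr => i _; rewrite bitS; congr (_ * _).
  rewrite -addnA; congr (_ + _); rewrite [RHS]big_mkcond big_ord_recl /=; congr (_ + _).
  by rewrite big_mkcond; apply: eq_bigr => j _; rewrite bitS.
rewrite !(big_morph odd oddD (erefl _)); apply: eq_bigr => i _.
by rewrite !oddM !oddD !oddb bit0.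
Qed.

Lemma inversionsE n (A B : {set 'I_n}) :
  inversions A B = (\sum_(i < n) (i \in A) * \sum_(j < n | j < i) (j \in B))%N.
Proof.
rewrite /inversions cardsE -sum1_card big_mkcond.
transitivity (\sum_(i < n) \sum_(j < n) (i \in A) * (if j < i then (j \in B : nat) else 0))%N.
  rewrite pair_bigA /=; apply: eq_bigr => -[i j] _ /=.
  by rewrite unfold_in /=; case: (i \in A); case: (j \in B); case: (j < i)%N.
by apply: eq_bigr => i _; rewrite -big_distrr -big_mkcond.
Qed.

Lemma ipar_inversions n A B : ipar n A B false = odd (inversions (setN n A) (setN n B)).
Proof.
rewrite iparE inversionsE; congr odd; apply: eq_bigr => i _; rewrite inE add0n; congr (_ * _)%N.
by apply: eq_bigr => j _; rewrite inE.
Qed.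

Definition disjN n A B := N.eqb (N.land (N.land A B) (N.ones (N.of_nat n))) 0.
Lemma disjNE n A B : disjN n A B = [disjoint setN n A & setN n B].
Proof.
rewrite -setI_eq0; apply/N.eqb_spec/eqP => H.
  apply/finset.setP => i; rewrite !inE; have := congr1 (fun m => bit m i) H.
  by rewrite !bit_land bit_ones ltn_ord andbT => ->; rewrite /bit N.bits_0.
suff E (k : nat) : bit (N.land (N.land A B) (N.ones (N.of_nat n))) k = false.
  by apply: N.bits_inj => k; rewrite N.bits_0 -(N2Nat.id k); apply: E.
rewrite !bit_land bit_ones; case: ltnP => [kn|]; rewrite ?andbF// andbT.
by have /finset.setP/(_ (Ordinal kn)) := H; rewrite !inE.
Qed.

Fixpoint popodd (n : nat) (A : N) : bool := if n is n'.+1 then N.odd A (+) popodd n' (N.div2 A) else false.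
Lemma popoddE n A : popodd n A = odd #|setN n A|.
Proof.
have -> : #|setN n A| = (\sum_(i < n) bit A i)%N.
  rewrite -sum1_card big_mkcond; apply: eq_bigr => i _; rewrite finset.inE; by case: bit.
elim: n A => [|n IH] A; first by rewrite big_ord0.
rewrite big_ord_recl /= oddD oddb bit0 IH; congr (_ (+) odd _).
by apply: eq_bigr => i _; rewrite bitS.
Qed.

Lemma setN_lor n A B : setN n (N.lor A B) = setN n A :|: setN n B.
Proof. by apply/finset.setP => i; rewrite !inE bit_lor. Qed.
Lemma setN_clear n A (i : 'I_n) : setN n (N.clearbit A (N.of_nat i)) = setN n A :\ i.
Proof. by apply/finset.setP => j; rewrite !inE bit_clear andbC. Qed.
Lemma setN_single n (i : 'I_n) : setN n (N.shiftl 1 (N.of_nat i)) = [set i].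
Proof. by apply/finset.setP => j; rewrite !inE bit_single. Qed.

Lemma setN_surj n (S : {set 'I_n}) : exists2 m : nat, (m < 2 ^ n)%N & setN n (N.of_nat m) = S.
Proof.
have gen (P : nat -> bool) : exists2 m : nat, (m < 2 ^ n)%N &
    forall i, (i < n)%N -> bit (N.of_nat m) i = P i.
  elim: n P {S} => [|k IH] P; first by exists 0%N.
  have [m mn H] := IH (fun i => P i.+1); exists (P 0%N + m.*2)%N.
    by rewrite expnS mul2n -!addnn; case: (P 0%N) => /=; rewrite ?add0n ?add1n; lia.
  have -> : N.of_nat (P 0%N + m.*2) = (if P 0%N then N.succ_double else N.double) (N.of_nat m).
    by case: (P 0%N); lia.
  move=> [|i] ilt; first by rewrite bit0; case: (P 0%N); case: (N.of_nat m).
  by rewrite bitS -H//; congr bit; case: (P 0%N); case: (N.of_nat m).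
have [m mn H] := gen (fun i => [exists j in S, val j == i]).
exists m => //; apply/finset.setP => i; rewrite inE H//.
by apply/exists_inP/idP => [[j jS /eqP/val_inj <-]//|iS]; exists i.
Qed.
End Masks.
End Masks.
Import Masks.

Module Lists.
#[local] Delimit Scope Z_scope with Z.

Definition sym := (N * nat)%type.
Definition mon := (nat * seq sym)%type.
Definition key := (N * mon)%type.
Definition lc (T : Type) := seq (T * Z).
Definition sexp := lc key.

Definition lscale (T : Type) (c : Z) (l : lc T) : lc T := [seq (t.1, Z.mul c t.2) | t <- l].

(* normalisation *)
Fixpoint slt (s t : seq sym) : bool :=
  match s, t with
  | [::], _ => true
  | _ :: _, [::] => false
  | (i, m) :: s', (j, k) :: t' =>
    match N.compare i j with
    | Lt => true | Gt => false
    | Eq => if m == k then slt s' t' else (m <= k)%N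
    end
  end.
Definition kle (a b : key * Z) : bool :=
  let: ((A, (i, s)), _) := a in let: ((B, (j, t)), _) := b in
  match N.compare A B with
  | Lt => true | Gt => false
  | Eq => if i == j then slt s t else (i <= j)%N
  end.
Section Merge.
Variable T : eqType.
Definition lcons (t : T * Z) (acc : lc T) : lc T :=
  if acc is (k, c) :: r then
    if t.1 == k then let d := Z.add t.2 c in if Z.eqb d 0 then r else (k, d) :: r
    else t :: acc
  else [:: t].
Definition combine (l : lc T) : lc T := foldr lcons [::] l.
End Merge.
Definition norm (l : sexp) : sexp := combine (sort kle l).

Definition ksign (b : bool) : Z := if b then (-1)%Z else 1%Z.

Definition tmul n (a b : key * Z) : sexp :=
  let: ((A, (i, s)), c) := a in let: ((B, (j, t)), d) := b in
  if disjN n A B then [:: ((N.lor A B, ((i + j)%N, s ++ t)), Z.mul (Z.mul c d) (ksign (ipar n A B false)))] else [::].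
Definition lmul n (l1 l2 : sexp) : sexp := flatten [seq flatten [seq tmul n a b | b <- l2] | a <- l1].

Definition lodd n (i : nat) (l : sexp) : sexp :=
  flatten [seq (let: ((A, r), c) := t in
     if bit A i then let A' := N.clearbit A (N.of_nat i) in
       [:: ((A', r), Z.mul c (ksign (ipar n (N.shiftl 1 (N.of_nat i)) A' false)))] else [::]) | t <- l].

Fixpoint bumps (s : seq sym) : seq (seq sym) :=
  if s is (i, m) :: s' then ((i, m.+1) :: s') :: [seq (i, m) :: t | t <- bumps s'] else [::].
Definition leven (l : sexp) : sexp :=
  flatten [seq (let: ((A, (i, s)), c) := t in
     (if i is i'.+1 then [:: ((A, (i', s)), Z.mul c (Z.of_nat i))] else [::])
     ++ [seq ((A, (i, s')), c) | s' <- bumps s]) | t <- l].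

Definition lproj n (p : bool) (l : sexp) : sexp := [seq t <- l | popodd n t.1.1 == p].
Definition lgen (i : nat) : sexp := [:: ((N.shiftl 1 (N.of_nat i), (0, [::])), 1%Z)].
Definition lsum (f : nat -> sexp) (n : nat) : sexp := flatten [seq f i | i <- iota 0 n].

(* vector fields *)
Definition lvf := seq sexp.
Definition lapp n (X : lvf) (l : sexp) : sexp :=
  lmul n (nth [::] X 0) (leven l) ++ lsum (fun i => lmul n (nth [::] X i.+1) (lodd n i l)) n.
Definition lvproj n p (X : lvf) : lvf :=
  lproj n p (nth [::] X 0) :: [seq lproj n (~~ p) (nth [::] X i.+1) | i <- iota 0 n].
Definition lbr n (X Y : lvf) : lvf :=
  let X1 := lvproj n true X in let X0 := lvproj n false X in
  let Y1 := lvproj n true Y in let Y0 := lvproj n false Y in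
  let br (s : bool) U V c :=
    lapp n U (nth [::] V c) ++ lscale (ksign s) (lapp n V (nth [::] U c)) in
  [seq (br false X1 Y1 c ++ br true X1 Y0 c) ++ (br true X0 Y1 c ++ br true X0 Y0 c)
    | c <- iota 0 n.+1].

(* contact geometry *)
Definition lsigma (Y : lvf) : sexp :=
  nth [::] Y 0 ++ lscale (-1) (lsum (fun i => lmul 8 (nth [::] Y i.+1) (lgen (4 + i))) 4).
Definition lDx i (l : sexp) : sexp := lodd 8 i l ++ lmul 8 (lgen (4 + i)) (leven l).
Definition lpm (l : sexp) : sexp := lproj 8 false l ++ lscale (-1) (lproj 8 true l).
Definition lcontact (f : sexp) : lvf :=
  let g := lpm f in
  (f ++ lsum (fun i => lmul 8 (lodd 8 (4 + i) g) (lgen (4 + i))) 4)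
  :: [seq lodd 8 (4 + i) g | i <- iota 0 4] ++ [seq lDx i g | i <- iota 0 4].
Definition lpull (l : sexp) : sexp := [seq ((N.land t.1.1 255, t.1.2), t.2) | t <- l].
Definition ldc (l : sexp) : sexp :=
  lsum (fun i => lmul 16 (lgen (8 + i)) (lpull (lDx i l)) ++
                 lmul 16 (lgen (12 + i)) (lpull (lodd 8 (4 + i) l))) 4.
Definition llie (X : lvf) : lvf :=
  lpull (nth [::] X 0) :: [seq lpull (nth [::] X i.+1) | i <- iota 0 8]
    ++ [seq ldc (nth [::] X i.+1) | i <- iota 0 8].
Definition lprod (l : seq nat) : sexp := foldl (fun f i => lmul 16 f (lgen i)) (lgen (head 0 l)) (behead l).
Definition lQ : sexp :=
  lprod [:: 8; 9; 12; 13] ++ lprod [:: 8; 10; 12; 14] ++ lprod [:: 8; 11; 12; 15]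
  ++ lscale (-2) (lprod [:: 8; 13; 14; 15]) ++ lscale (-1) (lprod [:: 9; 10; 13; 14])
  ++ lscale (-1) (lprod [:: 9; 11; 13; 15]) ++ lscale (-1) (lprod [:: 10; 11; 14; 15])
  ++ lscale 2 (lprod [:: 9; 10; 11; 12]).

Definition nilb (l : sexp) : bool := if norm l is [::] then true else false.

(* data *)
Definition x0 := 0%N. Definition x1 := 1%N. Definition x2 := 2%N. Definition x3 := 3%N.
Definition u0 := 4%N. Definition u1 := 5%N. Definition u2 := 6%N. Definition u3 := 7%N.
Definition A p q : nat * nat * nat := (0, p, q).
Definition H : nat * nat * nat := (1, 0, 0).
Definition Up : nat * nat * nat := (1, 1, 0).
Definition Dn : nat * nat * nat := (1, 2, 0).
Definition P s c : nat * nat * nat := (2, s, c).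
Definition data : seq (seq (Z * nat * seq nat) * seq (Z * nat * (nat * nat * nat)) * seq ((N * nat) * Z)) := [::
  ([:: (1%Z, 0, [::])],
   [:: ((-16)%Z, 0, Up)],
   [:: ((0%num, 0), 2%Z)]);
  ([:: (1%Z, 0, [:: x0])],
   [:: (4%Z, 0, P 0 0); ((-4)%Z, 1, P 1 0)],
   [:: ((1%num, 0), 2%Z)]);
  ([:: (1%Z, 0, [:: x1])],
   [:: (4%Z, 0, P 2 0); (4%Z, 1, P 4 0)],
   [:: ((2%num, 0), 2%Z)]);
  ([:: (1%Z, 0, [:: x2])],
   [:: (4%Z, 0, P 3 0); (4%Z, 1, P 7 0)],
   [:: ((4%num, 0), 2%Z)]);
  ([:: (1%Z, 0, [:: x3])],
   [:: (4%Z, 0, P 5 0); (4%Z, 1, P 6 0)],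
   [:: ((8%num, 0), 2%Z)]);
  ([:: (1%Z, 0, [:: u0])],
   [:: (4%Z, 0, P 0 0); (4%Z, 1, P 1 0)],
   [:: ((16%num, 0), 2%Z)]);
  ([:: (1%Z, 0, [:: u1])],
   [:: (4%Z, 0, P 2 0); ((-4)%Z, 1, P 4 0)],
   [:: ((32%num, 0), 2%Z)]);
  ([:: (1%Z, 0, [:: u2])],
   [:: (4%Z, 0, P 3 0); ((-4)%Z, 1, P 7 0)],
   [:: ((64%num, 0), 2%Z)]);
  ([:: (1%Z, 0, [:: u3])],
   [:: (4%Z, 0, P 5 0); ((-4)%Z, 1, P 6 0)],
   [:: ((128%num, 0), 2%Z)]);
  ([:: (2%Z, 1, [::]); ((-1)%Z, 0, [:: x0; u0]); ((-1)%Z, 0, [:: x1; u1]); ((-1)%Z, 0, [:: x2; u2]); ((-1)%Z, 0, [:: x3; u3])],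
   [:: ((-4)%Z, 0, H)],
   [:: ((0%num, 1), 1%Z)]);
  ([:: (1%Z, 0, [:: x0; u0]); ((-1)%Z, 0, [:: x1; u1]); (1%Z, 0, [:: x2; u2]); (1%Z, 0, [:: x3; u3])],
   [:: (8%Z, 1, A 3 1)],
   [:: ((68%num, 0), 1%Z); ((136%num, 0), 1%Z); ((0%num, 1), 1%Z)]);
  ([:: (1%Z, 0, [:: x0; u0]); (1%Z, 0, [:: x1; u1]); ((-1)%Z, 0, [:: x2; u2]); (1%Z, 0, [:: x3; u3])],
   [:: (8%Z, 1, A 6 2)],
   [:: ((34%num, 0), 1%Z); ((136%num, 0), 1%Z); ((0%num, 1), 1%Z)]);
  ([:: (1%Z, 0, [:: x0; u0]); (1%Z, 0, [:: x1; u1]); (1%Z, 0, [:: x2; u2]); ((-1)%Z, 0, [:: x3; u3])],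
   [:: (8%Z, 1, A 5 4)],
   [:: ((34%num, 0), 1%Z); ((68%num, 0), 1%Z); ((0%num, 1), 1%Z)]);
  ([:: (1%Z, 0, [:: x0; x1])],
   [:: (2%Z, 0, A 4 2); ((-2)%Z, 1, A 5 2); (2%Z, 1, A 6 4); (2%Z, 0, A 6 5)],
   [:: ((3%num, 0), 2%Z)]);
  ([:: (1%Z, 0, [:: x0; x2])],
   [:: ((-2)%Z, 0, A 4 1); (2%Z, 1, A 4 3); (2%Z, 1, A 5 1); (2%Z, 0, A 5 3)],
   [:: ((5%num, 0), 2%Z)]);
  ([:: (1%Z, 0, [:: x0; x3])],
   [:: (2%Z, 0, A 2 1); (2%Z, 1, A 3 2); ((-2)%Z, 1, A 6 1); ((-2)%Z, 0, A 6 3)],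
   [:: ((9%num, 0), 2%Z)]);
  ([:: ((-1)%Z, 0, [:: x2; x3]); (1%Z, 0, [:: x0; u1])],
   [:: ((-4)%Z, 1, A 1 0); ((-4)%Z, 0, A 3 0)],
   [:: ((33%num, 0), 2%Z)]);
  ([:: (1%Z, 0, [:: x2; u1])],
   [:: ((-2)%Z, 0, A 2 1); ((-2)%Z, 1, A 3 2); ((-2)%Z, 1, A 6 1); ((-2)%Z, 0, A 6 3)],
   [:: ((36%num, 0), 2%Z)]);
  ([:: (1%Z, 0, [:: x3; u1])],
   [:: ((-2)%Z, 0, A 4 1); (2%Z, 1, A 4 3); ((-2)%Z, 1, A 5 1); ((-2)%Z, 0, A 5 3)],
   [:: ((40%num, 0), 2%Z)]);
  ([:: (1%Z, 0, [:: u0; u1])],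
   [:: (2%Z, 0, A 4 2); (2%Z, 1, A 5 2); ((-2)%Z, 1, A 6 4); (2%Z, 0, A 6 5)],
   [:: ((48%num, 0), 2%Z)]);
  ([:: (1%Z, 0, [:: x1; x3]); (1%Z, 0, [:: x0; u2])],
   [:: ((-4)%Z, 1, A 2 0); ((-4)%Z, 0, A 6 0)],
   [:: ((65%num, 0), 2%Z)]);
  ([:: (1%Z, 0, [:: x1; u2])],
   [:: (2%Z, 0, A 2 1); ((-2)%Z, 1, A 3 2); ((-2)%Z, 1, A 6 1); (2%Z, 0, A 6 3)],
   [:: ((66%num, 0), 2%Z)]);
  ([:: (1%Z, 0, [:: x3; u2])],
   [:: ((-2)%Z, 0, A 4 2); ((-2)%Z, 1, A 5 2); ((-2)%Z, 1, A 6 4); (2%Z, 0, A 6 5)],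
   [:: ((72%num, 0), 2%Z)]);
  ([:: (1%Z, 0, [:: u0; u2])],
   [:: ((-2)%Z, 0, A 4 1); ((-2)%Z, 1, A 4 3); ((-2)%Z, 1, A 5 1); (2%Z, 0, A 5 3)],
   [:: ((80%num, 0), 2%Z)]);
  ([:: (1%Z, 0, [:: x3; u0]); (1%Z, 0, [:: u1; u2])],
   [:: ((-4)%Z, 1, A 4 0); (4%Z, 0, A 5 0)],
   [:: ((96%num, 0), 2%Z)]);
  ([:: ((-1)%Z, 0, [:: x1; x2]); (1%Z, 0, [:: x0; u3])],
   [:: ((-4)%Z, 1, A 4 0); ((-4)%Z, 0, A 5 0)],
   [:: ((129%num, 0), 2%Z)]);
  ([:: (1%Z, 0, [:: x1; u3])],
   [:: (2%Z, 0, A 4 1); (2%Z, 1, A 4 3); ((-2)%Z, 1, A 5 1); (2%Z, 0, A 5 3)],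
   [:: ((130%num, 0), 2%Z)]);
  ([:: (1%Z, 0, [:: x2; u3])],
   [:: (2%Z, 0, A 4 2); ((-2)%Z, 1, A 5 2); ((-2)%Z, 1, A 6 4); ((-2)%Z, 0, A 6 5)],
   [:: ((132%num, 0), 2%Z)]);
  ([:: (1%Z, 0, [:: u0; u3])],
   [:: (2%Z, 0, A 2 1); ((-2)%Z, 1, A 3 2); (2%Z, 1, A 6 1); ((-2)%Z, 0, A 6 3)],
   [:: ((144%num, 0), 2%Z)]);
  ([:: ((-1)%Z, 0, [:: x2; u0]); (1%Z, 0, [:: u1; u3])],
   [:: (4%Z, 1, A 2 0); ((-4)%Z, 0, A 6 0)],
   [:: ((160%num, 0), 2%Z)]);
  ([:: (1%Z, 0, [:: x1; u0]); (1%Z, 0, [:: u2; u3])],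
   [:: ((-4)%Z, 1, A 1 0); (4%Z, 0, A 3 0)],
   [:: ((192%num, 0), 2%Z)]);
  ([:: (3%Z, 1, [:: x0]); ((-1)%Z, 0, [:: x1; x2; x3]); ((-1)%Z, 0, [:: x0; x1; u1]); ((-1)%Z, 0, [:: x0; x2; u2]); ((-1)%Z, 0, [:: x0; x3; u3])],
   [:: ((-3)%Z, 0, P 0 1); (3%Z, 1, P 1 1)],
   [:: ((35%num, 0), (-2)%Z)]);
  ([:: (3%Z, 1, [:: x1]); (1%Z, 0, [:: x0; x1; u0]); ((-2)%Z, 0, [:: x1; x2; u2]); ((-2)%Z, 0, [:: x1; x3; u3]); (1%Z, 0, [:: x0; u2; u3])],
   [:: ((-3)%Z, 0, P 2 1); ((-3)%Z, 1, P 4 1)],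
   [:: ((19%num, 0), 2%Z)]);
  ([:: (3%Z, 1, [:: x2]); (1%Z, 0, [:: x0; x2; u0]); (2%Z, 0, [:: x1; x2; u1]); ((-2)%Z, 0, [:: x2; x3; u3]); ((-1)%Z, 0, [:: x0; u1; u3])],
   [:: ((-3)%Z, 0, P 3 1); ((-3)%Z, 1, P 7 1)],
   [:: ((21%num, 0), 2%Z)]);
  ([:: (3%Z, 1, [:: x3]); (1%Z, 0, [:: x0; x3; u0]); (2%Z, 0, [:: x1; x3; u1]); (2%Z, 0, [:: x2; x3; u2]); (1%Z, 0, [:: x0; u1; u2])],
   [:: ((-3)%Z, 0, P 5 1); ((-3)%Z, 1, P 6 1)],
   [:: ((25%num, 0), 2%Z)]);
  ([:: (3%Z, 1, [:: u0]); (2%Z, 0, [:: x1; u0; u1]); (2%Z, 0, [:: x2; u0; u2]); (2%Z, 0, [:: x3; u0; u3]); ((-1)%Z, 0, [:: u1; u2; u3])],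
   [:: ((-3)%Z, 0, P 0 1); ((-3)%Z, 1, P 1 1)],
   [:: ((224%num, 0), (-2)%Z)]);
  ([:: (3%Z, 1, [:: u1]); (1%Z, 0, [:: x2; x3; u0]); ((-2)%Z, 0, [:: x0; u0; u1]); (1%Z, 0, [:: x2; u1; u2]); (1%Z, 0, [:: x3; u1; u3])],
   [:: ((-3)%Z, 0, P 2 1); (3%Z, 1, P 4 1)],
   [:: ((28%num, 0), 2%Z)]);
  ([:: (3%Z, 1, [:: u2]); ((-1)%Z, 0, [:: x1; x3; u0]); ((-2)%Z, 0, [:: x0; u0; u2]); ((-1)%Z, 0, [:: x1; u1; u2]); (1%Z, 0, [:: x3; u2; u3])],
   [:: ((-3)%Z, 0, P 3 1); (3%Z, 1, P 7 1)],
   [:: ((26%num, 0), (-2)%Z)]);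
  ([:: (3%Z, 1, [:: u3]); (1%Z, 0, [:: x1; x2; u0]); ((-2)%Z, 0, [:: x0; u0; u3]); ((-1)%Z, 0, [:: x1; u1; u3]); ((-1)%Z, 0, [:: x2; u2; u3])],
   [:: ((-3)%Z, 0, P 5 1); (3%Z, 1, P 6 1)],
   [:: ((22%num, 0), 2%Z)]);
  ([:: ((-3)%Z, 2, [::]); (3%Z, 1, [:: x0; u0]); (3%Z, 1, [:: x1; u1]); (3%Z, 1, [:: x2; u2]); (3%Z, 1, [:: x3; u3]); (1%Z, 0, [:: x1; x2; x3; u0]); (2%Z, 0, [:: x0; x1; u0; u1]); (2%Z, 0, [:: x0; x2; u0; u2]); (1%Z, 0, [:: x1; x2; u1; u2]); (2%Z, 0, [:: x0; x3; u0; u3]); (1%Z, 0, [:: x1; x3; u1; u3]); (1%Z, 0, [:: x2; x3; u2; u3]); ((-1)%Z, 0, [:: x0; u1; u2; u3])],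
   [:: ((-3)%Z, 0, Dn)],
   [:: ((102%num, 0), 2%Z)])].
Definition gf (m : seq (Z * nat * seq nat)) : sexp :=
  [seq ((foldr (fun i a => N.setbit a (N.of_nat i)) 0%num t.2, (t.1.2, [::])), t.1.1) | t <- m].
Definition Fs : seq sexp := [seq gf d.1.1 | d <- data].
Definition Vs : seq lvf := [seq [seq norm l | l <- lcontact f] | f <- Fs].

(* symbols *)
Definition lsym (i : nat) : sexp :=
  [seq ((N.of_nat m, (0, [:: (N.of_nat (256 * i + m), 0)])), 1%Z) | m <- iota 0 256].
Definition plain (l : sexp) : bool := all (fun t => nilp t.1.2.2) l.

(* the constant frame of the contact distribution *)
Definition lone : sexp := [:: ((0%num, (0, [::])), 1%Z)].
Definition lframe (a : nat) : lvf :=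
  (if (a < 4)%N then lgen (4 + a) else [::]) :: [seq (if i == a then lone else [::]) | i <- iota 0 8].
Definition symX : lvf := [seq lsym i | i <- iota 0 9].
Definition symY : lvf :=
  lsum (fun i => lmul 8 (lsym i.+1) (lgen (4 + i))) 4 :: [seq lsym i.+1 | i <- iota 0 8].

Definition contact_ok (V : lvf) : bool := all plain V && nilb (lsigma (lbr 8 V symY)).
Definition lie_ok (f : sexp) (V : lvf) : bool :=
  nilb (lapp 16 (llie V) lQ ++ lscale (-1) (lmul 16 (lpull (lscale 2 (leven f))) lQ)).
(* the defect of a component of a contact field from the one of its generating function *)
Definition defect_ok (a : nat) : bool :=
  let b := if (a < 4)%N then (a + 4)%N else (a - 4)%N in
  nilb (nth [::] symX a.+1 ++ lscale (-1) (nth [::] (lcontact (lsigma symX)) a.+1)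
     ++ lscale (-1) (lsigma (lbr 8 symX (lframe b)))).

(* linear elimination *)
Definition row := lc sym.
Definition scmp (s t : sym) : comparison :=
  match N.compare s.1 t.1 with Eq => Nat.compare s.2 t.2 | c => c end.
Fixpoint axpy (n : nat) (a b : Z) (r p : row) : row :=
  if n is n'.+1 then
  match r, p with
  | [::], _ => lscale b p
  | _, [::] => lscale a r
  | (s, c) :: r', (t, d) :: p' =>
    match scmp s t with
    | Lt => (s, Z.mul a c) :: axpy n' a b r' p
    | Gt => (t, Z.mul b d) :: axpy n' a b r p'
    | Eq => let x := Z.add (Z.mul a c) (Z.mul b d) in
            if Z.eqb x 0 then axpy n' a b r' p' else (s, x) :: axpy n' a b r' p'
    end
  end else lscale a r ++ lscale b p.
Definition eliminate (a b : Z) (r p : row) := axpy (size r + size p) b (Z.opp a) r p.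
Fixpoint insert (pivs : seq row) (r : row) : seq row :=
  match r, pivs with
  | [::], _ => pivs
  | _, [::] => [:: r]
  | (s, a) :: r', p :: ps =>
    if p is (t, b) :: p' then
      match scmp s t with
      | Lt => r :: pivs
      | Gt => p :: insert ps r
      | Eq => p :: insert ps (eliminate a b r' p')
      end
    else insert ps r
  end.
Fixpoint inspan (pivs : seq row) (r : row) : bool :=
  match r, pivs with
  | [::], _ => true
  | _, [::] => false
  | (s, a) :: r', p :: ps =>
    if p is (t, b) :: p' then
      match scmp s t with
      | Lt => false
      | Gt => inspan ps r
      | Eq => ~~ Z.eqb b 0 && inspan ps (eliminate a b r' p')
      end
    else inspan ps r
  end.

(* coefficient extraction *)
Definition low (n : nat) (A : N) : N := N.land A (N.ones (N.of_nat n)).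
Fixpoint group (n : nat) (l : sexp) : seq (N * row) :=
  if l is ((A, (i, s)), c) :: l' then
    let g := group n l' in
    let t := (head (0%num, 0) s, c) in
    if g is (B, r) :: g' then
      if N.eqb (low n A) B then (B, t :: r) :: g' else (low n A, [:: t]) :: g
    else [:: (low n A, [:: t])]
  else [::].
Definition linear_term (t : key * Z) : bool := (t.1.2.1 == 0) && (size t.1.2.2 == 1).
Definition bits (l : seq nat) : N := foldr (fun i a => N.setbit a (N.of_nat i)) 0%num l.
Definition upper : seq N := [seq bits l | l <-
  [:: [:: 0; 1; 2; 4]; [:: 0; 1; 3; 4]; [:: 0; 2; 3; 4]; [:: 1; 2; 3; 4];
      [:: 0; 1; 4; 5]; [:: 1; 2; 4; 5]; [:: 1; 3; 4; 5]; [:: 1; 2; 4; 6]]].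
Definition selected (A : N) := N.shiftr (low 16 A) 8 \in upper.
Definition Qlie : sexp :=
  lapp 16 (llie (lcontact (lsym 0))) lQ ++ lscale (-1) (lmul 16 (lpull (lsym 1)) lQ).
Definition Qeqs : sexp := norm [seq t <- Qlie | selected t.1.1].
Definition Qgroups := group 16 Qeqs.
Definition sort_row (r : row) : row := sort (fun a b => if scmp a.1 b.1 is Gt then false else true) r.
Definition pivots (L : seq row) (start : seq row) : seq row := foldl insert start [seq sort_row r | r <- L].

Definition jets : seq row := [seq d.2 | d <- data].
Definition size_of (m : nat) := sumn [seq (bit (N.of_nat m) i : nat) | i <- iota 0 8].
Definition unit_row (o m : nat) : row := [:: ((N.of_nat m, o), 1%Z)].
Definition masks (p : pred nat) : seq nat := [seq m <- iota 0 256 | p (size_of m)].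

Definition hess_row : row := [:: ((0%num, 2), 1%Z); ((102%num, 0), 6%Z)].
Definition spans_ok (L : seq row) : bool :=
  let p := pivots L [::] in
  let pA := pivots (unit_row 2 0 :: [seq unit_row 1 m | m <- masks (pred1 1)]) p in
  let pB := pivots jets p in
  [&& all (inspan p) (hess_row :: unit_row 1 102 ::
         [seq unit_row 2 m | m <- masks (pred1 1)]),
      all (inspan pA) ([seq unit_row 0 m | m <- masks (leq 3)] ++ [seq unit_row 1 m | m <- masks (pred1 2)])
    & all (inspan pB) ([seq unit_row 0 m | m <- iota 0 256] ++
         [:: unit_row 1 0; unit_row 2 0] ++ [seq unit_row 1 m | m <- masks (pred1 1)])].
Definition elim_ok : bool :=
  [&& all linear_term Qeqs, path.sorted N.ltb [seq b.1 | b <- Qgroups],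
      all (fun b => selected b.1) Qgroups & spans_ok [seq b.2 | b <- Qgroups]].

(* jets and structure constants *)
Definition coef (m : N) (l : sexp) : Z :=
  foldr (fun t a => if [&& N.eqb (low 8 t.1.1) m, t.1.2.1 == 0 & nilp t.1.2.2] then Z.add t.2 a else a) 0%Z l.
Definition ljet (j : row) (l : sexp) : Z :=
  foldr (fun t a => Z.add (Z.mul t.2 (coef t.1.1 (iter t.1.2 leven l))) a) 0%Z j.
Definition ljets (l : sexp) : seq Z := [seq ljet j l | j <- jets].
Definition lcomb (c : seq Z) (b : nat) : sexp :=
  flatten [seq (if Z.eqb t.1 0 then [::] else lscale t.1 (nth [::] t.2 b)) | t <- zip c Vs].
Definition bracket_ok (V W : lvf) : seq Z * bool :=
  let B := [seq norm l | l <- lbr 8 V W] in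
  let c := ljets (norm (lsigma B)) in
  (c, all (fun b => nilb (lscale 2 (nth [::] B b) ++ lscale (-1) (lcomb c b))) (iota 0 9)).

Definition unit := (nat * nat * nat)%type.
Definition uexp := lc unit.
Definition gexp := lc (unit * bool).

Definition zsum (f : nat -> Z) (n : nat) : Z := foldr (fun i a => Z.add (f i) a) 0%Z (iota 0 n).
Definition zbool (b : bool) : Z := if b then 1%Z else 0%Z.
Definition zline (p q r : nat) : bool := (q == (p + 1) %% 7) && (r == (p + 3) %% 7).
Definition zfano p q r := [|| zline p q r, zline q r p | zline r p q].
Definition zoct p q r : Z := Z.sub (zbool (zfano p q r)) (zbool (zfano q p r)).
Definition zgamma (p s t : nat) : Z :=
  match s, t with
  | 0, 0 => 0%Z
  | 0, t'.+1 => Z.opp (zbool (t' == p))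
  | s'.+1, 0 => zbool (s' == p)
  | s'.+1, t'.+1 => zoct p t' s'
  end.
Definition zgamma2 p q s t : Z :=
  zsum (fun u => Z.sub (Z.mul (zgamma p s u) (zgamma q u t)) (Z.mul (zgamma q s u) (zgamma p u t))) 8.
Definition g2tab : seq (seq (seq (seq Z))) :=
  [seq [seq [seq [seq zgamma2 p q s t | t <- iota 0 8] | s <- iota 0 8] | q <- iota 0 7] | p <- iota 0 7].
Definition zsymp (c d : nat) : Z := Z.sub (zbool ((c == 0) && (d == 1))) (zbool ((c == 1) && (d == 0))).

Section Bracket.
Variable G : nat -> nat -> nat -> nat -> Z.
Definition uif (b : bool) (c : Z) (u : unit) : uexp := if b then [:: (u, c)] else [::].
Definition uspin (p q s c : nat) : uexp :=
  flatten [seq (let x := G p q t s in if Z.eqb x 0 then [::] else [:: ((2, t, c), Z.mul (-3) x)]) | t <- iota 0 8].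
Definition uodd (s c t d : nat) : uexp :=
  let y := zsymp c d in
  (if Z.eqb y 0 then [::] else
     flatten [seq flatten [seq (let x := G p q s t in
        if Z.eqb x 0 then [::] else [:: ((0, p, q), Z.mul (Z.mul (-8) y) x)]) | q <- iota 0 7] | p <- iota 0 7])
  ++ (if s == t then uif (d == 0) 24 (1, c, 1) ++ uif (d == 1) (-24) (1, c, 0)
        ++ uif (c == 0) 24 (1, d, 1) ++ uif (c == 1) (-24) (1, d, 0) else [::]).
Definition ubr (u v : unit) : uexp :=
  match u, v with
  | (0, p, q), (0, r, s) => uif (q == r) 24 (0, p, s) ++ uif (s == p) (-24) (0, r, q)
  | (0, p, q), (2, s, c) => uspin p q s c
  | (2, s, c), (0, p, q) => lscale (-1) (uspin p q s c)
  | (1, p, q), (1, r, s) => uif (q == r) 24 (1, p, s) ++ uif (s == p) (-24) (1, r, q)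
  | (1, a, b), (2, s, c) => uif (c == b) 24 (2, s, a)
  | (2, s, c), (1, a, b) => uif (c == b) (-24) (2, s, a)
  | (2, s, c), (2, t, d) => uodd s c t d
  | _, _ => [::]
  end.
Definition gbr (l m : gexp) : gexp :=
  flatten [seq flatten [seq [seq ((w.1, x.1.2 (+) y.1.2),
      Z.mul (ksign (x.1.2 && y.1.2)) (Z.mul (Z.mul x.2 y.2) w.2)) | w <- ubr x.1.1 y.1.1] | y <- m] | x <- l].
End Bracket.

Definition uwf (u : unit) : bool :=
  match u with
  | (0, p, q) => (p < 7) && (q < 7)
  | (1, a, b) => (a < 2) && (b < 2)
  | (2, s, c) => (s < 8) && (c < 2)
  | _ => false
  end.
Definition uleb (a b : unit * bool * Z) : bool :=
  let: ((k, p, q), i, _) := a in let: ((k', p', q'), i', _) := b in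
  if k == k' then if p == p' then if q == q' then i ==> i' else (q <= q')%N else (p <= p')%N else (k <= k')%N.
Definition gnilb (l : gexp) : bool := if combine (sort uleb l) is [::] then true else false.

Definition lel (k : nat) : gexp :=
  flatten [seq [seq ((w.1, odd t.1.2), Z.mul t.1.1 w.2) | w <-
     match t.2 with
     | (0, p, q) => [:: ((0, p, q), 1%Z); ((0, q, p), (-1)%Z)]
     | (1, 0, _) => [:: ((1, 0, 0), 1%Z); ((1, 1, 1), (-1)%Z)]
     | (1, 1, _) => [:: ((1, 0, 1), 1%Z)]
     | (1, _, _) => [:: ((1, 1, 0), 1%Z)]
     | u => [:: (u, 1%Z)]
     end] | t <- (nth ([::], [::], [::]) data k).1.2].
Definition Ls : seq gexp := [seq lel k | k <- iota 0 40].
Definition gcomb (c : seq Z) : gexp :=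
  flatten [seq (if Z.eqb t.1 0 then [::] else lscale t.1 t.2) | t <- zip c Ls].

Definition G2 p q s t : Z := nth 0%Z (nth [::] (nth [::] (nth [::] g2tab p) q) s) t.
Definition gpair_ok (c : seq Z) (l m : gexp) : bool := gnilb (gbr G2 l m ++ lscale (-48) (gcomb c)).
Definition table_ok : bool :=
  all (fun i => all (fun j =>
    let: (c, b) := bracket_ok (nth [::] Vs i) (nth [::] Vs j) in
    b && gpair_ok c (nth [::] Ls i) (nth [::] Ls j)) (iota 0 40)) (iota 0 40).

(* pairing *)
Definition gterm (x y : unit * bool * Z) : bool * Z :=
  (x.1.2 (+) y.1.2, Z.mul (ksign (x.1.2 && ~~ y.1.2)) (Z.mul x.2 y.2)).
Definition gpairing (l m : gexp) : lc bool :=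
  flatten [seq [seq gterm x y | y <- m & x.1.1 == y.1.1] | x <- l].
Definition gval (l : lc bool) (b : bool) : Z := foldr (fun t a => if t.1 == b then Z.add t.2 a else a) 0%Z l.
Definition gis (l : lc bool) (z : Z) : bool := Z.eqb (gval l false) z && Z.eqb (gval l true) 0.
Definition gnorm (l : gexp) : Z := foldr (fun t a => Z.add (Z.mul t.2 t.2) a) 0%Z l.
Definition dual_ok : bool :=
  all (fun k => ~~ Z.eqb (gnorm (nth [::] Ls k)) 0 &&
    all (fun j => gis (gpairing (nth [::] Ls k) (nth [::] Ls j)) (if k == j then gnorm (nth [::] Ls k) else 0%Z)) (iota 0 40))
  (iota 0 40).

Definition gent (l : gexp) (u : unit) : lc bool := [seq (t.1.2, t.2) | t <- l & t.1.1 == u].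
Definition member_ok (l : gexp) : bool :=
  all (fun p => all (fun q => gis (gent l (0, p, q) ++ gent l (0, q, p)) 0) (iota 0 7)) (iota 0 7)
  && gis (gent l (1, 0, 0) ++ gent l (1, 1, 1)) 0.
Definition isodd (l : gexp) : bool := has (fun t => t.1.1.1.1 == 2) l.
Definition homog_ok (l : gexp) : bool := all (fun t => (t.1.1.1.1 == 2) == isodd l) l.
Definition gelem_ok : bool := all (fun l => [&& all (fun t => uwf t.1.1) l, member_ok l & homog_ok l]) Ls.

(* spanning *)
Definition gweight (l : gexp) : Z := Z.div 2304 (gnorm l).
Definition gproj (u : unit) : gexp :=
  flatten [seq flatten [seq lscale (gweight l) [seq ((w.1.1, x.1.2 (+) w.1.2),
     Z.mul (ksign (x.1.2 && ~~ w.1.2)) (Z.mul x.2 w.2)) | w <- l] | x <- l & x.1.1 == u] | l <- Ls].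
Definition guproj (u : unit) : gexp :=
  match u with
  | (0, p, q) => [:: ((0, p, q, false), 1152%Z); ((0, q, p, false), (-1152)%Z)]
  | (1, a, b) => if a == b then [:: ((1, a, a, false), 1152%Z); ((1, 1 - a, 1 - a, false), (-1152)%Z)]
      else [:: ((u, false), 2304%Z)]
  | _ => [:: ((u, false), 2304%Z)]
  end.
Definition units (k m n : nat) : seq unit := [seq (k, p, q) | p <- iota 0 m, q <- iota 0 n].
Definition span_ok : bool :=
  all (fun u => gnilb (gproj u ++ lscale (-1) (guproj u))) (units 0 7 7 ++ units 1 2 2 ++ units 2 8 2).
Definition parity_ok : bool :=
  all (fun k => all (fun t => popodd 8 t.1.1 == isodd (nth [::] Ls k)) (nth [::] jets k)) (iota 0 40).
End Lists.
Import Lists.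

Module Denotation.
Import numFieldNormedType.Exports mathcomp.boot.finset.
Local Open Scope ring_scope.

Section Scalars.
Variable K : numFieldType.
Definition zK (c : Z) : K := (int_of_Z c)%:~R.
Lemma zKD a b : zK (Z.add a b) = zK a + zK b.
Proof. by rewrite /zK -intrD -rmorphD. Qed.
Lemma zKM a b : zK (Z.mul a b) = zK a * zK b.
Proof. by rewrite /zK -intrM -rmorphM. Qed.
Lemma zKN a : zK (Z.opp a) = - zK a.
Proof. by rewrite /zK -rmorphN -rmorphN. Qed.
Lemma zK_neg p : zK (Z.neg p) = - zK (Z.pos p).
Proof. exact: (zKN (Z.pos p)). Qed.
Lemma zK0 : zK 0 = 0. Proof. by []. Qed.
Lemma zK1 : zK 1 = 1. Proof. by []. Qed.
Lemma zK_nat n : zK (Z.of_nat n) = n%:R.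
Proof.
elim: n => [//|n IH]; rewrite (_ : Z.of_nat n.+1 = Z.add (Z.of_nat n) 1); last by lia.
by rewrite zKD IH zK1 -natr1.
Qed.
Lemma zK_neq0 c : Z.eqb c 0 = false -> zK c != 0.
Proof.
move=> /Z.eqb_neq c0; rewrite /zK intr_eq0; apply/eqP => E; apply: c0.
by rewrite -[c]int_of_ZK E.
Qed.
Lemma zK_sign b : zK (ksign b) = (-1) ^+ b.
Proof. by case: b; rewrite ?expr1 ?expr0 // -[ksign true]/(Z.opp 1) zKN zK1. Qed.

Section Lin.
Variables (V : lmodType K) (T : Type) (d : T -> V).
Definition lin (l : lc T) : V := \sum_(t <- l) zK t.2 *: d t.1.
Lemma lin_nil : lin [::] = 0. Proof. by rewrite /lin big_nil. Qed.
Lemma lin_cons t l : lin (t :: l) = zK t.2 *: d t.1 + lin l.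
Proof. by rewrite /lin big_cons. Qed.
Lemma lin_cat l1 l2 : lin (l1 ++ l2) = lin l1 + lin l2.
Proof. by rewrite /lin big_cat. Qed.
Lemma lin_scale c l : lin (lscale c l) = zK c *: lin l.
Proof.
rewrite /lin /lscale big_map scaler_sumr; apply: eq_bigr => t _ /=.
by rewrite zKM scalerA.
Qed.
Lemma lin_flatten (L : seq (lc T)) : lin (flatten L) = \sum_(l <- L) lin l.
Proof.
elim: L => [|l L IH]; first by rewrite big_nil lin_nil.
by rewrite big_cons /= lin_cat IH.
Qed.
End Lin.

Lemma lin_combine (V : lmodType K) (T : eqType) (d : T -> V) (l : lc T) :
  lin d (combine l) = lin d l.
Proof.
elim: l => [//|t l IH]; rewrite lin_cons -IH /= /lcons.
case: (combine l) => [|[k c] r]; first by rewrite lin_cons.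
case: eqP => [E|_]; last by rewrite !lin_cons.
rewrite lin_cons -E addrA -scalerDl -zKD /=.
case: (Z.eqb_spec (Z.add t.2 c) 0) => [->|_]; last by rewrite lin_cons E.
by rewrite zK0 scale0r add0r.
Qed.

Lemma lin_norm (V : lmodType K) (d : key -> V) (l : sexp) : lin d (norm l) = lin d l.
Proof. by rewrite /norm lin_combine; apply: perm_big; rewrite perm_sort. Qed.
End Scalars.

Section Denote.
Variables (K : numFieldType) (e : N -> K -> K).
Hypothesis smooth : forall i m (z : K), derivable (derive1n m (e i)) z 1.
Local Notation zK := (zK K).

Definition sfactor (s : seq sym) : K -> K := fun z => \prod_(t <- s) derive1n t.2 (e t.1) z.
Definition mfun (r : mon) : K -> K := fun z => z ^+ r.1 * sfactor r.2 z.
Definition kden n (k : key) : sfun K n := mono (setN n k.1) (mfun k.2).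
Definition sden n (l : sexp) : sfun K n := lin (kden n) l.

Lemma mfunM i j s t : mfun ((i + j)%N, s ++ t) = (fun z => mfun (i, s) z * mfun (j, t) z).
Proof. by apply/funext => z; rewrite /mfun /sfactor /= exprD big_cat /=; ring. Qed.

Lemma sden_norm n l : sden n (norm l) = sden n l. Proof. exact: lin_norm. Qed.
Lemma nilbP n l : nilb l -> sden n l = 0.
Proof. by rewrite /nilb -(sden_norm n); case: norm => // _; rewrite /sden lin_nil. Qed.

Lemma smul_sum n (I J : Type) (r : seq I) (s : seq J) (F : I -> sfun K n) (G : J -> sfun K n) :
  smul (\sum_(i <- r) F i) (\sum_(j <- s) G j) = \sum_(i <- r) \sum_(j <- s) smul (F i) (G j).
Proof.
rewrite (big_morph (fun f => smul f _) (fun f g => smulDl f g _) (smul0l _)).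
apply: eq_bigr => i _.
by rewrite (big_morph (fun f => smul _ f) (fun f g => smulDr f g _) (smul0r _)).
Qed.

Lemma sden_mul n l1 l2 : smul (sden n l1) (sden n l2) = sden n (lmul n l1 l2).
Proof.
rewrite [LHS]smul_sum /lmul /sden lin_flatten big_map; apply: eq_bigr => a _.
rewrite lin_flatten big_map; apply: eq_bigr => -[[B [j t]] d] _; case: a => [[A [i s]] c] /=.
rewrite smulZl smulZr scalerA smul_mono -disjNE; case: ifP => D; last by rewrite lin_nil scaler0.
rewrite lin_cons lin_nil addr0 /kden /= setN_lor mfunM !zKM zK_sign ipar_inversions signr_odd.
by rewrite scalerA.
Qed.

Lemma sden_odd n (i : 'I_n) l : d_odd i (sden n l) = sden n (lodd n i l).
Proof.
have d0 : d_odd i (0 : sfun K n) = 0.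
  by have := d_oddZ i 0 (0 : sfun K n); rewrite !scale0r.
rewrite /sden /lin (big_morph (d_odd i) (d_oddD i) d0) -/(lin _ _) /lodd lin_flatten big_map.
apply: eq_bigr => -[[A r] c] _ /=; rewrite d_oddZ d_odd_mono inE.
case: (bit A i); last by rewrite lin_nil scaler0.
rewrite lin_cons lin_nil addr0 /kden /= setN_clear zKM zK_sign ipar_inversions signr_odd.
by rewrite setN_single setN_clear scalerA.
Qed.

Lemma derivable_sfactor s z : derivable (sfactor s) z 1.
Proof.
elim: s => [|[i m] s IH].
  rewrite (_ : sfactor [::] = fun=> 1); first exact: derivable_cst.
  by apply/funext => x; rewrite /sfactor big_nil.
rewrite (_ : sfactor _ = derive1n m (e i) \* sfactor s); first exact: derivableM.
by apply/funext => x; rewrite /sfactor big_cons.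
Qed.

Lemma derive_sfactor s z : derive1 (sfactor s) z = \sum_(t <- bumps s) sfactor t z.
Proof.
elim: s => [|[i m] s IH].
  rewrite big_nil (_ : sfactor [::] = fun=> 1); first exact: derive1_cst.
  by apply/funext => x; rewrite /sfactor big_nil.
rewrite (_ : sfactor _ = derive1n m (e i) * sfactor s); last first.
  by apply/funext => x; rewrite /sfactor big_cons.
rewrite derive1E deriveM //; last exact: derivable_sfactor.
rewrite /= big_cons big_map -!derive1E IH addrC /GRing.scale /= mulr_sumr; congr (_ + _).
  by rewrite /sfactor big_cons /= mulrC.
by apply: eq_bigr => t _; rewrite /sfactor big_cons.
Qed.

Lemma derivable_mfun r z : derivable (mfun r) z 1.
Proof.
rewrite (_ : mfun r = (@GRing.exp K ^~ r.1) * sfactor r.2) //.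
by apply: derivableM; [exact: exprn_derivable|exact: derivable_sfactor].
Qed.

Lemma holomorphic_sden n l : holomorphic (sden n l).
Proof.
elim: l => [|t l IH]; first by rewrite /sden lin_nil; exact: holomorphic0.
rewrite /sden lin_cons; apply: holomorphicD => //; apply: holomorphicZ.
by apply: holomorphic_mono => z; exact: derivable_mfun.
Qed.

Lemma monoD n (A : {set 'I_n}) (f g : K -> K) : mono A (fun z => f z + g z) = mono A f + mono A g.
Proof. by apply/ffunP => S; rewrite !ffunE; case: ifP => _; rewrite ?addr0. Qed.
Lemma monoZ n (A : {set 'I_n}) c (f : K -> K) : mono A (fun z => c * f z) = c *: mono A f.
Proof. by apply/ffunP => S; rewrite !ffunE; case: ifP => _; rewrite ?scaler0. Qed.
Lemma mono0 n (A : {set 'I_n}) : mono A (fun=> 0) = 0 :> sfun K n.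
Proof. by apply/ffunP => S; rewrite !ffunE; case: ifP. Qed.

Lemma sden_even n l : d_even (sden n l) = sden n (leven l).
Proof.
elim: l => [|[[A [i s]] c] l IH]; first by rewrite /sden lin_nil d_even0.
have -> : leven ((A, (i, s), c) :: l) = ((if i is i'.+1 then [:: ((A, (i', s)), Z.mul c (Z.of_nat i))] else [::])
     ++ [seq ((A, (i, s')), c) | s' <- bumps s]) ++ leven l by [].
rewrite {1}/sden lin_cons [RHS]lin_cat -/(sden n l) -/(sden n (leven l)) -IH.
rewrite d_evenD; [|apply: holomorphicZ; apply: holomorphic_mono => z; exact: derivable_mfun|exact: holomorphic_sden].
congr (_ + _); rewrite d_evenZ /=; last by apply: holomorphic_mono => z; exact: derivable_mfun.
rewrite /kden d_even_mono /= lin_cat.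
have -> : derive1 (mfun (i, s)) = fun z => (if i is i'.+1 then i%:R * mfun (i', s) z else 0) + \sum_(t <- bumps s) mfun (i, t) z.
  apply/funext => z; rewrite (_ : mfun _ = (@GRing.exp K ^~ i) * sfactor s) //.
  rewrite derive1E deriveM; [|exact: exprn_derivable|exact: derivable_sfactor].
  rewrite -derive1E derive_sfactor /GRing.scale /= addrC; congr (_ + _).
    rewrite exp_derive /mfun /GRing.scale /= mulr1; case: i => [|i] /=; last by ring.
    by rewrite mul0r mulr0.
  by rewrite mulr_sumr.
rewrite monoD scalerDr; congr (_ + _).
  case: i => [|i]; first by rewrite mono0 scaler0 lin_nil.
  by rewrite monoZ lin_cons lin_nil addr0 zKM zK_nat scalerA.
elim: (bumps s) => [|t u IHu].
  by rewrite (_ : (fun z => _) = fun=> 0) ?mono0 ?scaler0 ?lin_nil//; apply/funext => z; rewrite big_nil.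
rewrite (_ : (fun z => _) = fun z => mfun (i, t) z + \sum_(t <- u) mfun (i, t) z); last first.
  by apply/funext => z; rewrite big_cons.
by rewrite monoD scalerDr IHu /= lin_cons.
Qed.

Lemma sden_proj n p l : sproj p (sden n l) = sden n (lproj n p l).
Proof.
elim: l => [|t l IH]; first by rewrite /sden lin_nil; have := sprojZ p 0 (0 : sfun K n); rewrite !scale0r.
rewrite /sden lin_cons sprojD -/(sden n _) IH sprojZ sproj_mono -popoddE /= -/(popodd n t.1.1).
by case: ifP => _; rewrite ?scaler0 ?add0r // /sden lin_cons.
Qed.

Lemma sden_gen n (i : 'I_n) : sgen K i = sden n (lgen i).
Proof.
rewrite sgenE; transitivity (zK 1 *: kden n (N.shiftl 1 (N.of_nat i), (0%N, [::]))).
  rewrite zK1 scale1r /kden; cbn [fst snd]; rewrite setN_single; congr mono.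
  by apply/funext => z; rewrite /mfun /sfactor big_nil expr0 mulr1.
by rewrite /sden /lgen lin_cons lin_nil addr0.
Qed.

Lemma sden_cat n a b : sden n (a ++ b) = sden n a + sden n b. Proof. exact: lin_cat. Qed.
Lemma sden_scale n c a : sden n (lscale c a) = zK c *: sden n a. Proof. exact: lin_scale. Qed.
Lemma sden_sum n m (f : nat -> sexp) : sden n (lsum f m) = \sum_(i < m) sden n (f i).
Proof. by rewrite /sden lin_flatten big_map -(big_mkord predT (fun i => lin _ (f i))) /index_iota subn0. Qed.

Definition vden n (X : lvf) : vfield K n :=
  (sden n (nth [::] X 0), [ffun i : 'I_n => sden n (nth [::] X i.+1)]).

Lemma vapp_den n X l : vapp (vden n X) (sden n l) = sden n (lapp n X l).
Proof.
rewrite /vapp /lapp sden_cat sden_even sden_mul sden_sum; congr (_ + _).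
by apply: eq_bigr => i _; rewrite ffunE sden_odd sden_mul.
Qed.

Lemma nth_iota_map T (x : T) (f : nat -> T) n i : (i < n)%N -> nth x [seq f i | i <- iota 0 n] i = f i.
Proof. by move=> h; rewrite (nth_map 0%N) ?size_iota// nth_iota. Qed.

Lemma vproj_den n p X : vproj p (vden n X) = vden n (lvproj n p X).
Proof.
rewrite /vproj /vden /= sden_proj; congr (_, _); apply/ffunP => i; rewrite !ffunE sden_proj.
by rewrite nth_iota_map.
Qed.

Lemma sum_bool (V : zmodType) (F : bool -> V) : \sum_(p : bool) F p = F true + F false.
Proof. exact: big_bool. Qed.

Lemma vbracketE n (X Y : vfield K n) : vbracket X Y =
  let b p q := vapp_comp (vproj p X) (vproj q Y)
    - ((-1) ^+ (p && q) : K) *: vapp_comp (vproj q Y) (vproj p X) in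
  (b true true + b true false) + (b false true + b false false).
Proof.
rewrite /vbracket; etransitivity; first exact: sum_bool.
by congr (_ + _); exact: sum_bool.
Qed.

Lemma vden2 n X (i : 'I_n) : (vden n X).2 i = sden n (nth [::] X i.+1).
Proof. by rewrite ffunE. Qed.
Lemma addv2 n (X Y : vfield K n) i : (X + Y).2 i = X.2 i + Y.2 i.
Proof. by rewrite ffunE. Qed.

Lemma vbr_den n X Y : vbracket (vden n X) (vden n Y) = vden n (lbr n X Y).
Proof.
rewrite vbracketE; cbv beta zeta; rewrite !vproj_den.
have C U V (s : bool) : vapp_comp (vden n U) (vden n V) - ((-1) ^+ s : K) *: vapp_comp (vden n V) (vden n U)
  = vden n [seq lapp n U (nth [::] V c) ++ lscale (ksign (~~ s)) (lapp n V (nth [::] U c)) | c <- iota 0 n.+1].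
  have E c : vapp (vden n U) (sden n (nth [::] V c)) - ((-1) ^+ s : K) *: vapp (vden n V) (sden n (nth [::] U c))
     = sden n (lapp n U (nth [::] V c) ++ lscale (ksign (~~ s)) (lapp n V (nth [::] U c))).
    rewrite !vapp_den sden_cat sden_scale zK_sign -scaleNr; congr (_ + _ *: _).
    by case: s; rewrite ?expr1 ?expr0 ?opprK.
  apply/pair_equal_spec; split; first by rewrite /= -E.
  apply/ffunP => i; rewrite [RHS]ffunE; cbn [snd].
  rewrite (nth_iota_map _ _ (_ : i.+1 < n.+1)%N) ?ltnS // -E.
  by rewrite /= !ffunE.
rewrite !C /lbr; cbv beta zeta; apply/pair_equal_spec; split; first by rewrite /= !sden_cat.
apply/ffunP => i; rewrite [RHS]ffunE; cbn [snd].
rewrite (nth_iota_map _ _ (_ : i.+1 < n.+1)%N) ?ltnS // !sden_cat.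
have i1 : (i.+1 < n.+1)%N by rewrite ltnS.
by rewrite !addv2 !vden2 !(nth_iota_map _ _ i1) !sden_cat.
Qed.

Lemma sigma_den X : sigma (vden 8 X) = sden 8 (lsigma X).
Proof.
rewrite /sigma /lsigma sden_cat sden_scale zK_neg zK1 scaleN1r sden_sum; congr (_ - _).
by apply: eq_bigr => i _; rewrite ffunE (sden_gen (iu i)) sden_mul.
Qed.

Lemma setN_land m : setN 16 (N.land m 255) = lshift 8 @: setN 8 m :> {set 'I_(8 + 8)}.
Proof.
apply/finset.setP => i; rewrite !inE bit_land (bit_ones 8).
case: (ltnP i 8) => i8; last first.
  rewrite andbF; apply/esym/negbTE/imsetP => -[j _ E]; move: i8; rewrite E /= leqNgt.
  by rewrite ltn_ord.
rewrite andbT; have -> : i = lshift 8 (Ordinal i8) by apply: val_inj.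
by rewrite mem_imset ?inE //; exact: lshift_inj.
Qed.

Lemma pull0 : pull (0 : sfun K 8) = 0.
Proof. by have := pullZ 0 (0 : sfun K 8); rewrite !scale0r. Qed.

Lemma pull_den l : pull (sden 8 l) = sden 16 (lpull l).
Proof.
elim: l => [|t l IH]; first by rewrite /sden !lin_nil pull0.
by rewrite /sden lin_cons pullD pullZ -/(sden 8 l) IH pull_mono -setN_land /= lin_cons.
Qed.

Lemma Dx_den (i : 'I_4) l : d_odd (ix i) (sden 8 l) + smul (sgen K (iu i)) (d_even (sden 8 l)) = sden 8 (lDx i l).
Proof. by rewrite /lDx sden_cat (sden_gen (iu i)) (sden_odd (ix i)) sden_even sden_mul. Qed.

Lemma dc_den l : d_contact (sden 8 l) = sden 16 (ldc l).
Proof.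
rewrite /d_contact /ldc sden_sum; apply: eq_bigr => i _.
by rewrite Dx_den (sden_odd (iu i)) sden_cat /omega /theta !sden_gen !pull_den !sden_mul.
Qed.

Lemma lie_den X : lie_field (vden 8 X) = vden 16 (llie X).
Proof.
have nS k : nth [::] (llie X) k.+1 = nth [::] ([seq lpull (nth [::] X i.+1) | i <- iota 0 8]
    ++ [seq ldc (nth [::] X i.+1) | i <- iota 0 8]) k by [].
apply/pair_equal_spec; split; first exact: pull_den.
apply/ffunP => a; rewrite [LHS]ffunE [RHS]ffunE nS nth_cat size_map size_iota.
case: splitP => b E; rewrite [X in if (X < _)%N then _ else _]E [X in nth _ _ X]E vden2.
  by rewrite ltn_ord nth_iota_map// pull_den.
rewrite ltnNge leq_addr [X in nth _ _ (X - _)]E addKn; cbn [negb].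
by rewrite nth_iota_map ?ltn_ord // -dc_den.
Qed.

Lemma Q_den : Qtensor K = sden 16 lQ.
Proof.
have om (i : 'I_4) k : k = (8 + i)%N -> omega K i = sden 16 (lgen k).
  by move=> ->; rewrite /omega sden_gen.
have th (i : 'I_4) k : k = (12 + i)%N -> theta K i = sden 16 (lgen k).
  by move=> ->; rewrite /theta sden_gen.
have z2 : zK 2 = 2 by rewrite -(zK_nat K 2).
have L (p : seq nat -> sexp) : sden 16 (p [:: 8; 9; 12; 13] ++ p [:: 8; 10; 12; 14]
    ++ p [:: 8; 11; 12; 15] ++ lscale (-2) (p [:: 8; 13; 14; 15])
    ++ lscale (-1) (p [:: 9; 10; 13; 14]) ++ lscale (-1) (p [:: 9; 11; 13; 15])
    ++ lscale (-1) (p [:: 10; 11; 14; 15]) ++ lscale 2 (p [:: 9; 10; 11; 12]))%N =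
   sden 16 (p [:: 8; 9; 12; 13]) + sden 16 (p [:: 8; 10; 12; 14]) + sden 16 (p [:: 8; 11; 12; 15])
   - 2 *: sden 16 (p [:: 8; 13; 14; 15]) - sden 16 (p [:: 9; 10; 13; 14])
   - sden 16 (p [:: 9; 11; 13; 15]) - sden 16 (p [:: 10; 11; 14; 15])
   + 2 *: sden 16 (p [:: 9; 10; 11; 12]).
  by rewrite !sden_cat !sden_scale !zK_neg z2 zK1 !scaleN1r !scaleNr !addrA.
have M (a b c d : nat) : sden 16 (lprod [:: a; b; c; d]) =
    smul (smul (smul (sden 16 (lgen a)) (sden 16 (lgen b))) (sden 16 (lgen c))) (sden 16 (lgen d)).
  by rewrite !sden_mul.
rewrite /lQ (L lprod) !M /Qtensor.
rewrite (om 0 8%N erefl) (om 1 9%N erefl) (om 2 10%N erefl) (om 3 11%N erefl).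
by rewrite (th 0 12%N erefl) (th 1 13%N erefl) (th 2 14%N erefl) (th 3 15%N erefl).
Qed.
End Denote.

Lemma bit_low n A i : bit (low n A) i = bit A i && (i < n)%N.
Proof. by rewrite /low bit_land bit_ones. Qed.
Lemma low_setN n A B : (setN n A == setN n B) = N.eqb (low n A) (low n B).
Proof.
apply/eqP/N.eqb_spec => [/finset.setP E|E].
  apply: N.bits_inj => k; rewrite -(N2Nat.id k) -!/(bit _ _) !bit_low.
  case: ltnP => kn; rewrite ?andbF // !andbT.
  by have := E (Ordinal kn); rewrite !inE.
apply/finset.setP => i; have := congr1 (fun m => bit m i) E.
by rewrite !bit_low ltn_ord !andbT !inE.
Qed.

Section Checks.
Lemma defects_ok : all defect_ok (iota 0 8). Proof. vm_cast_no_check (erefl true). Qed.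
Lemma elimination_ok : elim_ok. Proof. vm_cast_no_check (erefl true). Qed.
Lemma lies_ok : all (fun z => lie_ok z.1 z.2) (zip Fs Vs). Proof. vm_cast_no_check (erefl true). Qed.
Lemma contacts_ok : all contact_ok Vs. Proof. vm_cast_no_check (erefl true). Qed.
End Checks.

Section Geometry.
Variable K : numFieldType.
Hypothesis entire_derive : forall f : K -> K, (forall z : K, derivable f z 1) ->
  forall z : K, derivable (derive1 f) z 1.
Hypothesis derive0_const : forall f : K -> K, (forall z : K, derivable f z 1) ->
  (forall z, derive1 f z = 0) -> forall z, f z = f 0.

Definition entire (f : K -> K) := forall z : K, derivable f z 1.
Lemma entire_derive1n (phi : K -> K) m : entire phi -> entire (derive1n m phi).
Proof. by move=> hf; elim: m => [|m IH]; [exact: hf|exact: entire_derive]. Qed.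

(* the environment whose symbols are the coefficients of a family of superfunctions *)
Definition env (G : nat -> sfun K 8) (id : N) : K -> K :=
  G (N.to_nat (N.div id 256)) (setN 8 id).

Lemma env_smooth G : (forall i, holomorphic (G i)) ->
  forall i m (z : K), derivable (derive1n m (env G i)) z 1.
Proof. by move=> hG i m; apply: entire_derive1n; apply: hG. Qed.

Lemma perm_masks n : perm_eq [seq setN n (N.of_nat m) | m <- iota 0 (2 ^ n)] (enum {set 'I_n}).
Proof.
have S : {subset enum {set 'I_n} <= [seq setN n (N.of_nat m) | m <- iota 0 (2 ^ n)]}.
  move=> T _; have [m mn <-] := setN_surj T; apply/mapP; exists m => //.
  by rewrite mem_iota.
have sz : size [seq setN n (N.of_nat m) | m <- iota 0 (2 ^ n)] = size (enum {set 'I_n}).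
  by rewrite size_map size_iota -cardE -cardsT -powersetT card_powerset cardsT card_ord.
apply: uniq_perm; first by apply: (leq_size_uniq (enum_uniq _) S); rewrite sz.
  exact: enum_uniq.
by have [_ E] := uniq_min_size (enum_uniq _) S (eq_leq sz) => x; rewrite E.
Qed.

Lemma sum_mono n (f : sfun K n) : \sum_(m <- iota 0 (2 ^ n)) mono (setN n (N.of_nat m)) (f (setN n (N.of_nat m))) = f.
Proof.
rewrite -(big_map (fun m => setN n (N.of_nat m)) predT (fun S => mono S (f S))).
rewrite (perm_big _ (perm_masks n)) big_enum; apply/ffunP => S; rewrite sum_ffunE.
rewrite (bigD1 S) //= ffunE eqxx big1 ?addr0 // => T TS.
by rewrite ffunE eq_sym (negbTE TS).
Qed.

Lemma id_div i m : (m < 256)%N -> N.to_nat (N.div (N.of_nat (256 * i + m)) 256) = i.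
Proof.
move=> h; rewrite -(N.div_unique _ 256 (N.of_nat i) (N.of_nat m)) ?Nat2N.id //; first by lia.
by rewrite Nat2N.inj_add Nat2N.inj_mul.
Qed.

Lemma id_set i m : setN 8 (N.of_nat (256 * i + m)) = setN 8 (N.of_nat m).
Proof.
apply/eqP; rewrite low_setN; apply/N.eqb_spec.
rewrite /low !N.land_ones Nat2N.inj_add Nat2N.inj_mul N.mul_comm N.add_comm.
exact: N.Div0.mod_add.
Qed.

Lemma lsym_den G i : sden (env G) 8 (lsym i) = G i.
Proof.
rewrite /sden /lin /lsym big_map -[RHS]sum_mono; apply: eq_big_seq => m; rewrite mem_iota => /= m256.
rewrite zK1 scale1r /kden /=; congr mono; apply/funext => z.
by rewrite /mfun /sfactor /= big_seq1 expr0 mul1r /= /env id_div // id_set.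
Qed.

Lemma plain_den (e1 e2 : N -> K -> K) n l : plain l -> sden e1 n l = sden e2 n l.
Proof.
move=> /allP pl; apply: eq_big_seq => t /pl /nilP E; congr (_ *: _).
by rewrite /kden; congr mono; apply/funext => z; rewrite /mfun /sfactor E !big_nil.
Qed.

(* the trivial environment *)
Definition env0 (_ : N) : K -> K := fun=> 0.
Lemma derive1n0_cst m : derive1n m (fun=> 0 : K) = (fun=> 0 : K) :> (K -> K).
Proof. by elim: m => // m IH; rewrite /derive1n /= -/(derive1n m _) IH; apply/funext => z; exact: derive1_cst. Qed.
Lemma env0_smooth i m (z : K) : derivable (derive1n m (env0 i)) z 1.
Proof. by rewrite derive1n0_cst; exact: derivable_cst. Qed.

Lemma vholomorphic_vden (e : N -> K -> K) (V : lvf) n : (forall i m (z : K), derivable (derive1n m (e i)) z 1) ->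
  vholomorphic (vden e n V).
Proof. by move=> se; split=> [|i]; rewrite ?vden2; apply: holomorphic_sden. Qed.

(* contact *)
Lemma contact_okP (V : lvf) : contact_ok V -> preserves_contact (vden env0 8 V).
Proof.
move=> /andP[pV ok] Y [[Y1 Y2] sY].
pose G i : sfun K 8 := if i is i'.+1 then (if insub i' is Some j then Y.2 j else 0) else 0.
have hG i : holomorphic (G i).
  case: i => [|i] /=; first exact: holomorphic0.
  by case: insub => [j|]; [exact: Y2|exact: holomorphic0].
have sG := env_smooth hG.
have GY (j : 'I_8) : sden (env G) 8 (lsym j.+1) = Y.2 j by rewrite lsym_den /= valK.
have YE : Y = vden (env G) 8 symY.
  rewrite [LHS]surjective_pairing; apply/pair_equal_spec; split.
    move/eqP: sY; rewrite subr_eq0 => /eqP ->; rewrite /= (sden_sum (env G)).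
    by apply: eq_bigr => i _; rewrite -(GY (ix i)) (sden_gen (env G) (iu i)) sden_mul.
  by apply/ffunP => j; rewrite ffunE -[nth _ symY _]/(nth [::] [seq lsym i.+1 | i <- iota 0 8] j) nth_iota_map // GY.
have VE : vden env0 8 V = vden (env G) 8 V.
  have P c : plain (nth [::] V c).
    by case: (ltnP c (size V)) => h; [exact: (all_nthP [::] pV)|rewrite nth_default].
  by apply/pair_equal_spec; split; [exact: plain_den|apply/ffunP => i; rewrite !ffunE; exact: plain_den].
rewrite YE VE (vbr_den sG); split; first exact: vholomorphic_vden.
by rewrite sigma_den (nilbP _ _ ok).
Qed.

Lemma lie_okP (f : sexp) (V : lvf) : lie_ok f V -> preserves_Q (vden env0 8 V).
Proof.
move=> ok; exists (sden env0 8 (lscale 2 (leven f))); first exact: holomorphic_sden env0_smooth _ _.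
rewrite /lie_derivative (lie_den env0_smooth) (Q_den env0) (vapp_den env0_smooth) (pull_den env0) (sden_mul env0).
have := nilbP env0 16 ok; rewrite sden_cat sden_scale zK_neg zK1 scaleN1r => /eqP.
by rewrite subr_eq0 => /eqP.
Qed.
End Geometry.

Section Contact.
Variable K : numFieldType.
Hypothesis entire_derive : forall f : K -> K, (forall z : K, derivable f z 1) ->
  forall z : K, derivable (derive1 f) z 1.
Implicit Types (f : sfun K 8) (X : vfield K 8).

Definition contact_field f : vfield K 8 :=
  let g := sproj false f - sproj true f in
  (f + \sum_(i < 4) smul (d_odd (iu i) g) (sgen K (iu i)),
   [ffun a : 'I_(4 + 4) => match fintype.split a with
      | inl i => d_odd (iu i) g
      | inr i => d_odd (ix i) g + smul (sgen K (iu i)) (d_even g)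
      end]).

Lemma contact_den (e : N -> K -> K) l :
  (forall i m (z : K), derivable (derive1n m (e i)) z 1) ->
  contact_field (sden e 8 l) = vden e 8 (lcontact l).
Proof.
move=> se; have pmE : sproj false (sden e 8 l) - sproj true (sden e 8 l) = sden e 8 (lpm l).
  by rewrite !sden_proj /lpm sden_cat sden_scale zK_neg zK1 scaleN1r.
have nS k : nth [::] (lcontact l) k.+1 = nth [::] ([seq lodd 8 (4 + i) (lpm l) | i <- iota 0 4]
    ++ [seq lDx i (lpm l) | i <- iota 0 4]) k by [].
rewrite /contact_field pmE; apply/pair_equal_spec; split.
  rewrite -[nth [::] _ 0]/(l ++ lsum (fun i => lmul 8 (lodd 8 (4 + i) (lpm l)) (lgen (4 + i))) 4).
  rewrite sden_cat sden_sum; congr (_ + _); apply: eq_bigr => i _.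
  by rewrite (sden_odd e (iu i)) (sden_gen e (iu i)) sden_mul.
apply/ffunP => a; rewrite [LHS]ffunE [RHS]ffunE nS nth_cat size_map size_iota.
case: splitP => b E; rewrite [X in if (X < _)%N then _ else _]E [X in nth _ _ X]E.
  by rewrite ltn_ord nth_iota_map// (sden_odd e (iu b)).
rewrite ltnNge leq_addr [X in nth _ _ (X - _)]E addKn; cbn [negb].
by rewrite nth_iota_map ?ltn_ord // Dx_den.
Qed.

Definition vsym X (i : nat) : sfun K 8 :=
  if i is i'.+1 then (if insub i' is Some j then X.2 j else 0) else X.1.
Lemma vsym_holo X : vholomorphic X -> forall i, holomorphic (vsym X i).
Proof.
move=> [h1 h2] [|i]; first exact: h1.
by rewrite /vsym; case: insub => [j|]; [exact: h2|exact: holomorphic0].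
Qed.
Lemma vsym_den X : vden (env (vsym X)) 8 symX = X.
Proof.
rewrite [RHS]surjective_pairing; apply/pair_equal_spec; split; first exact: lsym_den.
apply/ffunP => j; rewrite ffunE.
rewrite -[nth _ symX _]/(nth [::] [seq lsym i.+1 | i <- iota 0 8] j) nth_iota_map // lsym_den /= valK.
by [].
Qed.

Lemma frames_ok : all (fun b => plain (nth [::] (lframe b) 0) && nilb (lsigma (lframe b))) (iota 0 8).
Proof. by vm_compute. Qed.

Lemma frame_contact e b : (b < 8)%N -> (forall i m (z : K), derivable (derive1n m (e i)) z 1) ->
  contact_section (vden e 8 (lframe b)).
Proof.
move=> b8 se; split; first exact: vholomorphic_vden.
have /allP/(_ b) := frames_ok; rewrite mem_iota => /(_ b8)/andP[_ ok].
by rewrite sigma_den nilbP.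
Qed.

Lemma contact_form X : vholomorphic X -> preserves_contact X -> X = contact_field (sigma X).
Proof.
move=> hX pX; have se := env_smooth entire_derive (vsym_holo hX).
set e := env (vsym X) in se; have XE : X = vden e 8 symX by rewrite vsym_den.
have D (a : nat) : (a < 8)%N -> sden e 8 (nth [::] symX a.+1) = sden e 8 (nth [::] (lcontact (lsigma symX)) a.+1).
  move=> a8; have /allP/(_ a) := defects_ok; rewrite mem_iota => /(_ a8)/(nilbP e 8).
  rewrite !sden_cat !sden_scale zK_neg zK1 !scaleN1r -sigma_den -(vbr_den se) -XE.
  have b8 : ((if a < 4 then a + 4 else a - 4) < 8)%N by case: ifP; lia.
  have [_ ->] := pX _ (frame_contact b8 se).
  by rewrite oppr0 addr0 => /eqP; rewrite subr_eq0 => /eqP.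
have S : contact_field (sigma X) = vden e 8 (lcontact (lsigma symX)).
  by rewrite {1}XE sigma_den contact_den.
have E2 : X.2 = (contact_field (sigma X)).2.
  by rewrite S {1}XE; apply/ffunP => a; rewrite !ffunE; apply: D.
rewrite [LHS]surjective_pairing [RHS]surjective_pairing E2; congr (_, _).
rewrite /sigma -[LHS](subrK (\sum_(i < 4) smul (X.2 (ix i)) (sgen K (iu i)))); congr (_ + _).
apply: eq_bigr => i _; rewrite {1}E2 ffunE; case: splitP => j /= E.
  by rewrite (_ : j = i) //; apply: val_inj.
by have := ltn_ord i; rewrite E; lia.
Qed.
End Contact.

Section Rows.
Variables (K : numFieldType) (d : sym -> K^o).
Local Notation rval := (lin d : row -> K^o).

Lemma scmp_eq s t : scmp s t = Eq -> s = t.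
Proof.
case: s t => [i m] [j k]; rewrite /scmp; cbn [fst snd].
by case: N.compare_spec => // -> /Nat.compare_eq_iff ->.
Qed.

Lemma axpy_val n a b r p : rval (axpy n a b r p) = zK K a *: rval r + zK K b *: rval p.
Proof.
elim: n r p => [|n IH] r p; first by rewrite /= lin_cat !lin_scale.
case: r => [|[s c] r]; first by rewrite /= lin_scale lin_nil scaler0 add0r.
case: p => [|[t v] p]; first by rewrite -[axpy _ _ _ _ _]/(lscale a ((s, c) :: r)) lin_scale lin_nil scaler0 addr0.
rewrite /=; case E: (scmp s t).
- have := IH r p; rewrite -(scmp_eq E) !lin_cons; cbn [fst snd].
  case: Z.eqb_spec => [Z0 ->|_ IHrp]; last rewrite lin_cons IHrp; cbn [fst snd].
    rewrite !scalerDr !scalerA addrACA -scalerDl -!zKM -zKD Z0 zK0 scale0r add0r //.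
  by rewrite zKD !zKM scalerDl !scalerDr !scalerA addrACA.
- by rewrite !lin_cons IH !lin_cons; cbn [fst snd]; rewrite zKM !scalerDr !scalerA !addrA.
- rewrite !lin_cons IH !lin_cons; cbn [fst snd]; rewrite zKM !scalerDr !scalerA !addrA.
  by congr (_ + _); rewrite -addrA addrC.
Qed.

Lemma eliminate_val a b r p : rval (eliminate a b r p) = zK K b *: rval r - zK K a *: rval p.
Proof. by rewrite axpy_val zKN scaleNr. Qed.

Lemma eliminate_zero s a r b p : rval ((s, b) :: p) = 0 ->
  rval (eliminate a b r p) = zK K b *: rval ((s, a) :: r).
Proof.
rewrite eliminate_val !lin_cons; cbn [fst snd] => /eqP; rewrite addrC addr_eq0 => /eqP ->.
by rewrite scalerN opprK scalerDr !scalerA addrC mulrC.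
Qed.

Lemma insert_val pivs r : (forall p, List.In p pivs -> rval p = 0) -> rval r = 0 ->
  forall p, List.In p (insert pivs r) -> rval p = 0.
Proof.
elim: pivs r => [|q ps IH] r hp r0 p; first by case: r r0 => [|[s a] r] r0 //= [<-|].
have hps p' : List.In p' ps -> rval p' = 0 by move=> ip; apply: hp; right.
have q0 : rval q = 0 by apply: hp; left.
case: r r0 => [|[s a] r] r0; first exact: hp.
case: q q0 hp => [|[t b] q] q0 hp /=; first exact: IH.
case E: (scmp s t) => /=.
- case=> [<-//|]; apply: IH => //.
  by rewrite (eliminate_zero (s := t)) // -(scmp_eq E) r0 scaler0.
- by case=> [<-//|[<-//|]]; apply: hps.
- by case=> [<-//|]; apply: IH.
Qed.

Lemma inspan_val pivs r : (forall p, List.In p pivs -> rval p = 0) -> inspan pivs r -> rval r = 0.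
Proof.
elim: pivs r => [|q ps IH] r hp; first by case: r => [_|[s a] r] //; rewrite lin_nil.
have hps p' : List.In p' ps -> rval p' = 0 by move=> ip; apply: hp; right.
have q0 : rval q = 0 by apply: hp; left.
case: r => [_|[s a] r]; first by rewrite lin_nil.
case: q q0 {hp} => [|[t b] q] q0 /=; first exact: IH.
case E: (scmp s t) => //=; last exact: IH.
move=> /andP[b0 /(IH _ hps)]; rewrite (eliminate_zero (s := t)) // -(scmp_eq E) => /eqP.
by rewrite scaler_eq0 (negbTE (zK_neq0 K (negbTE b0))) => /eqP.
Qed.

Lemma pivots_val L start : (forall p, List.In p start -> rval p = 0) ->
  (forall r, List.In r L -> rval r = 0) -> forall p, List.In p (pivots L start) -> rval p = 0.
Proof.
rewrite /pivots; elim: L start => [//|r L IH] start hs hL /=.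
apply: IH => [|q iq]; last by apply: hL; right.
apply: insert_val => //; rewrite /sort_row -(hL r); last by left.
by rewrite /lin; apply: perm_big; rewrite perm_sort.
Qed.
End Rows.

Section Group.
Variables (K : numFieldType) (e : N -> K -> K).
Definition symval (z : K) (s : sym) : K^o := derive1n s.2 (e s.1) z.

Lemma setN_low n A : setN n (low n A) = setN n A.
Proof. by apply/eqP; rewrite low_setN; apply/N.eqb_spec; rewrite /low -N.land_assoc N.land_diag. Qed.

Lemma linear_mfun (i : nat) s : (i == 0)%N && (size s == 1)%N ->
  mfun e (i, s) = fun z => symval z (head (0%num, 0%N) s).
Proof.
move=> /andP[/eqP-> ]; case: s => [|t []] // _.
by apply/funext => z; rewrite /mfun /sfactor big_seq1 expr0 mul1r.
Qed.

Lemma group_den n l : all linear_term l ->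
  sden e n l = \sum_(b <- group n l) mono (setN n b.1) (fun z => lin (symval z) b.2).
Proof.
elim: l => [_|[[A [i s]] c] l IH] /=; first by rewrite big_nil /sden lin_nil.
move=> /andP[lt /IH {}IH]; rewrite /sden lin_cons -/(sden e n l) IH; cbn [fst snd].
rewrite /kden; cbn [fst snd]; rewrite linear_mfun //.
have single : zK K c *: mono (setN n A) (fun z => symval z (head (0%num, 0%N) s)) =
    mono (setN n (low n A)) (fun z => lin (symval z) [:: (head (0%num, 0%N) s, c)]).
  rewrite setN_low -monoZ; congr mono; apply/funext => z.
  by rewrite lin_cons lin_nil addr0.
rewrite single; case: (group n l) => [|[B r] g]; first by rewrite big_seq1 big_nil addr0.
case: N.eqb_spec => [->|_]; last by rewrite [RHS]big_cons.
rewrite !big_cons addrA; congr (_ + _); cbn [fst snd]; rewrite -monoD; congr mono.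
by apply/funext => z; rewrite !lin_cons lin_nil addr0.
Qed.

Lemma group_low n l : all (fun b => low n b.1 == b.1) (group n l).
Proof.
have ll A : low n (low n A) == low n A by rewrite /low -N.land_assoc N.land_diag.
elim: l => [//|[[A [i s]] c] l IH] /=; case: (group n l) IH => [|[B r] g] /=; first by rewrite ll.
by move=> /andP[lB lg]; case: ifP => _ /=; rewrite ?ll lB lg.
Qed.

Lemma sum_pick (T : Type) (V : nmodType) (g : seq (N * T)) (F : N * T -> V) b :
  uniq [seq b.1 | b <- g] -> List.In b g -> \sum_(c <- g) (if c.1 == b.1 then F c else 0) = F b.
Proof.
elim: g => [//|c g IH] /= /andP[cg ug] [<-|bg]; rewrite big_cons.
  rewrite eqxx (_ : \sum_(c <- g) _ = 0) ?addr0 //.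
  elim: g cg {IH ug} => [|a g IH] /=; first by rewrite big_nil.
  by rewrite in_cons negb_or big_cons (eq_sym c.1) => /andP[/negbTE-> /IH->]; rewrite addr0.
case: eqP => [E|_]; last by rewrite add0r IH.
case/negP: cg; rewrite E; elim: g bg {IH ug} => //= a g IH [->|/IH H]; by rewrite in_cons ?eqxx ?H ?orbT.
Qed.
End Group.

Lemma all_In (T : Type) (P : pred T) (l : seq T) x : all P l -> List.In x l -> P x.
Proof. by elim: l => //= a l IH /andP[Pa /IH H] [<-|]. Qed.
Lemma In_mem (T : eqType) (l : seq T) x : List.In x l <-> x \in l.
Proof.
elim: l => //= a l IH; rewrite in_cons; split=> [[->|/IH->]|/orP[/eqP->|/IH]]; rewrite ?eqxx ?orbT //; by [left|right].
Qed.

Lemma ltb_uniq (l : seq N) : path.sorted N.ltb l -> uniq l.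
Proof.
apply: sorted_uniq => [b a c /N.ltb_lt ab /N.ltb_lt bc|a]; last exact: N.ltb_irrefl.
by apply/N.ltb_lt; apply: N.lt_trans bc.
Qed.

Section Uniqueness.
Variable K : numFieldType.
Hypothesis entire_derive : forall f : K -> K, (forall z : K, derivable f z 1) ->
  forall z : K, derivable (derive1 f) z 1.
Hypothesis derive0_const : forall f : K -> K, (forall z : K, derivable f z 1) ->
  (forall z, derive1 f z = 0) -> forall z, f z = f 0.
Implicit Types (f : sfun K 8) (X : vfield K 8).

Lemma congr_big_In (T : Type) (g : seq T) (F G : T -> K) :
  (forall c, List.In c g -> F c = G c) -> \sum_(c <- g) F c = \sum_(c <- g) G c.
Proof.
elim: g => [|c g IH] H; first by rewrite !big_nil.
by rewrite !big_cons H ?IH //; [move=> a ag; apply: H; right|left].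
Qed.

Lemma sden_coef e n l (S : {set 'I_n}) (z : K) :
  sden e n l S z = \sum_(t <- l) (if setN n t.1.1 == S then zK K t.2 * mfun e t.1.2 z else 0).
Proof.
elim: l => [|t l IH]; first by rewrite /sden lin_nil big_nil ffunE.
rewrite /sden lin_cons -/(sden e n l) !ffunE big_cons -IH eq_sym.
by case: eqP => _; rewrite ?scaler0.
Qed.

Lemma group_zero e n l (sel : pred N) L : L = norm [seq t <- l | sel t.1.1] ->
  (forall A B, low n A = low n B -> sel A = sel B) ->
  all linear_term L -> path.sorted N.ltb [seq b.1 | b <- group n L] ->
  all (fun b => sel b.1) (group n L) -> sden e n l = 0 ->
  forall b, List.In b (group n L) -> forall z : K, lin (symval e z) b.2 = 0.
Proof.
move=> LE sel_low lt sG sel_ok l0 b bg z.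
have selb : sel b.1 := all_In sel_ok bg.
have F : sden e n L (setN n b.1) z = 0.
  rewrite LE sden_norm sden_coef big_filter big_mkcond.
  have := congr1 (fun h : sfun K n => h (setN n b.1) z) l0.
  rewrite sden_coef [(0 : sfun K n) _]ffunE => l0z; rewrite -[RHS]l0z.
  apply: eq_bigr => t _; rewrite low_setN; case: N.eqb_spec => [tb|_]; last by case: ifP.
  by rewrite (sel_low _ _ tb) selb.
move: F; rewrite group_den // sum_ffunE fct_sumE => F.
rewrite -[LHS](@sum_pick _ K^o (group n L) (fun c => lin (symval e z) c.2) b) //; last exact: ltb_uniq.
rewrite -[RHS]F; apply: congr_big_In => c cg; rewrite ffunE.
rewrite eq_sym low_setN.
have lowE a : List.In a (group n L) -> low n a.1 = a.1 by move=> /(all_In (group_low n L))/eqP.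
rewrite !lowE //; case: N.eqb_spec => [->|H]; first by rewrite eqxx.
by case: eqP => // ->.
Qed.

Definition qsym f mu (i : nat) := if i is 0 then f else mu.
Lemma qsym_holo f mu : holomorphic f -> holomorphic mu -> forall i, holomorphic (qsym f mu i).
Proof. by move=> hf hmu [|i]; [exact: hf|exact: hmu]. Qed.

Lemma rows_zero f mu : holomorphic f -> holomorphic mu ->
  lie_derivative (contact_field f) (Qtensor K) = smul (pull mu) (Qtensor K) ->
  forall b, List.In b Qgroups -> forall z, lin (symval (env (qsym f mu)) z) b.2 = 0.
Proof.
move=> hf hmu.
have se := env_smooth entire_derive (qsym_holo hf hmu); set e := env (qsym f mu) in se *.
have f0 : f = sden e 8 (lsym 0) by rewrite lsym_den.
have m0 : mu = sden e 8 (lsym 1) by rewrite lsym_den.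
have L : lie_derivative (contact_field f) (Qtensor K) = sden e 16 (lapp 16 (llie (lcontact (lsym 0))) lQ).
  rewrite {1}f0 (contact_den _ se) /lie_derivative (lie_den se) (Q_den e); exact: (vapp_den se).
have M : smul (pull mu) (Qtensor K) = sden e 16 (lmul 16 (lpull (lsym 1)) lQ).
  rewrite {1}m0 (pull_den e) (Q_den e); exact: (sden_mul e).
rewrite L M => E {L M}.
have {}E : sden e 16 Qlie = 0.
  by rewrite /Qlie sden_cat sden_scale zK_neg zK1 scaleN1r E subrr.
have : elim_ok := elimination_ok; rewrite /elim_ok /Qgroups => /and4P[lt sG sel _].
have sl A B : low 16 A = low 16 B -> selected A = selected B by rewrite /selected => ->.
have QE : Qeqs = norm [seq t <- Qlie | selected t.1.1] by rewrite /Qeqs; reflexivity.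
exact: (group_zero QE sl lt sG sel E).
Qed.

Definition jetval f (s : sym) : K^o := derive1n s.2 (f (setN 8 s.1)) 0.

Lemma qsym_val f mu m (z : K) o : (m < 256)%N ->
  symval (env (qsym f mu)) z (N.of_nat m, o) = derive1n o (f (setN 8 (N.of_nat m))) z.
Proof.
by move=> h; rewrite /symval /env; cbn [fst snd]; have := id_div 0 h; rewrite muln0 add0n => ->.
Qed.

Lemma unit_val (d : sym -> K^o) o m : lin d (unit_row o m) = d (N.of_nat m, o).
Proof. by rewrite /unit_row lin_cons lin_nil addr0 zK1 scale1r. Qed.

Lemma masks_ok : all (fun m => [|| size_of m == 0 , size_of m == 1, size_of m == 2 | 3 <= size_of m]%N
     && ((size_of m == 0%N) ==> (m == 0%N))) (iota 0 256)
  && all (fun r => all (fun t => N.ltb t.1.1 256) r) jets.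
Proof. by vm_compute. Qed.

Lemma spans_zero f mu L : holomorphic f -> spans_ok L ->
  (forall r, List.In r L -> forall z, lin (symval (env (qsym f mu)) z) r = 0) ->
  (forall r, List.In r jets -> lin (jetval f) r = 0) -> f = 0.
Proof.
move=> hf + R J; set e := env (qsym f mu) in R *; rewrite /spans_ok; cbv zeta.
set p := pivots L [::] => /and3P[P1 PA PB].
have pz z q : List.In q p -> lin (symval e z) q = 0.
  by apply: pivots_val q => // r rL; exact: R.
pose F m o z := derive1n o (f (setN 8 (N.of_nat m))) z.
have Fe m o z : (m < 256)%N -> symval e z (N.of_nat m, o) = F m o z by exact: qsym_val.
have unit_zero ps z o m : (m < 256)%N -> (forall q, List.In q ps -> lin (symval e z) q = 0) ->
    inspan ps (unit_row o m) -> F m o z = 0.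
  by move=> h hps ins; rewrite -Fe // -unit_val; apply: inspan_val hps ins.
have maskP P m : m \in masks P -> (m < 256)%N by rewrite mem_filter mem_iota => /andP[].
have /andP[/allP sizes /allP ids] := masks_ok.
have /and3P[r102 u102 /allP u1] : [&& inspan p hess_row, inspan p (unit_row 1 102) & all (inspan p) [seq unit_row 2 m | m <- masks (pred1 1%N)]] := P1.
move: PA; rewrite all_cat => /andP[/allP u3 /allP u2].
move: PB; rewrite !all_cat => /and3P[/allP at0 at012 /allP at1].
have /and3P[at01 at02 _] : [&& inspan (pivots jets p) (unit_row 1 0), inspan (pivots jets p) (unit_row 2 0) & true] := at012.
have jz q : List.In q (pivots jets p) -> lin (symval e 0) q = 0.
  apply: pivots_val q => [q|r rJ]; first exact: pz.
  rewrite -[RHS](J r rJ); apply: congr_big_In => t tr; congr (_ *: _).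
  have /N.ltb_lt t256 := all_In (ids _ ((In_mem _ _).1 rJ)) tr.
  case: t t256 {tr} => [[A o] c]; cbn [fst snd] => t256.
  have h : (N.to_nat A < 256)%N by move: t256; clear; lia.
  by rewrite -(N2Nat.id A); exact: (qsym_val f mu 0 o h).
have F0 m : (m < 256)%N -> F m 0%N 0 = 0.
  by move=> h; apply: (unit_zero _ _ _ _ h jz); apply: at0; apply: map_f; rewrite mem_iota.
have F01 : F 0%N 1%N 0 = 0 by exact: (unit_zero _ _ _ _ _ jz).
have F02 : F 0%N 2%N 0 = 0 by exact: (unit_zero _ _ _ _ _ jz).
have F11 m : m \in masks (pred1 1%N) -> F m 1%N 0 = 0.
  by move=> mm; apply: (unit_zero _ _ _ _ (maskP _ _ mm) jz); apply: at1; exact: map_f.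
have hF m o (z : K) : derivable (F m o) z 1 by apply: (entire_derive1n entire_derive); apply: hf.
have const m o : (forall z, F m o.+1 z = 0) -> F m o 0 = 0 -> forall z, F m o z = 0.
  by move=> d0 v0 z; rewrite -v0; apply: derive0_const => //; exact: hF.
have F1 m : m \in masks (pred1 1%N) -> forall z, F m 1%N z = 0.
  move=> mm; apply: const (F11 _ mm) => z.
  by apply: (unit_zero _ _ _ _ (maskP _ _ mm) (pz z)); apply: u1; exact: map_f.
have F102 z : F 102 0%N z = 0.
  by apply: const (F0 _ _) z => // z; exact: (unit_zero _ _ _ _ _ (pz z)).
have F2 z : F 0%N 2%N z = 0.
  have := inspan_val (pz z) r102; rewrite !lin_cons lin_nil zK1 scale1r; cbn [fst snd].
  have -> : symval e z (0%num, 2%N) = F 0%N 2%N z by exact: (Fe 0%N 2%N z isT).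
  have -> : symval e z (102%num, 0%N) = F 102 0%N z by exact: (Fe 102 0%N z isT).
  by rewrite F102 scaler0 !addr0.
have us0 z r : List.In r [seq unit_row 1 m | m <- masks (pred1 1%N)] -> lin (symval e z) r = 0.
  move=> /In_mem/mapP[m mm ->].
  exact: etrans (unit_val (symval e z) 1 m) (etrans (Fe m 1%N z (maskP _ _ mm)) (F1 m mm z)).
have az z q : List.In q (pivots (unit_row 2 0 :: [seq unit_row 1 m | m <- masks (pred1 1%N)]) p) ->
    lin (symval e z) q = 0.
  move: (us0 z); move: [seq _ | _ <- _] => us usz; apply: pivots_val q; first exact: pz.
  move=> r [<-|]; last exact: usz.
  exact: etrans (unit_val (symval e z) 2 0) (etrans (Fe 0%N 2%N z isT) (F2 z)).
have all0 m : (m < 256)%N -> forall z, F m 0%N z = 0.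
  move=> h; have mi : m \in iota 0 256 by rewrite mem_iota.
  have inmask (P : pred nat) : P (size_of m) -> m \in masks P by rewrite mem_filter mi andbT.
  have /andP[/or4P[]] := sizes m mi.
  - move=> s0 /implyP/(_ s0)/eqP->; exact: (const 0%N 0%N (const 0%N 1%N F2 F01) (F0 0%N isT)).
  - by move=> s1 _; apply: const (F0 _ h); apply: F1; exact: inmask.
  - move=> s2 _; apply: const (F0 _ h) => z.
    by apply: (unit_zero _ _ _ _ h (az z)); apply: u2; apply: map_f; exact: inmask.
  - by move=> s3 _ z; apply: (unit_zero _ _ _ _ h (az z)); apply: u3; apply: map_f; exact: inmask.
apply/ffunP => S; rewrite ffunE; apply/funext => z.
by have [m h <-] := setN_surj S; apply: all0.
Qed.

Lemma contact_unique f : holomorphic f -> preserves_Q (contact_field f) ->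
  (forall r, List.In r jets -> lin (jetval f) r = 0) -> f = 0.
Proof.
move=> hf [mu hmu] /(rows_zero hf hmu) R J.
have : elim_ok := elimination_ok; rewrite /elim_ok => /and4P[_ _ _ sp].
move: R sp; move: Qgroups => g R sp.
apply: (spans_zero (mu := mu) hf sp _ J) => r /List.in_map_iff[b [<- bg]]; exact: R bg.
Qed.
End Uniqueness.

Lemma lin2 (K : numFieldType) (V : lmodType K) (k : K) (a b a' b' : V) :
  (k *: a + a') + (k *: b + b') = k *: (a + b) + (a' + b').
Proof. by rewrite scalerDr; exact: addrACA. Qed.
Lemma lin4 (K : numFieldType) (V : lmodType K) (k : K) (a b c d a' b' c' d' : V) :
  (k *: a + a' + (k *: b + b')) + ((k *: c + c') + (k *: d + d')) =
  k *: ((a + b) + (c + d)) + ((a' + b') + (c' + d')).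
Proof. by rewrite !scalerDr [RHS]addrACA; congr (_ + _); exact: addrACA. Qed.

Section Bilinear.
Variables (K : numFieldType) (n : nat).
Implicit Types (f g : sfun K n) (X Y Z : vfield K n) (k : K).

Lemma scalev2 k X i : (k *: X).2 i = k *: X.2 i. Proof. by rewrite ffunE. Qed.

Lemma vfieldP X Y : X.1 = Y.1 -> (forall i, X.2 i = Y.2 i) -> X = Y.
Proof. by case: X Y => [a b] [c d] /= -> E; congr (_, _); apply/ffunP. Qed.
Lemma vproj2 p X i : (vproj p X).2 i = sproj (~~ p) (X.2 i). Proof. by rewrite ffunE. Qed.
Lemma vapp_comp2 X Y i : (vapp_comp X Y).2 i = vapp X (Y.2 i). Proof. by rewrite ffunE. Qed.

Lemma holomorphic_lin k f g : holomorphic f -> holomorphic g -> holomorphic (k *: f + g).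
Proof. by move=> hf hg; exact: (@holomorphicD K n (k *: f) g (@holomorphicZ K n k f hf) hg). Qed.

Lemma vholomorphic_lin k X Y : vholomorphic X -> vholomorphic Y -> vholomorphic (k *: X + Y).
Proof.
move=> [X1 X2] [Y1 Y2]; split=> [|i]; first exact: (@holomorphic_lin k X.1 Y.1 X1 Y1).
by rewrite addv2 scalev2; exact: (@holomorphic_lin k (X.2 i) (Y.2 i) (X2 i) (Y2 i)).
Qed.

Lemma d_even_lin k f g : holomorphic f -> holomorphic g -> d_even (k *: f + g) = k *: d_even f + d_even g.
Proof. by move=> hf hg; rewrite (d_evenD (@holomorphicZ K n k f hf) hg) (d_evenZ k hf). Qed.

Lemma vapp_linl k X Y f : vapp (k *: X + Y) f = k *: vapp X f + vapp Y f.
Proof.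
rewrite /vapp smulDl smulZl scalerDr addrACA; congr (_ + _).
rewrite scaler_sumr -big_split; apply: eq_bigr => i _.
by rewrite addv2 scalev2 smulDl smulZl.
Qed.

Lemma vapp_linr X k f g : holomorphic f -> holomorphic g ->
  vapp X (k *: f + g) = k *: vapp X f + vapp X g.
Proof.
move=> hf hg.
rewrite /vapp d_even_lin // smulDr smulZr scalerDr addrACA; congr (_ + _).
rewrite scaler_sumr -big_split; apply: eq_bigr => i _.
by rewrite d_oddD d_oddZ smulDr smulZr.
Qed.

Lemma sproj_lin p k f g : sproj p (k *: f + g) = k *: sproj p f + sproj p g.
Proof. by rewrite sprojD sprojZ. Qed.

Lemma vproj_lin p k X Y : vproj p (k *: X + Y) = k *: vproj p X + vproj p Y.
Proof.
apply: vfieldP => [|i]; first exact: sproj_lin.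
by rewrite vproj2 !addv2 !scalev2 !vproj2 sproj_lin.
Qed.

Lemma holomorphic_sproj p f : holomorphic f -> holomorphic (sproj p f).
Proof. by move=> hf S z; rewrite ffunE; case: ifP => _; [exact: hf|exact: derivable_cst]. Qed.

Lemma vholomorphic_vproj p X : vholomorphic X -> vholomorphic (vproj p X).
Proof. move=> [X1 X2]; split=> [|i]; first exact: holomorphic_sproj X1.
by rewrite ffunE; exact: holomorphic_sproj (X2 i). Qed.

Lemma vapp_comp_linl k X Y Z : vapp_comp (k *: X + Y) Z = k *: vapp_comp X Z + vapp_comp Y Z.
Proof.
apply: vfieldP => [|i]; first exact: vapp_linl.
by rewrite vapp_comp2 addv2 scalev2 !vapp_comp2 vapp_linl.
Qed.

Lemma vapp_comp_linr k X Y Z : vholomorphic Y -> vholomorphic Z ->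
  vapp_comp X (k *: Y + Z) = k *: vapp_comp X Y + vapp_comp X Z.
Proof.
move=> [Y1 Y2] [Z1 Z2]; apply: vfieldP => [|i]; first exact: vapp_linr.
rewrite vapp_comp2 !addv2 !scalev2 !vapp_comp2; exact: vapp_linr (Y2 i) (Z2 i).
Qed.

Lemma vbracket_linl k X Y Z : vholomorphic X -> vholomorphic Y ->
  vbracket (k *: X + Y) Z = k *: vbracket X Z + vbracket Y Z.
Proof.
move=> hX hY; rewrite !vbracketE; cbv beta zeta.
have B p q : vapp_comp (vproj p (k *: X + Y)) (vproj q Z)
    - ((-1) ^+ (p && q) : K) *: vapp_comp (vproj q Z) (vproj p (k *: X + Y)) =
   k *: (vapp_comp (vproj p X) (vproj q Z)
    - ((-1) ^+ (p && q) : K) *: vapp_comp (vproj q Z) (vproj p X)) +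
   (vapp_comp (vproj p Y) (vproj q Z)
    - ((-1) ^+ (p && q) : K) *: vapp_comp (vproj q Z) (vproj p Y)).
  rewrite vproj_lin vapp_comp_linl vapp_comp_linr; [|exact: vholomorphic_vproj|exact: vholomorphic_vproj].
  move: (vapp_comp _ _) (vapp_comp _ _) (vapp_comp _ _) (vapp_comp _ _) ((-1) ^+ _ : K) => A B C D s.
  by rewrite scalerBr scalerDr !scalerA (mulrC s) opprD addrACA.
rewrite (B true true) (B true false) (B false true) (B false false).
exact: lin4.
Qed.

Lemma vbracket_linr k X Y Z : vholomorphic X -> vholomorphic Y ->
  vbracket Z (k *: X + Y) = k *: vbracket Z X + vbracket Z Y.
Proof.
move=> hX hY; rewrite !vbracketE; cbv beta zeta.
have B p q : vapp_comp (vproj p Z) (vproj q (k *: X + Y))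
    - ((-1) ^+ (p && q) : K) *: vapp_comp (vproj q (k *: X + Y)) (vproj p Z) =
   k *: (vapp_comp (vproj p Z) (vproj q X)
    - ((-1) ^+ (p && q) : K) *: vapp_comp (vproj q X) (vproj p Z)) +
   (vapp_comp (vproj p Z) (vproj q Y)
    - ((-1) ^+ (p && q) : K) *: vapp_comp (vproj q Y) (vproj p Z)).
  rewrite vproj_lin vapp_comp_linl vapp_comp_linr; [|exact: vholomorphic_vproj|exact: vholomorphic_vproj].
  move: (vapp_comp _ _) (vapp_comp _ _) (vapp_comp _ _) (vapp_comp _ _) ((-1) ^+ _ : K) => A B C D s.
  by rewrite scalerBr scalerDr !scalerA (mulrC s) opprD addrACA.
rewrite (B true true) (B true false) (B false true) (B false false).
exact: lin4.
Qed.
End Bilinear.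

Section ContactAlgebra.
Variable K : numFieldType.
Implicit Types (f g : sfun K 8) (X Y : vfield K 8) (k : K).

Lemma sigma_lin k X Y : sigma (k *: X + Y) = k *: sigma X + sigma Y.
Proof.
rewrite /sigma scalerBr addrACA -opprD; congr (_ - _).
rewrite scaler_sumr -big_split; apply: eq_bigr => i _.
by rewrite addv2 scalev2 smulDl smulZl.
Qed.

Lemma contact_section_lin k X Y : contact_section X -> contact_section Y -> contact_section (k *: X + Y).
Proof.
move=> [hX sX] [hY sY]; split; first exact: vholomorphic_lin.
by rewrite sigma_lin sX sY scaler0 addr0.
Qed.

Lemma d_contact_lin k f g : holomorphic f -> holomorphic g ->
  d_contact (k *: f + g) = k *: d_contact f + d_contact g.
Proof.
move=> hf hg; rewrite /d_contact scaler_sumr -big_split; apply: eq_bigr => i _.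
have D : d_odd (ix i) (k *: f + g) + smul (sgen K (iu i)) (d_even (k *: f + g)) =
    k *: (d_odd (ix i) f + smul (sgen K (iu i)) (d_even f)) + (d_odd (ix i) g + smul (sgen K (iu i)) (d_even g)).
  by rewrite d_oddD d_oddZ (d_even_lin k hf hg) smulDr smulZr scalerDr addrACA.
have P f' g' h : smul h (pull (k *: f' + g')) = k *: smul h (pull f') + smul h (pull g').
  by rewrite pullD pullZ smulDr smulZr.
rewrite D d_oddD d_oddZ (P _ _ (omega K i)) (P _ _ (theta K i)); exact: lin2.
Qed.

Lemma lie_derivative_lin k X Y T : vholomorphic X -> vholomorphic Y ->
  lie_derivative (k *: X + Y) T = k *: lie_derivative X T + lie_derivative Y T.
Proof.
move=> [X1 X2] [Y1 Y2]; rewrite /lie_derivative -vapp_linl; congr (vapp _ T).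
apply: vfieldP => [|a]; first by rewrite -[LHS]/(pull (k *: X.1 + Y.1)) pullD pullZ.
rewrite addv2 scalev2 ![(lie_field _).2 _]ffunE; case: splitP => b _; rewrite addv2 scalev2.
  by rewrite pullD pullZ.
exact: d_contact_lin (X2 b) (Y2 b).
Qed.

Lemma inf_lin k X Y : inf_MCQ X -> inf_MCQ Y -> inf_MCQ (k *: X + Y).
Proof.
move=> [hX cX [mu hmu qX]] [hY cY [nu hnu qY]]; split; first exact: vholomorphic_lin.
  move=> Z cZ; rewrite (vbracket_linl k Z hX hY).
  exact: contact_section_lin (cX Z cZ) (cY Z cZ).
exists (k *: mu + nu); first exact: holomorphic_lin.
by rewrite (lie_derivative_lin _ _ hX hY) qX qY pullD pullZ smulDl smulZl.
Qed.
End ContactAlgebra.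

Section Jets.
Variable K : numFieldType.
Hypothesis entire_derive : forall f : K -> K, (forall z : K, derivable f z 1) ->
  forall z : K, derivable (derive1 f) z 1.
Hypothesis derive0_const : forall f : K -> K, (forall z : K, derivable f z 1) ->
  (forall z, derive1 f z = 0) -> forall z, f z = f 0.
Implicit Types (f g : sfun K 8) (X Y : vfield K 8) (k : K).

Lemma derive1n_lin k (phi psi : K -> K) o : entire phi -> entire psi ->
  derive1n o (k *: phi + psi) = k *: derive1n o phi + derive1n o psi.
Proof.
move=> hphi hpsi; elim: o => [//|o IH].
rewrite -[LHS]/(derive1 (derive1n o (k *: phi + psi))) IH; apply/funext => z.
have dphi := @entire_derive1n K entire_derive phi o hphi z.
have dpsi := @entire_derive1n K entire_derive psi o hpsi z.
rewrite derive1E deriveD; [|exact: derivableZ|exact: dpsi].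
rewrite deriveZ; last exact: dphi.
by rewrite -!derive1E.
Qed.

Definition jet f (r : row) : K := lin (jetval f) r.

Lemma jet_lin k f g r : holomorphic f -> holomorphic g -> jet (k *: f + g) r = k * jet f r + jet g r.
Proof.
move=> hf hg; rewrite /jet /lin mulr_sumr -big_split; apply: eq_bigr => t _ /=.
have -> : jetval (k *: f + g) t.1 = k * jetval f t.1 + jetval g t.1.
  rewrite /jetval (_ : (k *: f + g) (setN 8 t.1.1) = k *: f (setN 8 t.1.1) + g (setN 8 t.1.1)); last by rewrite !ffunE.
  by rewrite (derive1n_lin _ _ (hf _) (hg _)).
by rewrite /GRing.scale /= mulrDr mulrCA.
Qed.

Lemma holomorphic_sigma X : vholomorphic X -> holomorphic (sigma X).
Proof.
move=> hX; have se := env_smooth entire_derive (vsym_holo hX).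
rewrite -[X in sigma X]vsym_den sigma_den; exact: holomorphic_sden se _ _.
Qed.

Definition coord (i : nat) X : K := jet (sigma X) (nth [::] jets i) / 2.

Lemma coord_lin i k X Y : vholomorphic X -> vholomorphic Y ->
  coord i (k *: X + Y) = k * coord i X + coord i Y.
Proof.
move=> hX hY; rewrite /coord sigma_lin (jet_lin _ _ (holomorphic_sigma hX) (holomorphic_sigma hY)).
by rewrite mulrDl mulrA.
Qed.

Lemma contact_field0 : contact_field 0 = 0 :> vfield K 8.
Proof.
have -> : 0 = sden (@env0 K) 8 [::] by rewrite /sden lin_nil.
rewrite (contact_den _ (@env0_smooth K)); apply: vfieldP => [|i]; first exact: nilbP.
have /allP/(_ i.+1) : all (fun j => nilb (nth [::] (lcontact [::]) j)) (iota 0 9) by vm_compute.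
rewrite mem_iota add0n ltnS ltn_ord vden2 => /(_ isT)/nilbP ->.
by rewrite ffunE.
Qed.

Lemma inf_zero X : inf_MCQ X -> (forall i, (i < size jets)%N -> coord i X = 0) -> X = 0.
Proof.
move=> [hX cX qX] j0; have XE := contact_form entire_derive hX cX.
rewrite XE (contact_unique entire_derive derive0_const (holomorphic_sigma hX)) ?contact_field0 //.
  by rewrite -XE.
move=> r /In_mem/(nthP [::])[i ij <-]; have := j0 i ij.
by rewrite /coord => /eqP; rewrite mulf_eq0 invr_eq0 pnatr_eq0 orbF => /eqP.
Qed.

(* polynomial fields *)
Lemma sfactor0 s : sfactor (@env0 K) s 0 = (nilp s)%:R.
Proof.
case: s => [|t s]; first by rewrite /sfactor big_nil.
by rewrite /sfactor big_cons derive1n0_cst mul0r.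
Qed.

Lemma coef_val l A : low 8 A = A -> sden (@env0 K) 8 l (setN 8 A) 0 = zK K (coef A l).
Proof.
move=> lA; rewrite sden_coef; elim: l => [|[[B [i s]] c] l IH]; first by rewrite big_nil zK0.
rewrite big_cons IH /=; cbn [fst snd]; rewrite low_setN lA; case: N.eqb_spec => [E|]; last by rewrite /= add0r.
rewrite /mfun sfactor0; cbn [fst snd]; case: i => [|i]; last by rewrite /= expr0n mul0r mulr0 add0r.
by rewrite expr0 mul1r /=; case: (nilp s); rewrite /= ?mulr1 ?zKD // mulr0 add0r.
Qed.

Lemma jetval_den l A o : low 8 A = A -> jetval (sden (@env0 K) 8 l) (A, o) = zK K (coef A (iter o leven l)).
Proof.
move=> lA; rewrite -coef_val // /jetval; cbn [fst snd]; congr (_ 0).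
elim: o => [//|o IH]; rewrite iterS -(sden_even (@env0_smooth K)) [RHS]ffunE.
by rewrite -[LHS]/(derive1 (derive1n o (sden (@env0 K) 8 l (setN 8 A)))) IH; apply/funext.
Qed.

Lemma jets_low : all (fun r => all (fun t => N.eqb (low 8 t.1.1) t.1.1) r) jets.
Proof. by vm_compute. Qed.

Lemma jet_den l i : (i < size jets)%N ->
  jet (sden (@env0 K) 8 l) (nth [::] jets i) = zK K (nth Z0 (ljets l) i).
Proof.
move=> ij; rewrite /ljets (nth_map [::]) //.
have /(all_nthP [::])/(_ i ij) := jets_low; move: (nth _ jets i) => r {ij}.
rewrite /jet; elim: r => [|[[A o] c] r IH]; first by rewrite lin_nil.
by move=> /andP[/N.eqb_spec lA /IH E]; rewrite lin_cons E jetval_den //= zKD zKM.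
Qed.
End Jets.
End Denotation.
Import Denotation.

Module Exceptional.
Local Open Scope ring_scope.

Section F4Bilinear.
Variable K : numFieldType.
Implicit Types (a b c : f4_ambient K) (k : K).

Lemma spin_lin k (A B : 'M[K]_7) : spin (k *: A + B) = k *: spin A + spin B.
Proof.
rewrite /spin scalerN -opprD; congr (- _).
rewrite scalerA mulrC -scalerA -scalerDr; congr (_ *: _).
rewrite scaler_sumr -big_split; apply: eq_bigr => p _.
rewrite scaler_sumr -big_split; apply: eq_bigr => q _.
rewrite !mxE scalerDl -scalerA; reflexivity.
Qed.

Lemma trmx_lin m n k (A B : 'M[K]_(m, n)) : (k *: A + B)^T = k *: A^T + B^T.
Proof. by rewrite linearD linearZ. Qed.

Lemma odd_so_linl k (P Q T : 'M[K]_(1 + 7, 2)) : odd_so (k *: P + Q) T = k *: odd_so P T + odd_so Q T.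
Proof.
rewrite /odd_so.
have -> : \matrix_(p < 7, q < 7) \tr ((k *: P + Q)^T *m gamma2 K p q *m T *m (symp K)^T) =
    k *: (\matrix_(p, q) \tr (P^T *m gamma2 K p q *m T *m (symp K)^T)) + \matrix_(p, q) \tr (Q^T *m gamma2 K p q *m T *m (symp K)^T).
  by apply/matrixP => p q; rewrite !mxE trmx_lin !mulmxDl -!scalemxAl mxtraceD mxtraceZ.
by move: (- (2 / 3)) => c; rewrite scalerDr !scalerA (mulrC c).
Qed.
Lemma odd_so_linr k (P Q T : 'M[K]_(1 + 7, 2)) : odd_so T (k *: P + Q) = k *: odd_so T P + odd_so T Q.
Proof.
rewrite /odd_so.
have -> : \matrix_(p < 7, q < 7) \tr (T^T *m gamma2 K p q *m (k *: P + Q) *m (symp K)^T) =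
    k *: (\matrix_(p, q) \tr (T^T *m gamma2 K p q *m P *m (symp K)^T)) + \matrix_(p, q) \tr (T^T *m gamma2 K p q *m Q *m (symp K)^T).
  by apply/matrixP => p q; rewrite !mxE mulmxDr mulmxDl -scalemxAr -scalemxAl mxtraceD mxtraceZ.
by move: (- (2 / 3)) => c; rewrite scalerDr !scalerA (mulrC c).
Qed.
Lemma odd_sp_linl k (P Q T : 'M[K]_(1 + 7, 2)) : odd_sp (k *: P + Q) T = k *: odd_sp P T + odd_sp Q T.
Proof.
rewrite /odd_sp trmx_lin.
have -> : (k *: P^T + Q^T) *m T + T^T *m (k *: P + Q) = k *: (P^T *m T + T^T *m P) + (Q^T *m T + T^T *m Q).
  by rewrite mulmxDl mulmxDr -scalemxAl -scalemxAr addrACA -scalerDr.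
move: (P^T *m T + _) (Q^T *m T + _) => A B. rewrite mulmxDl. by rewrite -scalemxAl.
Qed.
Lemma odd_sp_linr k (P Q T : 'M[K]_(1 + 7, 2)) : odd_sp T (k *: P + Q) = k *: odd_sp T P + odd_sp T Q.
Proof.
have S P' : odd_sp T P' = odd_sp P' T by rewrite /odd_sp addrC.
by rewrite !S odd_sp_linl.
Qed.
Lemma f4_act_linl k (a b : 'M[K]_7 * 'M[K]_2) P : f4_act (k *: a + b) P = k *: f4_act a P + f4_act b P.
Proof.
rewrite /f4_act spin_lin linearD linearZ /= mulmxDl mulmxDr -scalemxAl -scalemxAr.
by rewrite scalerDr addrACA.
Qed.
Lemma f4_act_linr k (a : 'M[K]_7 * 'M[K]_2) P Q : f4_act a (k *: P + Q) = k *: f4_act a P + f4_act a Q.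
Proof.
by rewrite /f4_act !mulmxDl !mulmxDr -!scalemxAl -!scalemxAr scalerDr addrACA.
Qed.

Lemma comm_linl n k (A B C : 'M[K]_n) : (k *: A + B) *m C - C *m (k *: A + B) = k *: (A *m C - C *m A) + (B *m C - C *m B).
Proof. by rewrite mulmxDl mulmxDr -scalemxAl -scalemxAr opprD addrACA scalerBr. Qed.
Lemma comm_linr n k (A B C : 'M[K]_n) : C *m (k *: A + B) - (k *: A + B) *m C = k *: (C *m A - A *m C) + (C *m B - B *m C).
Proof. by rewrite mulmxDl mulmxDr -scalemxAl -scalemxAr opprD addrACA scalerBr. Qed.

Lemma f4_bracket_linl k a b c : f4_bracket (k *: a + b) c = k *: f4_bracket a c + f4_bracket b c.
Proof.
case: a b c => [[A1 A2] A3] [[B1 B2] B3] [[C1 C2] C3]; rewrite /f4_bracket; cbn [fst snd].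
apply/pair_equal_spec; split; first (apply/pair_equal_spec; split).
- by rewrite [X in X + _]comm_linl odd_so_linl addrACA -scalerDr.
- by rewrite [X in X + _]comm_linl odd_sp_linl addrACA -scalerDr.
- rewrite (f4_act_linl k (A1, A2) (B1, B2)) f4_act_linr opprD addrACA -scalerBr. by [].
Qed.
Lemma f4_bracket_linr k a b c : f4_bracket c (k *: a + b) = k *: f4_bracket c a + f4_bracket c b.
Proof.
case: a b c => [[A1 A2] A3] [[B1 B2] B3] [[C1 C2] C3]; rewrite /f4_bracket; cbn [fst snd].
apply/pair_equal_spec; split; first (apply/pair_equal_spec; split).
- by rewrite [X in X + _]comm_linr odd_so_linr addrACA -scalerDr.
- by rewrite [X in X + _]comm_linr odd_sp_linr addrACA -scalerDr.
- rewrite (f4_act_linl k (A1, A2) (B1, B2)) f4_act_linr opprD addrACA -scalerBr. by [].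
Qed.
End F4Bilinear.

Section Units.
Variable K : numFieldType.
Local Notation zK := (zK K).

Lemma zK_bool b : zK (zbool b) = b%:R. Proof. by case: b. Qed.
Lemma zKB a b : zK (Z.sub a b) = zK a - zK b.
Proof. by rewrite -[Z.sub a b]/(Z.add a (Z.opp b)) zKD zKN. Qed.
Lemma zK_sum f n : zK (zsum f n) = \sum_(i < n) zK (f i).
Proof.
rewrite /zsum -(big_mkord predT (fun i => zK (f i))) /index_iota subn0.
by elim: (iota 0 n) => [|i l IH]; rewrite ?big_nil // big_cons /= zKD IH.
Qed.

Lemma lineE (p q r : 'I_7) : fano_line p q r = zline p q r.
Proof. by rewrite /fano_line /zline -!(inj_eq val_inj). Qed.

Lemma octE (p q r : 'I_7) : oct K p q r = zK (zoct p q r).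
Proof. by rewrite /zoct zKB !zK_bool /zfano -!lineE. Qed.

Lemma gammaE (p : 'I_7) (s t : 'I_(1 + 7)) : gamma K p s t = zK (zgamma p s t).
Proof.
rewrite /gamma !mxE.
case: (fintype.splitP s) => s' Es; rewrite !mxE; case: (fintype.splitP t) => t' Et; rewrite !mxE Es Et /=.
- by rewrite !ord1.
- by rewrite ord1 zKN zK_bool.
- by rewrite ord1 zK_bool andbT.
- exact: octE.
Qed.

Lemma gamma2E (p q : 'I_7) (s t : 'I_(1 + 7)) : 2 * gamma2 K p q s t = zK (zgamma2 p q s t).
Proof.
rewrite /gamma2 mxE mulrA mulfV ?pnatr_eq0 // mul1r !mxE -sumrB zK_sum; apply: eq_bigr => u _.
by rewrite zKB !zKM !gammaE.
Qed.

Lemma G2E (p q : 'I_7) (s t : 'I_(1 + 7)) : 2 * gamma2 K p q s t = zK (G2 p q s t).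
Proof. by rewrite gamma2E /G2 !nth_iota_map. Qed.

Definition U (u : unit) : f4_ambient K :=
  match u with
  | (0%N, p, q) => (delta_mx (inord p) (inord q), 0, 0)
  | (1%N, a, b) => (0, delta_mx (inord a) (inord b), 0)
  | (2%N, s, c) => (0, 0, delta_mx (inord s : 'I_(1 + 7)) (inord c))
  | _ => 0
  end.
Definition Uso (p q : 'I_7) : f4_ambient K := (delta_mx p q, 0, 0).
Definition Usp (a b : 'I_2) : f4_ambient K := (0, delta_mx a b, 0).
Definition Uod (s : 'I_(1 + 7)) (c : 'I_2) : f4_ambient K := (0, 0, delta_mx s c).

Lemma Uso_E (p q : 'I_7) : U (0%N, p : nat, q : nat) = Uso p q.
Proof. by rewrite /U !inord_val. Qed.
Lemma Usp_E (a b : 'I_2) : U (1%N, a : nat, b : nat) = Usp a b.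
Proof. by rewrite /U !inord_val. Qed.
Lemma Uod_E (s : 'I_(1 + 7)) (c : 'I_2) : U (2%N, s : nat, c : nat) = Uod s c.
Proof. by rewrite /U !inord_val. Qed.

Variant unit_spec : unit -> Type :=
  | UnitSo (p q : 'I_7) : unit_spec (0%N, p : nat, q : nat)
  | UnitSp (a b : 'I_2) : unit_spec (1%N, a : nat, b : nat)
  | UnitOd (s : 'I_(1 + 7)) (c : 'I_2) : unit_spec (2%N, s : nat, c : nat).
Lemma uwfP u : uwf u -> unit_spec u.
Proof.
case: u => [[[|[|[|k]]] p] q] //= /andP[h1 h2].
- exact: (UnitSo (Ordinal h1) (Ordinal h2)).
- exact: (UnitSp (Ordinal h1) (Ordinal h2)).
- exact: (@UnitOd (Ordinal (h1 : p < 1 + 7)%N) (Ordinal h2)).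
Qed.

Definition uden : uexp -> f4_ambient K := lin U.

Lemma uden_if b c u : uden (uif b c u) = (if b then zK c else 0) *: U u.
Proof. by case: b; rewrite /uden ?lin_cons lin_nil ?addr0 ?scale0r. Qed.

Lemma f4P (a b : f4_ambient K) : a.1.1 = b.1.1 -> a.1.2 = b.1.2 -> a.2 = b.2 -> a = b.
Proof. by case: a b => [[? ?] ?] [[? ?] ?] /= -> -> ->. Qed.

Lemma spin0 : spin (0 : 'M[K]_7) = 0.
Proof. by have := spin_lin (-1) (0 : 'M[K]_7) 0; rewrite scaler0 add0r scaleN1r addNr. Qed.
Lemma odd_so0l (P : 'M[K]_(1 + 7, 2)) : odd_so 0 P = 0.
Proof. by have := odd_so_linl (-1) 0 0 P; rewrite scaler0 add0r scaleN1r addNr. Qed.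
Lemma odd_so0r (P : 'M[K]_(1 + 7, 2)) : odd_so P 0 = 0.
Proof. by have := odd_so_linr (-1) 0 0 P; rewrite scaler0 add0r scaleN1r addNr. Qed.
Lemma odd_sp0l (P : 'M[K]_(1 + 7, 2)) : odd_sp 0 P = 0.
Proof. by have := odd_sp_linl (-1) 0 0 P; rewrite scaler0 add0r scaleN1r addNr. Qed.
Lemma odd_sp0r (P : 'M[K]_(1 + 7, 2)) : odd_sp P 0 = 0.
Proof. by have := odd_sp_linr (-1) 0 0 P; rewrite scaler0 add0r scaleN1r addNr. Qed.

Lemma f4_bracket_anti (a b : f4_ambient K) : a.2 = 0 -> f4_bracket a b = - f4_bracket b a.
Proof.
move=> a0; apply: f4P; rewrite /f4_bracket; cbn [fst snd].
- rewrite a0 odd_so0l odd_so0r !addr0; exact: esym (opprB _ _).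
- rewrite a0 odd_sp0l odd_sp0r !addr0; exact: esym (opprB _ _).
- exact: esym (opprB _ _).
Qed.

Lemma spin_delta p q : spin (delta_mx p q : 'M[K]_7) = - (4^-1 *: gamma2 K p q).
Proof.
rewrite /spin; congr (- (_ *: _)).
rewrite (bigD1 p) //= (bigD1 q) //= mxE !eqxx scale1r !big1 ?addr0 // => [i ip|j jq].
  by rewrite big1 // => j _; rewrite mxE (negbTE ip) scale0r.
by rewrite mxE (negbTE jq) andbF scale0r.
Qed.

Lemma deltaM m n k (i : 'I_m) (j : 'I_n) (r : 'I_n) (s : 'I_k) :
  delta_mx i j *m delta_mx r s = (j == r)%:R *: delta_mx i s :> 'M[K]_(m, k).
Proof. by rewrite mul_delta_mx_cond; case: eqP; rewrite ?scale1r ?scale0r. Qed.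

Lemma mul_delta m n k (M : 'M[K]_(m, n)) (j : 'I_n) (s : 'I_k) :
  M *m delta_mx j s = \sum_i M i j *: delta_mx i s.
Proof.
rewrite {1}[M]matrix_sum_delta mulmx_suml; apply: eq_bigr => i _; rewrite mulmx_suml.
rewrite (bigD1 j) //= -scalemxAl deltaM eqxx scale1r big1 ?addr0 // => t tj.
by rewrite -scalemxAl deltaM (negbTE tj) scale0r scaler0.
Qed.

Lemma br_so_so p q r s : f4_bracket (Uso p q) (Uso r s) = (q == r)%:R *: Uso p s - (s == p)%:R *: Uso r q.
Proof.
apply: f4P; rewrite /f4_bracket /f4_act; cbn [fst snd Uso].
- by rewrite odd_so0l addr0 !deltaM.
- by rewrite odd_sp0l addr0 mulmx0 subrr -[RHS]/(_ *: 0 - _ *: 0) !scaler0 subrr.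
- by rewrite !mulmx0 !mul0mx !addr0 subrr -[RHS]/(_ *: 0 - _ *: 0) !scaler0 subrr.
Qed.
Lemma br_sp_sp a b c d : f4_bracket (Usp a b) (Usp c d) = (b == c)%:R *: Usp a d - (d == a)%:R *: Usp c b.
Proof.
apply: f4P; rewrite /f4_bracket /f4_act; cbn [fst snd Usp].
- by rewrite odd_so0l addr0 mulmx0 subrr -[RHS]/(_ *: 0 - _ *: 0) !scaler0 subrr.
- by rewrite odd_sp0l addr0 !deltaM.
- by rewrite !mulmx0 !mul0mx !addr0 subrr -[RHS]/(_ *: 0 - _ *: 0) !scaler0 subrr.
Qed.
Lemma br_so_sp p q a b : f4_bracket (Uso p q) (Usp a b) = 0.
Proof.
apply: f4P; rewrite /f4_bracket /f4_act; cbn [fst snd Uso Usp].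
- by rewrite odd_so0l addr0 mulmx0 mul0mx subrr.
- by rewrite odd_sp0l addr0 mulmx0 mul0mx subrr.
- by rewrite !mulmx0 !mul0mx !addr0 subrr.
Qed.
Lemma br_so_od p q s c : f4_bracket (Uso p q) (Uod s c) = (0, 0, \sum_t (- (4^-1 * gamma2 K p q t s)) *: delta_mx t c).
Proof.
apply: f4P; rewrite /f4_bracket /f4_act; cbn [fst snd Uso Uod].
- by rewrite odd_so0l addr0 mulmx0 mul0mx subrr.
- by rewrite odd_sp0l addr0 mulmx0 subrr.
- rewrite spin0 mul0mx trmx0 !mulmx0 !addr0 subr0 spin_delta mul_delta; apply: eq_bigr => t _.
  by rewrite !mxE.
Qed.
Lemma br_sp_od a b s c : f4_bracket (Usp a b) (Uod s c) = (c == b)%:R *: Uod s a.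
Proof.
apply: f4P; rewrite /f4_bracket /f4_act; cbn [fst snd Usp Uod].
- by rewrite odd_so0l addr0 mulmx0 subrr -[RHS]/(_ *: 0) scaler0.
- by rewrite odd_sp0l addr0 mulmx0 mul0mx subrr -[RHS]/(_ *: 0) scaler0.
- by rewrite spin0 !mul0mx !add0r subr0 trmx_delta deltaM.
Qed.

Lemma trace_delta m n (M : 'M[K]_(m, n)) i j : \tr (delta_mx i j *m M) = M j i.
Proof.
rewrite mxtrace_mulC mul_delta linear_sum /= (bigD1 j) //= mxtraceZ big1 ?addr0 => [|t tj].
  rewrite /mxtrace (bigD1 j) //= mxE !eqxx big1 ?addr0 ?mulr1 // => k /negbTE kj.
  by rewrite mxE kj.
rewrite mxtraceZ /mxtrace big1 ?mulr0 // => k _; rewrite mxE.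
by case: eqP => // ->; rewrite (negbTE tj).
Qed.

Lemma mul_deltaE m n k (M : 'M[K]_(m, n)) (j : 'I_n) (s : 'I_k) a b :
  (M *m delta_mx j s) a b = M a j * (b == s)%:R.
Proof.
rewrite mul_delta summxE (bigD1 a) //= big1 => [|i /negbTE ia]; first by rewrite !mxE eqxx addr0.
by rewrite !mxE eq_sym ia mulr0.
Qed.
Lemma delta_mulE m n k l (M : 'M[K]_(m, n)) (N : 'M[K]_(k, l)) t d a b :
  (M *m delta_mx t d *m N) a b = M a t * N d b.
Proof.
rewrite mxE (bigD1 d) //= mul_deltaE eqxx mulr1 big1 ?addr0 // => i /negbTE id.
by rewrite mul_deltaE id mulr0 mul0r.
Qed.

Lemma odd_so_delta s t c d : @odd_so K (delta_mx s c) (delta_mx t d) =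
  - (2 / 3) *: \matrix_(p, q) (gamma2 K p q s t * symp K c d).
Proof.
rewrite /odd_so; congr (_ *: _); apply/matrixP => p q; rewrite [LHS]mxE [RHS]mxE.
by rewrite trmx_delta -!mulmxA trace_delta mulmxA delta_mulE [(symp K)^T _ _]mxE.
Qed.
Lemma odd_sp_delta s t c d : @odd_sp K (delta_mx s c) (delta_mx t d) =
  (s == t)%:R *: ((d == 0)%:R *: delta_mx c 1 - (d == 1)%:R *: delta_mx c 0
    + ((c == 0)%:R *: delta_mx d 1 - (c == 1)%:R *: delta_mx d 0)).
Proof.
rewrite /odd_sp !trmx_delta !deltaM (eq_sym t s) -scalerDr -scalemxAl; congr (_ *: _).
by rewrite mulmxDl /symp !mulmxBr !deltaM.
Qed.
Lemma sympE (c d : 'I_2) : symp K c d = zK (zsymp c d).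
Proof. by rewrite !mxE zKB !zK_bool -!val_eqE. Qed.
Lemma br_od_od s c t d : f4_bracket (Uod s c) (Uod t d) =
  (odd_so (delta_mx s c) (delta_mx t d), odd_sp (delta_mx s c) (delta_mx t d), 0).
Proof.
apply: f4P; rewrite /f4_bracket /f4_act; cbn [fst snd Uod].
- by rewrite mulmx0 subrr add0r.
- by rewrite mulmx0 subrr add0r.
- by rewrite spin0 trmx0 !mul0mx !mulmx0 addr0 subrr.
Qed.

(* lists *)
Lemma uden_flatten (L : seq uexp) : uden (flatten L) = \sum_(l <- L) uden l.
Proof. exact: lin_flatten. Qed.
Lemma uden_map n (f : nat -> uexp) : uden (flatten [seq f i | i <- iota 0 n]) = \sum_(i < n) uden (f i).
Proof. by rewrite uden_flatten big_map -(big_mkord predT (fun i => uden (f i))) /index_iota subn0. Qed.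
Lemma uden_nz x y u : uden (if Z.eqb x 0 then [::] else [:: (u, Z.mul y x)]) = (zK y * zK x) *: U u.
Proof.
by case: Z.eqb_spec => [->|_]; rewrite /uden ?lin_cons lin_nil ?zK0 ?mulr0 ?scale0r ?addr0 // zKM.
Qed.
Definition iod (P : 'M[K]_(1 + 7, 2)) : f4_ambient K := (0, 0, P).
Definition iso (A : 'M[K]_7) : f4_ambient K := (A, 0, 0).
Lemma sum_iod n (k : 'I_n -> K) (F : 'I_n -> 'M[K]_(1 + 7, 2)) : \sum_i k i *: iod (F i) = iod (\sum_i k i *: F i).
Proof.
apply: (big_rec2 (fun x y => x = iod y)) => [//|i x y _ ->].
by apply: f4P; rewrite /= ?scaler0 ?addr0.
Qed.
Lemma sum_iso n (F : 'I_n -> 'M[K]_7) : \sum_i iso (F i) = iso (\sum_i F i).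
Proof.
apply: (big_rec2 (fun x y => x = iso y)) => [//|i x y _ ->].
by apply: f4P; rewrite /= ?scaler0 ?addr0.
Qed.

Lemma uspin_den (p q : 'I_7) (s : 'I_(1 + 7)) (c : 'I_2) :
  uden (uspin G2 p q s c) = 24 *: f4_bracket (Uso p q) (Uod s c).
Proof.
rewrite /uspin (uden_map 8) br_so_od.
transitivity (\sum_(t < 1 + 7) (24 * - (4^-1 * gamma2 K p q t s)) *: iod (delta_mx t c)).
  apply: eq_bigr => t _; rewrite uden_nz -G2E Uod_E; congr (_ *: _).
  by rewrite zK_neg -[zK 3]/(3 : K); field.
rewrite sum_iod; apply: f4P; rewrite -?[RHS]/(24 *: 0) ?scaler0 //.
by rewrite [RHS]scaler_sumr; apply: eq_bigr => t _; rewrite scalerA.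
Qed.

Lemma zK3 : zK 3 = 3. Proof. exact: (zK_nat K 3). Qed.
Lemma zK24 : zK 24 = 24. Proof. exact: (zK_nat K 24). Qed.
Lemma zK8 : zK 8 = 8. Proof. exact: (zK_nat K 8). Qed.

Definition isp (B : 'M[K]_2) : f4_ambient K := (0, B, 0).
Lemma isoZ k A : k *: iso A = iso (k *: A).
Proof. by apply: f4P; rewrite /= ?scaler0. Qed.
Lemma ispZ k A : k *: isp A = isp (k *: A).
Proof. by apply: f4P; rewrite /= ?scaler0. Qed.
Lemma ispD A B : isp A + isp B = isp (A + B).
Proof. by apply: f4P; rewrite /= ?addr0. Qed.

Lemma uodd_so_den (s t : 'I_(1 + 7)) (c d : 'I_2) :
  uden (if Z.eqb (zsymp c d) 0 then [::] else
     flatten [seq flatten [seq (let x := G2 p q s t in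
        if Z.eqb x 0 then [::] else [:: ((0, p, q), Z.mul (Z.mul (-8) (zsymp c d)) x)]) | q <- iota 0 7] | p <- iota 0 7])%N
   = iso (24 *: odd_so (delta_mx s c) (delta_mx t d)).
Proof.
have -> : 24 *: odd_so (delta_mx s c) (delta_mx t d) =
    \sum_(p < 7) \sum_(q < 7) (-16 * gamma2 K p q s t * symp K c d) *: delta_mx p q.
  rewrite odd_so_delta scalerA (matrix_sum_delta (\matrix_(p, q) _)) scaler_sumr; apply: eq_bigr => p _.
  rewrite scaler_sumr; apply: eq_bigr => q _; rewrite scalerA mxE; congr (_ *: _).
  by field.
transitivity (\sum_(p < 7) \sum_(q < 7) iso ((-16 * gamma2 K p q s t * symp K c d) *: delta_mx p q)); last first.
  by rewrite -sum_iso; apply: eq_bigr => p _; rewrite sum_iso.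
case: Z.eqb_spec => [E|_].
  rewrite /uden lin_nil big1 // => p _; rewrite big1 // => q _.
  by rewrite sympE E zK0 mulr0 scale0r.
rewrite uden_map; apply: eq_bigr => p _; rewrite uden_map; apply: eq_bigr => q _.
rewrite uden_nz -G2E Uso_E zKM -sympE zK_neg zK8 -isoZ; congr (_ *: _).
by ring.
Qed.

Lemma uodd_den (s t : 'I_(1 + 7)) (c d : 'I_2) :
  uden (uodd G2 s c t d) = 24 *: f4_bracket (Uod s c) (Uod t d).
Proof.
rewrite br_od_od /uodd [LHS]lin_cat -!/(uden _) uodd_so_den.
have -> : uden (if s == t :> nat then uif (d == 0%N :> nat) 24 (1%N, c : nat, 1%N) ++ uif (d == 1%N :> nat) (-24) (1%N, c : nat, 0%N)
        ++ uif (c == 0%N :> nat) 24 (1%N, d : nat, 1%N) ++ uif (c == 1%N :> nat) (-24) (1%N, d : nat, 0%N) else [::]) =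
   isp (24 *: odd_sp (delta_mx s c) (delta_mx t d)).
  rewrite odd_sp_delta -[(s == t :> nat)]/(s == t); case: eqP => _; last first.
    by rewrite scale0r scaler0 /uden lin_nil.
  have E0 (a : 'I_2) : U (1%N, a : nat, 0%N) = isp (delta_mx a 0) by exact: (Usp_E a 0).
  have E1 (a : 'I_2) : U (1%N, a : nat, 1%N) = isp (delta_mx a 1) by exact: (Usp_E a 1).
  rewrite scale1r /uden !lin_cat -!/(uden _) !uden_if !E0 !E1 zK_neg zK24 !ispZ !ispD; congr isp.
  rewrite -[(d == 0%N :> nat)]/(d == 0) -[(d == 1%N :> nat)]/(d == 1) -[(c == 0%N :> nat)]/(c == 0) -[(c == 1%N :> nat)]/(c == 1).
  rewrite !scalerDr !scalerN !scalerA -!scaleNr !addrA.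
  by congr (_ *: _ + _ *: _ + _ *: _ + _ *: _); case: (_ == _); rewrite ?mulr1 ?mulr0 ?oppr0.
by apply: f4P; rewrite /= ?add0r ?addr0 ?scaler0.
Qed.

Lemma ubr_den u v : uwf u -> uwf v -> uden (ubr G2 u v) = 24 *: f4_bracket (U u) (U v).
Proof.
have nil0 : uden [::] = 0 by rewrite /uden lin_nil.
have anti (a b : f4_ambient K) : a.2 = 0 -> 24 *: f4_bracket b a = - (24 *: f4_bracket a b).
  by move=> a0; rewrite (f4_bracket_anti _ a0) scalerN opprK.
have z24 : zK (-24) = -24 by rewrite zK_neg zK24.
have b24 (b : bool) (k : K) : (if b then k else 0) = k * b%:R by case: b; rewrite ?mulr1 ?mulr0.
move=> /uwfP[p q|a b|s c] /uwfP[r t|d e|r d]; rewrite ?Uso_E ?Usp_E ?Uod_E.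
- rewrite br_so_so [ubr _ _ _]/=  [LHS]lin_cat -!/(uden _) !uden_if !Uso_E z24 zK24 !b24 scalerBr !scalerA mulNr scaleNr.
  by rewrite -!val_eqE.
- by rewrite br_so_sp scaler0.
- exact: uspin_den.
- by rewrite anti // br_so_sp scaler0 oppr0.
- rewrite br_sp_sp [ubr _ _ _]/=  [LHS]lin_cat -!/(uden _) !uden_if !Usp_E z24 zK24 !b24 scalerBr !scalerA mulNr scaleNr.
  by rewrite -!val_eqE.
- by rewrite br_sp_od [LHS]uden_if Uod_E zK24 b24 scalerA.
- by rewrite anti // -uspin_den [LHS]lin_scale zK_neg zK1 scaleN1r.
- by rewrite anti // br_sp_od [LHS]uden_if Uod_E z24 b24 scalerA mulNr scaleNr.
- exact: uodd_den.
Qed.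
End Units.

Section GaussChecks.
Lemma dual_checked : dual_ok. Proof. vm_cast_no_check (erefl true). Qed.
Lemma gelem_checked : gelem_ok. Proof. vm_cast_no_check (erefl true). Qed.
Lemma span_checked : span_ok. Proof. vm_cast_no_check (erefl true). Qed.
Lemma parity_checked : parity_ok. Proof. vm_cast_no_check (erefl true). Qed.
End GaussChecks.

Section Gauss.
Variables (K : numFieldType) (ii : K).
Hypothesis ii2 : ii * ii = -1.
Local Notation zK := (zK K).
Local Notation U := (U K).

Definition gkey (k : unit * bool) : f4_ambient K := ii ^+ k.2 *: U k.1.
Definition gden : gexp -> f4_ambient K := lin gkey.
Definition bval : lc bool -> K^o := lin (fun b : bool => ii ^+ b : K^o).

Lemma ii_mul (a b : bool) : ii ^+ a * ii ^+ b = (-1) ^+ (a && b) * ii ^+ (a (+) b).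
Proof. by case: a; case: b; rewrite ?mul1r ?mulr1 ?ii2 ?expr0 ?mulr1. Qed.
Lemma ii_conj (a b : bool) : (- ii) ^+ a * ii ^+ b = (-1) ^+ (a && ~~ b) * ii ^+ (a (+) b).
Proof. by case: a; case: b; rewrite /= ?expr1 ?expr0 ?mulNr ?ii2 ?opprK ?mul1r ?mulr1. Qed.

Lemma gnilbP l : gnilb l -> gden l = 0.
Proof.
rewrite /gnilb => E; have : gden (combine (sort uleb l)) = 0 by case: combine E => // _; exact: lin_nil.
by rewrite /gden lin_combine => <-; apply/esym/perm_big; rewrite perm_sort.
Qed.

Lemma f4_bracket_sum I J (r : seq I) (s : seq J) (a : I -> K) (F : I -> f4_ambient K) (b : J -> K) (G : J -> f4_ambient K) :
  f4_bracket (\sum_(i <- r) a i *: F i) (\sum_(j <- s) b j *: G j) =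
  \sum_(i <- r) \sum_(j <- s) (a i * b j) *: f4_bracket (F i) (G j).
Proof.
have z0 (x : f4_ambient K) : f4_bracket 0 x = 0.
  by have := f4_bracket_linl (-1) 0 0 x; rewrite scaler0 add0r scaleN1r addNr.
have z1 (x : f4_ambient K) : f4_bracket x 0 = 0.
  by have := f4_bracket_linr (-1) 0 0 x; rewrite scaler0 add0r scaleN1r addNr.
elim: r => [|i r IH]; first by rewrite !big_nil z0.
rewrite !big_cons f4_bracket_linl IH; congr (_ + _).
elim: s {IH} => [|j s IH]; first by rewrite !big_nil z1 scaler0.
by rewrite !big_cons f4_bracket_linr scalerDr IH scalerA.
Qed.

Lemma gbr_den l m : all (fun t => uwf t.1.1) l -> all (fun t => uwf t.1.1) m ->
  gden (gbr G2 l m) = 24 *: f4_bracket (gden l) (gden m).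
Proof.
move=> wl wm; rewrite /gden /lin -/(lin _ _) f4_bracket_sum scaler_sumr /gbr [LHS]lin_flatten big_map.
rewrite big_seq [RHS]big_seq; apply: eq_bigr => x /(allP wl) wx.
rewrite lin_flatten big_map scaler_sumr big_seq [RHS]big_seq; apply: eq_bigr => y /(allP wm) wy.
have -> : f4_bracket (gkey x.1) (gkey y.1) = (ii ^+ x.1.2 * ii ^+ y.1.2) *: f4_bracket (U x.1.1) (U y.1.1).
  by have := f4_bracket_sum [:: x] [:: y] (fun x => ii ^+ x.1.2) (fun x => U x.1.1) (fun x => ii ^+ x.1.2) (fun x => U x.1.1); rewrite !big_seq1.
have E c d (B : f4_ambient K) : 24 *: (c *: (d *: B)) = (c * d) *: (24 *: B).
  by rewrite !scalerA -mulrA mulrC.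
rewrite E -ubr_den // /uden /lin scaler_sumr big_map; apply: eq_bigr => w _ /=.
rewrite /gkey /= !scalerA; congr (_ *: _); rewrite !zKM zK_sign ii_mul; ring.
Qed.

(* coordinates *)
Definition ent (a : f4_ambient K) (u : unit) : K :=
  match u with
  | (0%N, p, q) => a.1.1 (inord p) (inord q)
  | (1%N, b, c) => a.1.2 (inord b) (inord c)
  | (2%N, s, c) => a.2 (inord s : 'I_(1 + 7)) (inord c)
  | _ => 0
  end.
Lemma ent_lin k a b u : ent (k *: a + b) u = k * ent a u + ent b u.
Proof. by case: u => [[[|[|[|n]]] p] q]; rewrite /= ?mxE // mulr0 addr0. Qed.
Lemma ent0 u : ent 0 u = 0.
Proof. by case: u => [[[|[|[|n]]] p] q]; rewrite /= ?mxE. Qed.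
Lemma ent_sum I (r : seq I) (F : I -> f4_ambient K) (c : I -> K) u : ent (\sum_(i <- r) c i *: F i) u = \sum_(i <- r) c i * ent (F i) u.
Proof.
elim: r => [|i r IH]; first by rewrite !big_nil ent0.
by rewrite !big_cons ent_lin IH.
Qed.
Lemma ent_U u v : uwf u -> uwf v -> ent (U v) u = (u == v)%:R.
Proof.
by move=> /uwfP[p q|a b|s c] /uwfP[r t|d e|r d]; rewrite /= !inord_val ?mxE -?val_eqE // !xpair_eqE.
Qed.

Lemma gent_den l u : uwf u -> all (fun t => uwf t.1.1) l -> ent (gden l) u = bval (gent l u).
Proof.
move=> wu wl; rewrite /gden /lin ent_sum /bval /gent /lin big_map big_filter [RHS]big_mkcond big_seq [RHS]big_seq.
apply: eq_bigr => t /(allP wl) wt; rewrite /gkey -[ii ^+ _ *: _]addr0 ent_lin ent0 addr0 ent_U // eq_sym.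
by case: eqP; rewrite ?mulr1 ?mulr0.
Qed.

Lemma bval_gval l : bval l = zK (gval l false) + ii * zK (gval l true).
Proof.
elim: l => [|[b c] l IH]; first by rewrite /bval lin_nil zK0 mulr0 addr0.
rewrite /bval lin_cons -/(bval l) IH /=; case: b; rewrite /= ?zKD /GRing.scale /= ?expr0 ?expr1; ring.
Qed.
Lemma gisP l z : gis l z -> bval l = zK z.
Proof. by move=> /andP[/Z.eqb_spec h1 /Z.eqb_spec h2]; rewrite bval_gval h1 h2 zK0 mulr0 addr0. Qed.

Definition gdual (l : gexp) (a : f4_ambient K) : K := \sum_(t <- l) zK t.2 * ((- ii) ^+ t.1.2 * ent a t.1.1).
Lemma gdual_lin l k a b : gdual l (k *: a + b) = k * gdual l a + gdual l b.
Proof.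
rewrite /gdual mulr_sumr -big_split; apply: eq_bigr => t _ /=.
by rewrite ent_lin; ring.
Qed.
Lemma gdual0 l : gdual l 0 = 0.
Proof. by rewrite /gdual big1 // => t _; rewrite ent0 !mulr0. Qed.
Lemma gdual_sum l I (r : seq I) (F : I -> f4_ambient K) (c : I -> K) : gdual l (\sum_(i <- r) c i *: F i) = \sum_(i <- r) c i * gdual l (F i).
Proof.
elim: r => [|i r IH]; first by rewrite !big_nil gdual0.
by rewrite !big_cons gdual_lin IH.
Qed.

Lemma gpairing_den l m : all (fun t => uwf t.1.1) l -> all (fun t => uwf t.1.1) m ->
  gdual l (gden m) = bval (gpairing l m).
Proof.
move=> wl wm; rewrite /gpairing /bval lin_flatten big_map /gdual.
rewrite big_seq [RHS]big_seq; apply: eq_bigr => x /(allP wl) wx.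
rewrite /gden /lin ent_sum big_map big_filter [RHS]big_mkcond !mulr_sumr big_seq [RHS]big_seq; apply: eq_bigr => y /(allP wm) wy.
rewrite /gkey -[ii ^+ _ *: _]addr0 ent_lin ent0 addr0 ent_U //.
case: eqP => _; rewrite ?mulr0 // mulr1 [RHS]/(_ * _) /= !zKM zK_sign.
move: (ii_conj x.1.2 y.1.2); move: ((- ii) ^+ _) (ii ^+ y.1.2) ((-1) ^+ _) (ii ^+ (x.1.2 (+) y.1.2)) => p q r t E.
rewrite -[RHS]/(r * (zK x.2 * zK y.2) * t).
by transitivity (zK x.2 * zK y.2 * (p * q)); [|rewrite E]; ring.
Qed.

Definition L (k : nat) : f4_ambient K := gden (nth [::] Ls k).

Lemma Ls_ok k : (k < 40)%N -> [/\ all (fun t => uwf t.1.1) (nth [::] Ls k),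
  member_ok (nth [::] Ls k) & homog_ok (nth [::] Ls k)].
Proof. by move=> k40; have /(all_nthP [::])/(_ k) := gelem_checked; move=> /(_ k40)/and3P[]. Qed.

Lemma sp_trace (B : 'M[K]_2) : B^T *m symp K + symp K *m B = \tr B *: symp K.
Proof.
rewrite /mxtrace !big_ord_recl big_ord0 addr0.
apply/matrixP => i j; rewrite !mxE !big_ord_recl !big_ord0 !mxE !addr0.
have H (k : 'I_2) : (k == 0) || (k == 1) by case: k => [[|[]]].
have e1 : lift ord0 ord0 = 1 :> 'I_2 by exact: val_inj.
rewrite e1 -[ord0]/(0 : 'I_2).
by case/orP: (H i) => /eqP ->; case/orP: (H j) => /eqP -> /=; ring.
Qed.

Lemma f4_setP (a : f4_ambient K) : f4_set a <-> (forall p q, a.1.1 p q + a.1.1 q p = 0) /\ \tr a.1.2 = 0.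
Proof.
rewrite /f4_set /classical_sets.mkset sp_trace; split=> [[A B]|[A B]]; split.
- by move=> p q; have := congr1 (fun M : 'M[K]_7 => M q p) A; rewrite !mxE => ->; rewrite addNr.
- have := congr1 (fun M : 'M[K]_2 => M 0 1) B; rewrite !mxE subr0 mulr1.
  exact.
- by apply/matrixP => p q; rewrite !mxE; apply/eqP; rewrite -addr_eq0 A.
- by rewrite B scale0r.
Qed.

Lemma f4_set_lin k (a b : f4_ambient K) : f4_set a -> f4_set b -> f4_set (k *: a + b).
Proof.
move=> /f4_setP[a1 a2] /f4_setP[b1 b2]; apply/f4_setP; split=> [p q|].
  by rewrite !mxE addrACA -mulrDr a1 b1 mulr0 addr0.
by rewrite mxtraceD mxtraceZ a2 b2 mulr0 addr0.
Qed.

Lemma L_mem k : (k < 40)%N -> f4_set (L k).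
Proof.
move=> /Ls_ok[wf /andP[/allP sk tr0] _]; apply/f4_setP; split=> [p q|].
  have E (r s : 'I_7) : (L k).1.1 r s = bval (gent (nth [::] Ls k) (0%N, r : nat, s : nat)).
    by rewrite -gent_den ?[ent _ _]/= ?inord_val //= !ltn_ord.
  have [iq ip] : (q : nat) \in iota 0 7 /\ (p : nat) \in iota 0 7 by rewrite !mem_iota !ltn_ord.
  by rewrite !E -[_ + _](lin_cat _ _ _); have /allP/(_ _ iq)/gisP := sk _ ip.
have E (b : 'I_2) : (L k).1.2 b b = bval (gent (nth [::] Ls k) (1%N, b : nat, b : nat)).
  by rewrite -gent_den ?[ent _ _]/= ?inord_val //= !ltn_ord.
rewrite /mxtrace !big_ord_recl big_ord0 addr0 !E -[_ + _](lin_cat _ _ _).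
exact: (gisP tr0).
Qed.

Lemma gdual_L k j : (k < 40)%N -> (j < 40)%N ->
  gdual (nth [::] Ls k) (L j) = if k == j then zK (gnorm (nth [::] Ls k)) else 0.
Proof.
move=> k40 j40; have [wk _ _] := Ls_ok k40; have [wj _ _] := Ls_ok j40.
rewrite (gpairing_den wk wj).
have /allP/(_ k) := dual_checked; rewrite mem_iota => /(_ k40)/andP[_ /allP/(_ j)].
by rewrite mem_iota => /(_ j40)/gisP ->; case: eqP.
Qed.
Lemma gnorm_neq0 k : (k < 40)%N -> zK (gnorm (nth [::] Ls k)) != 0.
Proof.
move=> k40; have /allP/(_ k) := dual_checked; rewrite mem_iota => /(_ k40)/andP[/negbTE h _].
exact: zK_neq0.
Qed.

Lemma L_homog k : (k < 40)%N -> @f4_homog K (isodd (nth [::] Ls k)) (L k).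
Proof.
move=> /Ls_ok[_ _]; rewrite /f4_homog /classical_sets.mkset /L /gden /homog_ok.
move: (isodd _) => b; elim: (nth _ _ _) => [|t l IH] /=; first by rewrite lin_nil; case: b.
move=> /andP[/eqP tb /IH]; rewrite lin_cons.
have : if b then (gkey t.1).1 = 0 else (gkey t.1).2 = 0.
  rewrite -tb /gkey; case: t.1 {tb} => [[[[|[|[|n]]] p] q] c]; exact: scaler0.
case: b {tb IH} => E F.
  by rewrite -[LHS]/(zK t.2 *: (gkey t.1).1 + (lin gkey l).1) E F scaler0 addr0.
by rewrite -[LHS]/(zK t.2 *: (gkey t.1).2 + (lin gkey l).2) E F scaler0 addr0.
Qed.

(* table *)
Lemma sum_zip (V : nmodType) (T : Type) (x0 : T) (c : seq Z) (l : seq T) (F : Z -> T -> V) : size c = size l ->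
  \sum_(t <- zip c l) F t.1 t.2 = \sum_(k < size l) F (nth Z0 c k) (nth x0 l k).
Proof.
move=> sz; rewrite (big_nth (Z0, x0)) size_zip sz minnn big_mkord; apply: eq_bigr => k _.
by rewrite nth_zip.
Qed.

Lemma gcomb_den c : size c = 40%N -> gden (gcomb c) = \sum_(k < 40) zK (nth Z0 c k) *: L k.
Proof.
move=> sz; rewrite /gcomb /gden lin_flatten big_map.
rewrite (eq_bigr (fun t => zK t.1 *: gden t.2)); last first.
  by move=> t _; case: Z.eqb_spec => [->|_]; rewrite ?lin_scale // lin_nil zK0 scale0r.
exact: (@sum_zip _ _ [::] c Ls (fun z l => zK z *: gden l)).
Qed.

Lemma gpair_okP c i j : size c = 40%N -> (i < 40)%N -> (j < 40)%N ->
  gpair_ok c (nth [::] Ls i) (nth [::] Ls j) ->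
  f4_bracket (L i) (L j) = 2 *: \sum_(k < 40) zK (nth Z0 c k) *: L k.
Proof.
move=> sz i40 j40 /gnilbP; have [wi _ _] := Ls_ok i40; have [wj _ _] := Ls_ok j40.
rewrite /gden lin_cat lin_scale -!/(gden _) gbr_den // gcomb_den // zK_neg scaleNr => /eqP.
rewrite subr_eq0 -[zK 48](zK_nat K 48) => /eqP E.
have n24 : 24 != 0 :> K by rewrite pnatr_eq0.
apply: (scalerI n24); rewrite E scalerA; congr (_ *: _); ring.
Qed.

(* projection *)
Definition proj (a : f4_ambient K) : f4_ambient K := \sum_(k < 40) (zK (gweight (nth [::] Ls k)) * gdual (nth [::] Ls k) a) *: L k.
Lemma proj_sum I (r : seq I) (F : I -> f4_ambient K) (c : I -> K) : proj (\sum_(i <- r) c i *: F i) = \sum_(i <- r) c i *: proj (F i).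
Proof.
rewrite /proj; under [RHS]eq_bigr => i _ do rewrite scaler_sumr.
rewrite exchange_big; apply: eq_bigr => k _; rewrite gdual_sum mulr_sumr scaler_suml; apply: eq_bigr => i _.
by rewrite scalerA; congr (_ *: _); ring.
Qed.
Lemma units_all u : uwf u -> u \in units 0 7 7 ++ units 1 2 2 ++ units 2 8 2.
Proof.
have unitsE k m n p q : (p < m)%N -> (q < n)%N -> (k, p, q) \in units k m n.
  by move=> hp hq; apply: allpairs_f; rewrite mem_iota.
case/uwfP => p q; rewrite mem_cat; apply/orP; [left|right|right]; first exact: unitsE.
  by rewrite mem_cat; apply/orP; left; exact: unitsE.
by rewrite mem_cat; apply/orP; right; exact: unitsE.
Qed.
Lemma proj_unit u : uwf u -> proj (U u) = gden (guproj u).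
Proof.
move=> wu; have /allP/(_ u (units_all wu))/gnilbP := span_checked.
rewrite /gden lin_cat lin_scale -!/(gden _) zK_neg zK1 scaleN1r => /eqP; rewrite subr_eq0 => /eqP <-.
rewrite /proj /gproj /gden lin_flatten big_map (big_nth [::]) big_mkord.
apply: eq_bigr => k _; have [wk _ _] := Ls_ok (ltn_ord k).
rewrite lin_flatten big_map big_filter [RHS]big_mkcond /gdual mulr_sumr scaler_suml big_seq [RHS]big_seq.
apply: eq_bigr => x /(allP wk) wx; rewrite ent_U //; case: eqP => _; last by rewrite !mulr0 scale0r.
rewrite mulr1 lin_scale -scalerA; congr (_ *: _); rewrite /L /gden /lin scaler_sumr big_map; apply: eq_bigr => w _ /=.
rewrite /gkey /= !scalerA; congr (_ *: _); rewrite !zKM zK_sign.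
move: (ii_conj x.1.2 w.1.2); move: ((- ii) ^+ _) (ii ^+ w.1.2) ((-1) ^+ _) (ii ^+ (x.1.2 (+) w.1.2)) => p q r t E.
by transitivity (zK x.2 * zK w.2 * (p * q)); [|rewrite E]; ring.
Qed.

Lemma proj_lin k a b : proj (k *: a + b) = k *: proj a + proj b.
Proof.
rewrite /proj scaler_sumr -big_split; apply: eq_bigr => i _.
by rewrite gdual_lin mulrDr scalerDl scalerA mulrCA.
Qed.

Lemma zK_pos n : zK (Z.of_nat n) = n%:R. Proof. exact: zK_nat. Qed.
Let z1152 : zK 1152 = 1152. Proof. exact: (zK_nat K 1152). Qed.
Let z2304 : zK 2304 = 2304. Proof. exact: (zK_nat K 2304). Qed.

Lemma gkey0 u : gkey (u, false) = U u. Proof. by rewrite /gkey expr0 scale1r. Qed.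

Lemma proj_so (p q : 'I_7) : proj (Uso K p q) = 1152 *: Uso K p q - 1152 *: Uso K q p.
Proof.
rewrite -!Uso_E proj_unit; last by rewrite /= !ltn_ord.
by rewrite /gden !lin_cons lin_nil addr0 !gkey0 zK_neg z1152 scaleNr.
Qed.
Lemma proj_od (s : 'I_(1 + 7)) (c : 'I_2) : proj (Uod K s c) = 2304 *: Uod K s c.
Proof.
rewrite -!Uod_E proj_unit; last by rewrite /= !ltn_ord.
by rewrite /gden lin_cons lin_nil addr0 gkey0 z2304.
Qed.
Lemma proj_sp (a b : 'I_2) : proj (Usp K a b) =
  if a == b then 1152 *: Usp K a b - 1152 *: Usp K (1 - a) (1 - b) else 2304 *: Usp K a b.
Proof.
rewrite -!Usp_E proj_unit; last by rewrite /= !ltn_ord.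
have H (k : 'I_2) : (k == 0) || (k == 1) by case: k => [[|[]]].
rewrite /gden /guproj; case/orP: (H a) => /eqP ->; case/orP: (H b) => /eqP ->;
  by rewrite /= !lin_cons lin_nil addr0 !gkey0 ?zK_neg ?z1152 ?z2304 ?scaleNr.
Qed.

Lemma proj_sum2 m n (M : 'M[K]_(m, n)) (F : 'I_m -> 'I_n -> f4_ambient K) :
  proj (\sum_i \sum_j M i j *: F i j) = \sum_i \sum_j M i j *: proj (F i j).
Proof. by rewrite !pair_bigA /= proj_sum. Qed.

Lemma iso_sum A : iso A = \sum_p \sum_q A p q *: Uso K p q.
Proof.
rewrite {1}[A]matrix_sum_delta -sum_iso; apply: eq_bigr => p _; rewrite -sum_iso.
by apply: eq_bigr => q _; rewrite -isoZ.
Qed.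
Lemma isp_sum B : isp B = \sum_p \sum_q B p q *: Usp K p q.
Proof.
have isp0 : isp (0 : 'M[K]_2) = 0 by [].
have D (A C : 'M[K]_2) : isp (A + C) = isp A + isp C by rewrite ispD.
rewrite {1}[B]matrix_sum_delta (big_morph (@isp K) D isp0); apply: eq_bigr => p _.
by rewrite (big_morph (@isp K) D isp0); apply: eq_bigr => q _; rewrite -ispZ.
Qed.
Lemma iod_sum P : iod P = \sum_s \sum_c P s c *: Uod K s c.
Proof.
have iod0 : iod (0 : 'M[K]_(1 + 7, 2)) = 0 by [].
have D (A C : 'M[K]_(1 + 7, 2)) : iod (A + C) = iod A + iod C by apply: f4P; rewrite /= ?addr0.
rewrite {1}[P]matrix_sum_delta (big_morph (@iod K) D iod0); apply: eq_bigr => p _.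
rewrite (big_morph (@iod K) D iod0); apply: eq_bigr => q _.
by apply: f4P; rewrite /= ?scaler0.
Qed.

Lemma proj_iso A : proj (iso A) = 1152 *: iso (A - A^T).
Proof.
rewrite {1}iso_sum proj_sum2 iso_sum scaler_sumr.
under eq_bigr => p _ do (under eq_bigr => q _ do rewrite proj_so scalerBr; rewrite sumrB).
rewrite sumrB [X in _ - X]exchange_big -sumrB; apply: eq_bigr => p _.
rewrite -sumrB scaler_sumr; apply: eq_bigr => q _.
by rewrite !mxE !scalerBl !scalerBr !scalerA ![_ * 1152]mulrC.
Qed.

Lemma traceless_combination (V : lmodType K) (c b p q : K) (x y z t : V) :
  b *: (c *: x - c *: y) + p *: ((c + c) *: z) + (q *: ((c + c) *: t) + (- b) *: (c *: y - c *: x)) =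
  (c + c) *: (b *: x + p *: z + (q *: t + (- b) *: y)).
Proof.
have E (k : K) (v : V) : (c + c) *: (k *: v) = k *: (c *: v) + k *: (c *: v).
  by rewrite scalerDl !scalerA mulrC.
have C (k : K) (v : V) : (c + c) *: (k *: v) = k *: ((c + c) *: v) by rewrite !scalerA mulrC.
rewrite !scaleNr [in RHS]scalerDr [in RHS]scalerDr [(c + c) *: (_ - _)]scalerBr E (C p) (C q) E.
rewrite !scalerBr opprB opprD.
move: (b *: (c *: x)) (b *: (c *: y)) (p *: _) (q *: _) => {x y z t E C} x y z t.
by rewrite [LHS](AC ((2*1)*(1*2)) (((1*5)*3)*(4*(2*6)))).
Qed.

Lemma proj_id a : f4_set a -> proj a = 2304 *: a.
Proof.
move=> /f4_setP[sk tr].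
have aE : a = 1 *: iso a.1.1 + (1 *: isp a.1.2 + iod a.2).
  by rewrite !scale1r; apply: f4P; rewrite /= ?add0r ?addr0.
have -> : 2304 *: a = 2304 *: iso a.1.1 + (2304 *: isp a.1.2 + 2304 *: iod a.2).
  by rewrite {1}aE !scale1r !scalerDr.
rewrite {1}aE !proj_lin !scale1r; congr (_ + (_ + _)).
- rewrite proj_iso (_ : _ - _ = 2 *: a.1.1); first by rewrite -isoZ scalerA; congr (_ *: _); ring.
  apply/matrixP => p q; rewrite !mxE mulr_natl mulr2n; congr (_ + _).
  by apply/eqP; rewrite eq_sym -addr_eq0 sk.
- have t1 : a.1.2 1 1 = - a.1.2 0 0.
    apply/eqP; rewrite -addr_eq0 addrC; apply/eqP; rewrite -tr /mxtrace !big_ord_recl big_ord0 addr0.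
    by congr (_ + a.1.2 _ _); exact: val_inj.
  have s2 (V : nmodType) (F : 'I_2 -> V) : \sum_i F i = F 0 + F 1.
    by rewrite !big_ord_recl big_ord0 addr0; congr (_ + F _); exact: val_inj.
  have p00 : proj (Usp K 0 0) = 1152 *: Usp K 0 0 - 1152 *: Usp K 1 1 by exact: proj_sp.
  have p11 : proj (Usp K 1 1) = 1152 *: Usp K 1 1 - 1152 *: Usp K 0 0 by exact: proj_sp.
  have p01 : proj (Usp K 0 1) = 2304 *: Usp K 0 1 by exact: proj_sp.
  have p10 : proj (Usp K 1 0) = 2304 *: Usp K 1 0 by exact: proj_sp.
  have -> : 2304 = 1152 + 1152 :> K by rewrite -natrD.
  rewrite isp_sum proj_sum2 !s2 p00 p11 p01 p10 t1.
  have -> : 2304 = 1152 + 1152 :> K by rewrite -natrD.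
  exact: traceless_combination.
- rewrite iod_sum proj_sum2 scaler_sumr; apply: eq_bigr => s _; rewrite scaler_sumr; apply: eq_bigr => c _.
  by rewrite proj_od !scalerA mulrC.
Qed.
End Gauss.
End Exceptional.
Import Exceptional.

Module Isomorphism.
Import numFieldNormedType.Exports mathcomp.boot.finset.
Local Open Scope ring_scope.

Section MoreChecks.
Lemma table_checked : table_ok. Proof. vm_cast_no_check (erefl true). Qed.
Definition sigma_ok : bool := all (fun z => nilb (lsigma z.2 ++ lscale (-1) z.1)) (zip Fs Vs).
Lemma sigma_checked : sigma_ok. Proof. vm_cast_no_check (erefl true). Qed.
Definition jets_dual_ok : bool :=
  all (fun i => ljets (nth [::] Fs i) == [seq (if j == i then Z.of_nat 2 else Z0) | j <- iota 0 40]) (iota 0 40).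
Lemma jets_dual_checked : jets_dual_ok. Proof. vm_cast_no_check (erefl true). Qed.
Lemma parity_sigma_checked p :
  nilb (lsigma (lvproj 8 p symX) ++ lscale (Zneg xH) (lproj 8 p (lsigma symX))).
Proof. by case: p; vm_cast_no_check (erefl true). Qed.
End MoreChecks.

Section Basis.
Variable K : numFieldType.
Hypothesis entire_derive : forall f : K -> K, (forall z : K, derivable f z 1) ->
  forall z : K, derivable (derive1 f) z 1.
Hypothesis derive0_const : forall f : K -> K, (forall z : K, derivable f z 1) ->
  (forall z, derive1 f z = 0) -> forall z, f z = f 0.
Implicit Types (f g : sfun K 8) (X Y : vfield K 8) (k : K).

Definition basis (i : nat) : vfield K 8 := vden (@env0 K) 8 (nth [::] Vs i).

Lemma basis_inf i : (i < 40)%N -> inf_MCQ (basis i).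
Proof.
move=> i40; split.
- by apply: vholomorphic_vden; exact: env0_smooth.
- by apply: (contact_okP entire_derive); have /(all_nthP [::])/(_ i i40) := contacts_ok.
- apply: (@lie_okP _ (nth [::] Fs i)).
  have /(all_nthP ([::], [::]))/(_ i) := lies_ok; rewrite nth_zip //; exact.
Qed.

Lemma coord_basis i j : (i < 40)%N -> (j < 40)%N -> coord j (basis i) = (j == i)%:R.
Proof.
move=> i40 j40; rewrite /coord /basis sigma_den.
have -> : sden (@env0 K) 8 (lsigma (nth [::] Vs i)) = sden (@env0 K) 8 (nth [::] Fs i).
  have /(all_nthP ([::], [::]))/(_ i) := sigma_checked; rewrite nth_zip // => /(_ i40)/(nilbP (@env0 K) 8).
  by rewrite sden_cat sden_scale zK_neg zK1 scaleN1r => /eqP; rewrite subr_eq0 => /eqP.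
rewrite jet_den //; have /allP/(_ i) := jets_dual_checked; rewrite mem_iota => /(_ i40)/eqP ->.
rewrite nth_iota_map //; case: eqP => _; last by rewrite zK0 mul0r.
by rewrite zK_nat divff ?pnatr_eq0.
Qed.

Lemma inf_0 : inf_MCQ (0 : vfield K 8).
Proof.
have := inf_lin (-1) (@basis_inf 0 isT) (@basis_inf 0 isT).
by rewrite scaleN1r addNr.
Qed.

Lemma inf_sum n (c : 'I_n -> K) (F : 'I_n -> vfield K 8) : (forall i, inf_MCQ (F i)) -> inf_MCQ (\sum_i c i *: F i).
Proof.
move=> hF; apply: big_ind => [|X Y hX hY|i _]; first exact: inf_0.
  by have := inf_lin 1 hX hY; rewrite scale1r.
by have := inf_lin (c i) (hF i) inf_0; rewrite addr0.
Qed.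

Lemma inf_holo X : inf_MCQ X -> vholomorphic X. Proof. by case. Qed.

Lemma coord_sum n (c : 'I_n -> K) (F : 'I_n -> vfield K 8) j : (forall i, inf_MCQ (F i)) ->
  coord j (\sum_i c i *: F i) = \sum_i c i * coord j (F i).
Proof.
move=> hF.
have c0 : coord j (0 : vfield K 8) = 0.
  have := coord_lin entire_derive j (-1) (inf_holo inf_0) (inf_holo inf_0).
  by rewrite scaler0 add0r mulN1r addNr.
suff [] : inf_MCQ (\sum_i c i *: F i) /\ coord j (\sum_i c i *: F i) = \sum_i c i * coord j (F i) by [].
apply: (big_rec2 (fun X x => inf_MCQ X /\ coord j X = x)) => [|i x X _ [hX <-]]; first by split; [exact: inf_0|].
split; first exact: inf_lin.
exact: (coord_lin entire_derive j (c i) (inf_holo (hF i)) (inf_holo hX)).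
Qed.

Lemma inf_expand X : inf_MCQ X -> X = \sum_(i < 40) coord i X *: basis i.
Proof.
move=> hX; set Y := \sum_i _; have hb (i : 'I_40) : inf_MCQ (basis i) by exact: basis_inf.
have hY : inf_MCQ Y by exact: inf_sum.
apply/esym/eqP; rewrite -subr_eq0 -scaleN1r addrC; apply/eqP.
apply: (inf_zero entire_derive derive0_const); first exact: inf_lin.
move=> i i40; rewrite (coord_lin entire_derive _ _ (inf_holo hX) (inf_holo hY)) coord_sum //.
rewrite (bigD1 (Ordinal i40)) //= coord_basis // eqxx mulr1 big1 ?addr0; first by rewrite mulN1r addNr.
by move=> j /eqP ji; rewrite coord_basis //; case: eqP => [E|]; [case: ji; exact: val_inj|rewrite mulr0].
Qed.

Definition struct i j : seq Z := (bracket_ok (nth [::] Vs i) (nth [::] Vs j)).1.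
Lemma struct_size i j : size (struct i j) = 40%N. Proof. by []. Qed.

Lemma lcomb_den c b : size c = 40%N ->
  sden (@env0 K) 8 (lcomb c b) = \sum_(k < 40) zK K (nth Z0 c k) *: sden (@env0 K) 8 (nth [::] (nth [::] Vs k) b).
Proof.
move=> sz; rewrite /lcomb /sden lin_flatten big_map.
rewrite (eq_bigr (fun t => zK K t.1 *: sden (@env0 K) 8 (nth [::] t.2 b))); last first.
  by move=> t _; case: Z.eqb_spec => [->|_]; rewrite ?lin_scale // lin_nil zK0 scale0r.
exact: (@sum_zip _ _ [::] c Vs (fun z V => zK K z *: sden (@env0 K) 8 (nth [::] V b))).
Qed.

Lemma table_okP i j : (i < 40)%N -> (j < 40)%N ->
  (bracket_ok (nth [::] Vs i) (nth [::] Vs j)).2 /\ gpair_ok (struct i j) (nth [::] Ls i) (nth [::] Ls j).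
Proof.
move=> i40 j40; have /allP/(_ i) := table_checked; rewrite mem_iota => /(_ i40)/allP/(_ j).
rewrite mem_iota => /(_ j40); rewrite /struct; case: bracket_ok => c b /andP[-> ->]. by [].
Qed.

Lemma sum2 n (c : 'I_n -> K) (F : 'I_n -> vfield K 8) a : (\sum_i c i *: F i).2 a = \sum_i c i *: (F i).2 a.
Proof.
apply: (big_rec2 (fun X x => X.2 a = x)) => [|i x X _ <-]; first by rewrite ffunE.
by rewrite addv2 scalev2.
Qed.
Lemma sum1 n (c : 'I_n -> K) (F : 'I_n -> vfield K 8) : (\sum_i c i *: F i).1 = \sum_i c i *: (F i).1.
Proof. by apply: (big_rec2 (fun X x => X.1 = x)) => [//|i x X _ <-]. Qed.

Lemma bracket_okP V W b : (bracket_ok V W).2 -> (b < 9)%N ->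
  2 *: sden (@env0 K) 8 (nth [::] (lbr 8 V W) b) =
  \sum_(k < 40) zK K (nth Z0 (bracket_ok V W).1 k) *: sden (@env0 K) 8 (nth [::] (nth [::] Vs k) b).
Proof.
move=> + b9; rewrite -lcomb_den; last by rewrite /bracket_ok /ljets; cbn [fst]; rewrite !size_map.
rewrite /bracket_ok; cbn [fst snd] => /allP/(_ b); rewrite mem_iota => /(_ b9)/(nilbP (@env0 K) 8).
rewrite sden_cat !sden_scale zK_neg zK1 scaleN1r => /eqP; rewrite subr_eq0 => /eqP <-.
have sz : size (lbr 8 V W) = 9%N by rewrite size_map size_iota.
have -> : nth [::] [seq norm l | l <- lbr 8 V W] b = norm (nth [::] (lbr 8 V W) b) by rewrite (nth_map [::]) ?sz.
rewrite sden_norm.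
by rewrite (zK_nat K 2).
Qed.

Lemma bracket_basis i j : (i < 40)%N -> (j < 40)%N ->
  vbracket (basis i) (basis j) = \sum_(k < 40) (zK K (nth Z0 (struct i j) k) / 2) *: basis k.
Proof.
move=> i40 j40; have [ok _] := table_okP i40 j40.
rewrite /basis (vbr_den (@env0_smooth K)) /struct.
move: (nth [::] Vs i) (nth [::] Vs j) ok => V W ok.
have n2 : 2 != 0 :> K by rewrite pnatr_eq0.
have C b : (b < 9)%N -> sden (@env0 K) 8 (nth [::] (lbr 8 V W) b) =
    \sum_(k < 40) (zK K (nth Z0 (bracket_ok V W).1 k) / 2) *: sden (@env0 K) 8 (nth [::] (nth [::] Vs k) b).
  move=> b9; apply: (scalerI n2); rewrite (bracket_okP ok b9) scaler_sumr; apply: eq_bigr => k _.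
  by rewrite scalerA mulrC divfK.
apply: vfieldP => [|a]; first by rewrite sum1; exact: (C 0%N).
rewrite sum2 vden2 (C a.+1 (ltn_ord a)); apply: eq_bigr => k _; by rewrite vden2.
Qed.

(* parity *)
Lemma sigma_vproj p X : sigma (vproj p X) = sproj p (sigma X).
Proof.
rewrite -[X]vsym_den vproj_den !sigma_den sden_proj.
have := nilbP (env (vsym X)) 8 (parity_sigma_checked p).
by rewrite sden_cat sden_scale zK_neg zK1 scaleN1r => /eqP; rewrite subr_eq0 => /eqP.
Qed.

Lemma coord_parity p X (k : nat) : (k < 40)%N -> vproj p X = X -> isodd (nth [::] Ls k) != p -> coord k X = 0.
Proof.
move=> k40 pX np; rewrite /coord -pX sigma_vproj.
have /allP/(_ k) := parity_checked; rewrite mem_iota => /(_ k40); move: np.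
move: (isodd _) (nth [::] jets k) => b r np par; rewrite /jet.
suff -> : lin (jetval (sproj p (sigma X))) r = 0 by rewrite mul0r.
elim: r par => [|[[A o] c] r IH]; first by rewrite lin_nil.
move=> /andP[/eqP pA /IH E]; rewrite lin_cons E addr0; cbn [fst snd] in pA; cbn [fst snd].
rewrite /jetval; cbn [fst snd]; rewrite ffunE -popoddE pA (negbTE np).
by rewrite derive1n0_cst scaler0.
Qed.
End Basis.

Section Isomorphism.
Variables (K : numFieldType) (ii : K).
Hypothesis ii2 : ii * ii = -1.
Hypothesis entire_derive : forall f : K -> K, (forall z : K, derivable f z 1) ->
  forall z : K, derivable (derive1 f) z 1.
Hypothesis derive0_const : forall f : K -> K, (forall z : K, derivable f z 1) ->
  (forall z, derive1 f z = 0) -> forall z, f z = f 0.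
Implicit Types X Y : vfield K 8.
Local Notation L := (L ii).

Definition phi X : f4_ambient K := \sum_(k < 40) (coord k X / 4) *: L k.

Lemma n4 : 4 != 0 :> K. Proof. by rewrite pnatr_eq0. Qed.

Lemma phi_lin k X Y : inf_MCQ X -> inf_MCQ Y -> phi (k *: X + Y) = k *: phi X + phi Y.
Proof.
move=> hX hY; rewrite /phi scaler_sumr -big_split; apply: eq_bigr => i _.
rewrite (coord_lin entire_derive i k (inf_holo hX) (inf_holo hY)) mulrDl scalerDl -mulrA -scalerA; reflexivity.
Qed.

Lemma f4_set_sum n (c : 'I_n -> K) (F : 'I_n -> f4_ambient K) : (forall i, f4_set (F i)) -> f4_set (\sum_i c i *: F i).
Proof.
move=> hF.
have f0 : f4_set (0 : f4_ambient K) by have := f4_set_lin (-1) (@L_mem K ii _ (isT : 0 < 40)%N) (@L_mem K ii _ (isT : 0 < 40)%N); rewrite scaleN1r addNr.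
apply: big_ind => [//|a b ha hb|i _]; first by have := f4_set_lin 1 ha hb; rewrite scale1r.
by have := f4_set_lin (c i) (hF i) f0; rewrite addr0.
Qed.

Lemma phi_mem X : f4_set (phi X).
Proof. by apply: f4_set_sum => i; apply: L_mem. Qed.

Lemma gdual_phi j X : (j < 40)%N -> gdual ii (nth [::] Ls j) (phi X) = coord j X / 4 * zK K (gnorm (nth [::] Ls j)).
Proof.
move=> j40; rewrite /phi gdual_sum (bigD1 (Ordinal j40)) //= gdual_L // eqxx big1 ?addr0 //.
move=> k /eqP kj; rewrite gdual_L //; case: eqP => [E|_]; last by rewrite mulr0.
by case: kj; apply: val_inj.
Qed.

Lemma phi_inj X Y : inf_MCQ X -> inf_MCQ Y -> phi X = phi Y -> X = Y.
Proof.
move=> hX hY E; rewrite (inf_expand entire_derive derive0_const hX) (inf_expand entire_derive derive0_const hY).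
apply: eq_bigr => j _; congr (_ *: _).
have := congr1 (gdual ii (nth [::] Ls j)) E; rewrite !gdual_phi // => /(mulIf (gnorm_neq0 _ (ltn_ord j))).
by apply: mulIf; rewrite invr_eq0 n4.
Qed.

Lemma basis_infO (i : 'I_40) : inf_MCQ (basis K i). Proof. exact: basis_inf. Qed.

Lemma phi_sum (c : 'I_40 -> K) : phi (\sum_k c k *: basis K k) = \sum_k (c k / 4) *: L k.
Proof.
rewrite /phi; apply: eq_bigr => j _; congr ((_ / _) *: _).
rewrite (coord_sum entire_derive) => [|k]; last exact: basis_infO.
rewrite (bigD1 j) //= coord_basis // eqxx mulr1 big1 ?addr0 // => k /eqP kj.
by rewrite coord_basis //; case: eqP => [E|_]; [case: kj; apply: val_inj|rewrite mulr0].
Qed.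

Lemma phi_surj a : f4_set a -> exists2 X, inf_MCQ X & phi X = a.
Proof.
move=> /(proj_id ii2) E.
have n2304 : 2304 != 0 :> K by rewrite pnatr_eq0.
pose c (k : 'I_40) := zK K (gweight (nth [::] Ls k)) * gdual ii (nth [::] Ls k) a.
exists (\sum_k (4 / 2304 * c k) *: basis K k); first by apply: inf_sum => // k; exact: basis_infO.
rewrite phi_sum; apply: (scalerI n2304); rewrite -E /proj scaler_sumr; apply: eq_bigr => k _.
rewrite scalerA; congr (_ *: _); rewrite -/(c k).
have cancel (u v x : K) : u != 0 -> v != 0 -> u * (v / u * x / v) = x.
  by move=> u0 v0; field; rewrite u0 v0.
exact: cancel n2304 n4.
Qed.

Lemma phi_homog p X : vproj p X = X -> f4_homog p (phi X).
Proof.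
move=> pX; rewrite /phi /f4_homog /classical_sets.mkset.
have T (k : 'I_40) : let Z := (coord k X / 4) *: L k in if p then Z.1 = 0 else Z.2 = 0.
  have := L_homog ii (ltn_ord k); rewrite /f4_homog /classical_sets.mkset.
  case: (eqVneq (isodd (nth [::] Ls k)) p) => [->|np _] /=.
    by case: p {pX} => E; rewrite E scaler0.
  by rewrite (coord_parity (ltn_ord k) pX np) mul0r; case: p {pX np}; rewrite scale0r.
apply: (big_ind (fun Z : f4_ambient K => if p then Z.1 = 0 else Z.2 = 0)) => [|a b|k _]; last exact: T.
  by case: p {pX T}.
by case: p {pX T} => /= -> ->; rewrite addr0.
Qed.

Lemma vbracket_sum (a b : 'I_40 -> K) :
  vbracket (\sum_i a i *: basis K i) (\sum_j b j *: basis K j) = \sum_i \sum_j (a i * b j) *: vbracket (basis K i) (basis K j).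
Proof.
have z0 Z : vbracket 0 Z = 0 :> vfield K 8.
  by have := vbracket_linl (-1) Z (inf_holo (inf_0 entire_derive)) (inf_holo (inf_0 entire_derive)); rewrite scaler0 add0r scaleN1r addNr.
have z1 Z : vbracket Z 0 = 0 :> vfield K 8.
  by have := vbracket_linr (-1) Z (inf_holo (inf_0 entire_derive)) (inf_holo (inf_0 entire_derive)); rewrite scaler0 add0r scaleN1r addNr.
suff [] : vholomorphic (\sum_i a i *: basis K i) /\ vbracket (\sum_i a i *: basis K i) (\sum_j b j *: basis K j) =
   \sum_i \sum_j (a i * b j) *: vbracket (basis K i) (basis K j) by [].
apply: (big_rec2 (fun X Z => vholomorphic X /\ vbracket X (\sum_j b j *: basis K j) = Z)) => [|i Z X _ [hX <-]].
  by split; [exact: (inf_holo (inf_0 entire_derive))|].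
have hi := inf_holo (basis_infO i).
split; first exact: vholomorphic_lin.
rewrite (vbracket_linl (a i) _ hi hX); congr (_ + _).
suff [] : vholomorphic (\sum_j b j *: basis K j) /\ a i *: vbracket (basis K i) (\sum_j b j *: basis K j) =
   \sum_j (a i * b j) *: vbracket (basis K i) (basis K j) by [].
apply: (big_rec2 (fun X Z => vholomorphic X /\ a i *: vbracket (basis K i) X = Z)) => [|j Z' Y _ [hY <-]].
  by split; [exact: (inf_holo (inf_0 entire_derive))|rewrite z1 scaler0].
split; first exact: vholomorphic_lin (inf_holo (basis_infO j)) hY.
by rewrite (vbracket_linr (b j) _ (inf_holo (basis_infO j)) hY) scalerDr scalerA.
Qed.

Lemma phi_bracket X Y : inf_MCQ X -> inf_MCQ Y ->
  inf_MCQ (vbracket X Y) /\ phi (vbracket X Y) = f4_bracket (phi X) (phi Y).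
Proof.
move=> hX hY; have E := inf_expand entire_derive derive0_const.
have V : vbracket X Y = \sum_(k < 40) (\sum_(i < 40) \sum_(j < 40) coord i X * coord j Y * (zK K (nth Z0 (struct i j) k) / 2)) *: basis K k.
  rewrite {1}(E X hX) {1}(E Y hY) vbracket_sum.
  under [RHS]eq_bigr => k _ do (rewrite scaler_suml; under eq_bigr => i _ do rewrite scaler_suml).
  rewrite [RHS]exchange_big; apply: eq_bigr => i _; rewrite [RHS]exchange_big; apply: eq_bigr => j _.
  by rewrite bracket_basis // scaler_sumr; apply: eq_bigr => k _; rewrite scalerA.
rewrite V; split; first by apply: inf_sum => // k; exact: basis_infO.
rewrite phi_sum /phi f4_bracket_sum.
under [LHS]eq_bigr => k _ do (rewrite mulr_suml scaler_suml; under eq_bigr => i _ do rewrite mulr_suml scaler_suml).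
rewrite [LHS]exchange_big; apply: eq_bigr => i _; rewrite [LHS]exchange_big; apply: eq_bigr => j _.
have [_ ok] := table_okP (ltn_ord i) (ltn_ord j).
rewrite (gpair_okP ii2 (struct_size i j) (ltn_ord i) (ltn_ord j) ok) !scaler_sumr; apply: eq_bigr => k _.
rewrite !scalerA; congr (_ *: _); by field.
Qed.

Theorem inf_iso_F4 : superalgebra_iso (inf_superalgebra K) (F4 K).
Proof.
exists phi; split.
- split=> [X hX|X Y /set_mem hX /set_mem hY|a /phi_surj[X hX <-]]; [exact: phi_mem|exact: phi_inj|by exists X].
- move=> k X Y hX hY; split; [exact: inf_lin|exact: phi_lin].
- by move=> p X _ pX; apply: phi_homog.
- exact: phi_bracket.
Qed.
End Isomorphism.
End Isomorphism.
Import Isomorphism.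

Import numFieldNormedType.Exports.
Local Open Scope ring_scope.

Lemma entire_cst (R : realType) (f : CF R -> CF R) : (forall z : CF R, derivable f z 1) ->
  (forall z, derive1 f z = 0) -> forall z, f z = f 0.
Proof.
move=> df f0 z; apply: deriv0_cst => w; apply: DeriveDef; first exact: df.
by rewrite -derive1E f0.
Qed.

Theorem theorem6p9 (R : realType) :
  superalgebra_iso (inf_superalgebra R[i]) (F4 R[i]).
Proof.
have i2 : ('i%C : CF R) * 'i%C = -1 by rewrite -expr2; exact: sqr_i.
exact: (inf_iso_F4 i2 (@entire_derivable R) (@entire_cst R)).
Qed.
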